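(* Consider the jump-diffusion process $X$ described in the context, with coefficients $\gamma,\sigma,\lambda$ and jump density $f$ satisfying the conditions listed there. For each fixed $T>0$ there exists $h_0:=h_0(T)>0$ such that, for any $t\in[0,T]$ and $h\in(0,h_0)$, the optimal threshold $B^*_{t,h}$ based on the increment $X_{t+h}-X_t$ (the unique global minimum point of the loss function $L_{t,h}$ defined in the context) satisfies $$B^*_{t,h}=h\overline{\gamma}_{t,h}+\sqrt{2h\overline{\sigma}^2_{t,h}}\left[\ln\left(1+\exp\left(\frac{-2B^*_{t,h}\overline{\gamma}_{t,h}}{\overline{\sigma}^2_{t,h}}\right)\right)-\ln\left(\sqrt{2\pi h\overline{\sigma}^2_{t,h}}\sum_{k=1}^\infty\frac{(h\overline{\lambda}_{t,h})^k}{k!}\left[\phi_{t,h}*f^{*k}(B^*_{t,h})+\phi_{t,h}*f^{*k}(-B^*_{t,h})\right]\right)\right]^{1/2}.$$ Furthermore, as $h\to0$, $$B^*_{t,h}=\sqrt{h}\,\overline{\sigma}_{t,h}\left[3\log(1/h)-2\log\left(\sqrt{2\pi}\,\mathcal{C}_0(f)\,\overline{\sigma}_{t,h}\overline{\lambda}_{t,h}\right)\right]^{1/2}+o\left(h^{\frac12+\alpha}\right)$$ for any $\alpha\in(0,1/2)$. If, furthermore, $t\mapsto\sigma_t^2$ and $t\mapsto\lambda_t$ belong to $C^1((0,T))$ and are continuous on $[0,T]$, then the last asymptotics remains true if $\overline{\sigma}_{t,h}$ and $\overline{\lambda}_{t,h}$ are replaced with $\sigma_t$ and $\lambda_t$,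 respectively.
   Context: Model: $X_t=X^c_t+J_t$, $X^c_t=\int_0^t\gamma_u\,du+\int_0^t\sigma_u\,dW_u$, $J_t=\sum_{j=1}^{N_t}\zeta_j$, where $W$ is a Wiener process, $N$ is a non-homogeneous Poisson process with intensity function $\{\lambda_t\}_{t\ge0}$, and $\{\zeta_j\}_{j\ge1}$ are i.i.d. with density $f$; $W$, $N$ and $\{\zeta_j\}$ are independent (in particular $X^c$ and $J$ are independent). Conditions on the coefficients: $\gamma:[0,\infty)\to\mathbb{R}$, $\sigma:[0,\infty)\to\mathbb{R}^+$, $\lambda:[0,\infty)\to\mathbb{R}^+$ are deterministic functions (such that the integrals above are well defined) and, for any fixed $t>0$, $0<\inf_{0\le s\le t}\sigma_s\le\sup_{0\le s\le t}\sigma_s<\infty$, $0<\inf_{0\le s\le t}\gamma_s\le\sup_{0\le s\le t}\gamma_s<\infty$, $0<\inf_{0\le s\le t}\lambda_s\le\sup_{0\le s\le t}\lambda_s<\infty$. Moreover $t\mapsto\sigma_t$ is continuous. Conditions on the jump density: $f(x)=p f_+(x)\mathbf{1}_{[x\ge0]}+q f_-(x)\mathbf{1}_{[x<0]}$ with $p\in[0,1]$, $q=1-p$, where $f_+:[0,\infty)\to[0,\infty)$ and $f_-:(-\infty,0]\to[0,\infty)$ are bounded, $\int_0^\infty f_+(x)dx=\int_{-\infty}^0 f_-(x)dx=1$, and $f_\pm(0)=\lim_{x\to0^\pm}f_\pm(x)\in(0,\infty)$. In addition, $f_+\in C^1([0,b))$ and $f_-\in C^1((a,0])$ for some $a\in(-\infty,0)$,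 $b\in(0,\infty)$, and the limits $f'_\pm(0):=\lim_{x\to0^\pm}f'_\pm(x)$ exist. Notation: $\overline{\sigma}^2_{t,h}=\frac1h\int_t^{t+h}\sigma_u^2du$ (with $\overline{\sigma}_{t,h}>0$ its square root), $\overline{\gamma}_{t,h}=\frac1h\int_t^{t+h}\gamma_udu$, $\overline{\lambda}_{t,h}=\frac1h\int_t^{t+h}\lambda_udu$; $\phi$ is the standard normal density; $\phi_{t,h}(x)=\frac{1}{\overline{\sigma}_{t,h}\sqrt h}\phi\left(\frac{x-h\overline{\gamma}_{t,h}}{\overline{\sigma}_{t,h}\sqrt h}\right)$ is the density of $X^c_{t+h}-X^c_t$; $*$ is convolution and $f^{*k}$ the $k$-fold convolution of $f$; $\mathcal{C}_0(f):=\lim_{\varepsilon\to0^+}\frac{1}{2\varepsilon}\int_{-\varepsilon}^{\varepsilon}f(x)dx=\frac12\left(pf_+(0)+qf_-(0)\right)$. Loss function: $L_{t,h}(B)=\mathbb{P}(|X_{t+h}-X_t|>B,\,N_{t+h}-N_t=0)+\mathbb{P}(|X_{t+h}-X_t|\le B,\,N_{t+h}-N_t\ne0)$, $B\ge0$. For $T>0$ fixed, all sufficiently small $h$ and all $t\in[0,T]$, this function has a unique global minimum point, denoted $B^*_{t,h}$.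
   Formalization: The last asymptotics, with σ_t and λ_t in place of the averages, is stated for t in (0,T) (uniformly on compact subintervals), not at t=0 or t=T, where it can fail: e.g. σ_t²=1+t^{1/4} at t=0 gives an error of order h^{3/4}√log(1/h). *)

(* Defs.v *)
From HB Require Import structures.
From mathcomp Require Import all_boot all_order all_algebra.
From mathcomp Require Import all_classical all_reals all_analysis.

Set Implicit Arguments.
Unset Strict Implicit.
Unset Printing Implicit Defensive.

Import Order.TTheory GRing.Theory Num.Theory.
Import numFieldNormedType.Exports.

Local Open Scope classical_set_scope.
Local Open Scope ring_scope.

Section independence.
Context {d : measure_display} {Omega : measurableType d} {R : realType}.
Variable P : probability Omega R.

Definition mutually_independent {d'} {E : measurableType d'}
    (X : nat -> Omega -> E) : Prop :=
  forall (s : seq nat) (A : nat -> set E), uniq s ->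
    (forall i, measurable (A i)) ->
    P (\bigcap_(i in [set` s]) (X i @^-1` A i)) =
    (\prod_(i <- s) P (X i @^-1` A i))%E.

Definition generated_sigma_algebra {I : Type} {d'} {E : measurableType d'}
    (D : set I) (X : I -> Omega -> E) : set (set Omega) :=
  <<s [set X i @^-1` A | i in D & A in (measurable : set (set E))] >>.

Definition independent3 (F G H : set (set Omega)) : Prop :=
  forall A B C, F A -> G B -> H C ->
    P (A `&` B `&` C) = (P A * P B * P C)%E.

(* Infinite nondecreasing sequences of times suffice: a finite one is extended
   by repeating its last term. *)
Definition independent_increments (X : R -> Omega -> R) : Prop :=
  forall u : nat -> R, 0 <= u 0%N -> (forall i, u i <= u i.+1) ->
    mutually_independent (fun i w => X (u i.+1) w - X (u i) w).

Definition iid_with_density (f : R -> R) (zeta : nat -> {RV P >-> R}) : Prop :=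
  (forall j (A : set R), measurable A ->
     P (zeta j @^-1` A) = (\int[lebesgue_measure]_(x in A) (f x)%:E)%E) /\
  mutually_independent (fun j => zeta j : Omega -> R).

End independence.

Section processes.
Context {d : measure_display} {Omega : measurableType d} {R : realType}.
Variable P : probability Omega R.

(* Time is indexed by the whole of R, but only times t >= 0 are constrained. *)

Record wiener_process (W : R -> {RV P >-> R}) : Prop := WienerProcess {
  wiener_start : {ae P, forall w, W 0 w = 0};
  wiener_paths :
    {ae P, forall w, {within `[0, +oo[, continuous (fun t => W t w)}};
  wiener_indep : independent_increments P (fun t => W t : Omega -> R);
  wiener_normal : forall s t, 0 <= s -> s < t ->
    forall A : set R, measurable A ->
      P [set w | A (W t w - W s w)] = normal_prob 0 (Num.sqrt (t - s)) A }.

Record poisson_process (lambda : R -> R) (N : R -> {RV P >-> nat}) : Prop :=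
    PoissonProcess {
  poisson_start : {ae P, forall w, N 0 w = 0%N};
  poisson_paths : {ae P, forall w,
    (forall s t, 0 <= s -> s <= t -> (N s w <= N t w)%N) /\
    (forall t, 0 <= t ->
      (N u w)%:R @[u --> t^'+] --> ((N t w)%:R : R))};
  poisson_indep : independent_increments P (fun t w => (N t w)%:R);
  poisson_law : forall s t, 0 <= s -> s < t -> forall k : nat,
    P [set w | N t w = (N s w + k)%N] =
    (poisson_pmf (\int[lebesgue_measure]_(u in `[s, t]) lambda u) k)%:E }.

Definition step_function (n : nat) (u c : nat -> R) (x : R) : R :=
  \sum_(i < n) c i * \1_(`]u i, u i.+1] : set R) x.

Definition step_integral (W : R -> Omega -> R) (n : nat) (u c : nat -> R)
    (w : Omega) : R :=
  \sum_(i < n) c i * (W (u i.+1) w - W (u i) w).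

(* Y is (a version of) the Wiener integral of the square-integrable function g
   over [0, t]: the common L^2(P)-limit of the integrals of step functions
   that approximate g in L^2([0, t]). *)
Definition is_wiener_integral (W : R -> Omega -> R) (g : R -> R) (t : R)
    (Y : Omega -> R) : Prop :=
  forall (n : nat -> nat) (u c : nat -> nat -> R),
    (forall m, 0 <= u m 0%N /\ (forall i, u m i <= u m i.+1) /\
               u m (n m) <= t) ->
    (\int[lebesgue_measure]_(x in `[0%R, t])
        ((step_function (n m) (u m) (c m) x - g x) ^+ 2)%:E)%E
      @[m --> \oo] --> 0%E ->
    'E_P[(fun w => (step_integral W (n m) (u m) (c m) w - Y w) ^+ 2)%R]%E
      @[m --> \oo] --> 0%E.

(* X_t = \int_0^t gamma_u du + I_t + \sum_(j <= N_t) zeta_j, where I is the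
   Wiener integral process; the jump sizes are numbered from 0. *)
Definition jump_diffusion (gamma : R -> R) (I : R -> Omega -> R)
    (N : R -> Omega -> nat) (zeta : nat -> Omega -> R) (t : R) (w : Omega) : R :=
  \int[lebesgue_measure]_(u in `[0, t]) gamma u + I t w +
  \sum_(j < N t w) zeta j w.

Definition loss (X : R -> Omega -> R) (N : R -> Omega -> nat) (t h B : R)
    : \bar R :=
  (P [set w | B < `|X (t + h) w - X t w| /\ N (t + h) w = N t w]%R +
   P [set w | `|X (t + h) w - X t w| <= B /\ N (t + h) w <> N t w]%R)%E.

Definition unique_global_minimum (L : R -> \bar R) (B : R) : Prop :=
  0 <= B /\ forall B', 0 <= B' -> B' <> B -> (L B < L B')%E.

End processes.

Section coefficients.
Context {R : realType}.

(* 0 < inf_[0,t] g <= sup_[0,t] g < +oo for every t > 0 *)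
Definition locally_bounded_away (g : R -> R) : Prop :=
  forall t, 0 < t ->
    (0 < ereal_inf [set (g s)%:E | s in `[0%R, t]])%E /\
    (ereal_sup [set (g s)%:E | s in `[0%R, t]] < +oo)%E.

(* C^1 on an interval D that may contain its endpoints; derivatives at
   endpoints belonging to D are one-sided. *)
Definition C1_on (D : set R) (f : R -> R) : Prop :=
  exists2 g : R -> R, {within D, continuous g} &
    forall x, D x -> (f y - f x) / (y - x) @[y --> within D x^'] --> g x.

(* D is a half-line ending at 0 and F the one-sided punctured filter at 0. *)
Record one_sided_density (D : set R) (F : set_system R) (f : R -> R) : Prop :=
    OneSidedDensity {
  osd_measurable : measurable_fun D f;
  osd_ge0 : forall x, D x -> 0 <= f x;
  osd_bounded : exists M, forall x, D x -> f x <= M;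
  osd_integral : (\int[lebesgue_measure]_(x in D) (f x)%:E)%E = 1%E;
  osd_gt0 : 0 < f 0;
  osd_lim : f x @[x --> F] --> f 0;
  osd_derive_lim : cvg (derive1 f x @[x --> F]) }.

Definition mixture_density (p : R) (fp fm : R -> R) (x : R) : R :=
  p * fp x * \1_(`[0, +oo[ : set R) x + (1 - p) * fm x * \1_(`]-oo, 0[ : set R) x.

Definition average (g : R -> R) (t h : R) : R :=
  h^-1 * \int[lebesgue_measure]_(u in `[t, t + h]) g u.

Definition sigma_bar (sigma : R -> R) (t h : R) : R :=
  Num.sqrt (average (fun u => sigma u ^+ 2) t h).

Definition phi_th (gamma sigma : R -> R) (t h x : R) : R :=
  (sigma_bar sigma t h * Num.sqrt h)^-1 *
  normal_pdf 0 1 ((x - h * average gamma t h) /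
                  (sigma_bar sigma t h * Num.sqrt h)).

Definition convolution (f g : R -> R) (x : R) : R :=
  \int[lebesgue_measure]_y (f (x - y) * g y).

(* f^{*k}, for k >= 1 *)
Definition convolution_power (f : R -> R) (k : nat) : R -> R :=
  iter k.-1 (convolution f) f.

Definition C0 (f : R -> R) : R :=
  lim ((2 * e)^-1 * \int[lebesgue_measure]_(x in `[- e, e]) f x @[e --> 0^'+]).

Definition threshold_rhs (gamma sigma lambda f : R -> R) (t h B : R) : R :=
  let gb := average gamma t h in
  let sb := sigma_bar sigma t h in
  let lb := average lambda t h in
  let phi := phi_th gamma sigma t h in
  h * gb + Num.sqrt (2 * h * sb ^+ 2) *
    Num.sqrt (ln (1 + expR (- 2 * B * gb / sb ^+ 2)) -
      ln (Num.sqrt (2 * pi * h * sb ^+ 2) *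
          \big[+%R/0]_(1 <= k <oo) ((h * lb) ^+ k / k`!%:R *
            (convolution phi (convolution_power f k) B +
             convolution phi (convolution_power f k) (- B))))).

Definition threshold_leading (f : R -> R) (h s l : R) : R :=
  Num.sqrt h * s *
  Num.sqrt (3 * ln (1 / h) - 2 * ln (Num.sqrt (2 * pi) * C0 f * s * l)).

End coefficients.

(* Main.v *)
(** Given k jumps in [t, t + h], the increment of X has density phi * f^{*k},
    where phi = phi_{t,h} is a normal density of mean c = h gbar and variance
    s^2 = h sbar^2. Hence, with La = h lbar and
    H = sum_{k >= 1} (La^k / k!) phi * f^{*k}, the loss at B equals
      e^{-La} (1 + int_{-B}^{B} (H - phi)).
    The integrand is continuous, so phi(B) + phi(-B) = H(B) + H(-B) at a minimum
    point B > 0. Moreover phi(B) = O(h) at a minimum, which excludes B <= c;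
    solving the equation for the exponent (B - c)^2 / (2 s^2) of phi(B) gives the
    exact formula. For the asymptotics, comparing the losses at B and at h^beta,
    beta < 1/2, shows B < 2 h^beta. Since f is Lipschitz at 0 on either side,
    H(B) + H(-B) = La (2 C_0(f) + O(h^beta)), and taking logarithms gives
    (B - c)^2 / s^2 up to O(h^beta). The last claim follows from the mean value
    theorem, as sbar and lbar are then O(h)-close to sigma_t and lambda_t. *)
Require Import Defs.
From HB Require Import structures.
From mathcomp Require Import all_boot all_order all_algebra.
From mathcomp Require Import all_classical all_reals all_analysis.
From mathcomp Require Import measurable_realfun.
From mathcomp Require Import ring lra zify.

Set Implicit Arguments.
Unset Strict Implicit.
Unset Printing Implicit Defensive.

Import Order.TTheory GRing.Theory Num.Theory.
Import numFieldNormedType.Exports.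

Local Open Scope classical_set_scope.
Local Open Scope ring_scope.

(** The Wiener integral is known only as an L^2 limit of step integrals; neither the law of its
    increments nor their independence of the jumps is assumed. Both are proved for step integrals
    whose coefficients are root mean squares of [sigma] over the cells. These have the limiting
    variance exactly, so the identity passed to the limit in probability is the same for every
    index.

    Since f may be discontinuous at 0, phi * f^{*1} at B is compared with a one-sided limit of f.
    The Gaussian mass that reaches the other side of 0 is of the order of the square root of s
    phi(B), so the bound phi(B) = O(h) at a minimum also controls this error.

    Uniformity in t is obtained by forgetting t: after the loss formula the averages become three
    numbers in fixed compact ranges, and each estimate holds for all small h simultaneously for all
    such numbers. In the asymptotics beta is taken between alpha and 1/2, so that the error sqrt(h)
    h^beta is o(h^(1/2 + alpha)). *)

(** * Changes of variable and measures with a density *)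

Definition pushforward_measure d1 d2 (T1 : measurableType d1)
  (T2 : measurableType d2) (R : realType) (m : {measure set T1 -> \bar R})
  (f : T1 -> T2) (mf : measurable_fun setT f) : {measure set T2 -> \bar R}.
Proof. refine (pushforward m f); exact: mf. Defined.

Lemma preimage_measurable d1 d2 (T1 : measurableType d1)
    (T2 : measurableType d2) (f : T1 -> T2) (A : set T2) :
  measurable_fun setT f -> measurable A -> measurable (f @^-1` A).
Proof. by move=> mf mA; rewrite -[X in measurable X]setTI; exact: mf. Qed.

(** As a function of [A] the left side is a measure giving each half-open interval its length, so
    uniqueness of the Lebesgue measure applies. *)
Lemma lebesgue_measure_affine (R : realType) (a c : R) (A : set R) :
  0 < a -> measurable A ->
  (a%:E * lebesgue_measure ((fun x : R => a * x + c)%R @^-1` A))%E =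
  lebesgue_measure A.
Proof.
move=> a0 mA.
have mf : measurable_fun [set: measurableTypeR R]
    ((fun x => a * x + c) : measurableTypeR R -> measurableTypeR R).
  by apply: measurable_funD => //; exact: measurable_funM.
pose m := mscale (NngNum (ltW a0)) (pushforward_measure lebesgue_measure mf).
rewrite -[LHS]/(m A); apply/esym/lebesgue_measure_unique => //= _ [[u v]] _ <-.
rewrite /m /mscale/= /pushforward.
rewrite (_ : _ @^-1` _ = `](u - c) / a, (v - c) / a]%classic); last first.
  apply/seteqP; split => x /=; rewrite !in_itv/= ltr_pdivrMr// ler_pdivlMr//;
  by rewrite (mulrC x) ltrBlDr lerBrDr.
rewrite !lebesgue_measure_itv/= !lte_fin ltr_pM2r ?invr_gt0// ltrD2r.
case: ifPn => uv; last by rewrite mule0.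
by rewrite -!EFinB -EFinM -mulrBl mulrC divfK ?gt_eqF// opprB addrA subrK.
Qed.

Lemma ge0_integral_affine (R : realType) (a c : R) (A : set R) (g : R -> R) :
  0 < a -> measurable A -> measurable_fun setT g -> (forall x, 0 <= g x) ->
  (\int[lebesgue_measure]_(x in (fun x : R => a * x + c)%R @^-1` A) (g x)%:E)%E =
  (\int[lebesgue_measure]_(x in A) (a^-1 * g ((x - c) / a))%:E)%E.
Proof.
move=> a0 mA mg g0.
have mf : measurable_fun [set: measurableTypeR R]
    ((fun x => a * x + c) : measurableTypeR R -> measurableTypeR R).
  by apply: measurable_funD => //; exact: measurable_funM.
have mg' : measurable_fun [set: measurableTypeR R]
    (fun x : R => (a^-1 * g ((x - c) / a))%:E : \bar R).
  apply/measurable_EFinP; apply: measurable_funM => //.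
  apply: measurableT_comp => //; apply: measurable_funM => //.
  exact: measurable_funB.
pose m := mscale (NngNum (ltW a0)) (pushforward_measure lebesgue_measure mf).
have ge0 x : (0 <= (a^-1 * g ((x - c) / a))%:E)%E.
  by rewrite lee_fin mulr_ge0// invr_ge0 ltW.
(* The scaled pushforward [m] agrees with the Lebesgue measure on measurable sets, and integrals
   against it can be pulled back along the affine map. *)
transitivity (\int[m]_(x in A) (a^-1 * g ((x - c) / a))%:E)%E; last first.
  by apply: eq_measure_integral => B mB _; exact: lebesgue_measure_affine.
rewrite ge0_integral_mscale//; last exact: measurable_funTS.
rewrite /pushforward_measure/= ge0_integral_pushforward//; last exact: measurable_funTS.
rewrite -ge0_integralZl//=; first last.
- by rewrite lee_fin ltW.
- by apply: measurable_funTS; apply: measurableT_comp mg' mf.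
- by apply: preimage_measurable; first exact: mf.
apply: eq_integral => x _ /=; rewrite -EFinM addrK mulrA divff ?gt_eqF// mul1r.
by rewrite mulrAC divff ?gt_eqF// mul1r.
Qed.

Section measure_with_density.
Context d (T : measurableType d) (R : realType) (mu : {measure set T -> \bar R}).
Variable g : T -> R.
Hypotheses (mg : measurable_fun setT g) (g0 : forall x, 0 <= g x).

(** The two proofs are arguments of the term so that the measure structure declared below can be
    inferred from it. *)
Definition density_measure of measurable_fun setT g & (forall x, 0 <= g x) :=
  fun A : set T => (\int[mu]_(x in A) (g x)%:E)%E.

Local Notation nu := (density_measure mg g0).

Let nu0 : nu set0 = 0%E.
Proof. exact: integral_set0. Qed.

Let nu_ge0 A : (0 <= nu A)%E.
Proof. by apply: integral_ge0 => x _; rewrite lee_fin. Qed.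

Let nu_sigma_additive : semi_sigma_additive nu.
Proof.
move=> /= A mA tA mUA; rewrite /density_measure ge0_integral_bigcup//=.
- by apply: is_cvg_ereal_nneg_natsum_cond => n _ _; exact: nu_ge0.
- exact/measurable_EFinP/measurable_funTS.
- by move=> x _; rewrite lee_fin.
Qed.

HB.instance Definition _ := isMeasure.Build _ _ _ nu
  nu0 nu_ge0 nu_sigma_additive.

End measure_with_density.

(** The bound makes convolutions finite at every point rather than almost everywhere, and a
    convolution inherits it from its left factor. *)
Record bounded_density (R : realType) (M : R) (g : R -> R) : Prop :=
  BoundedDensity {
    bd_measurable : measurable_fun setT g ;
    bd_ge0 : forall x, 0 <= g x ;
    bd_le : forall x, g x <= M ;
    bd_integral : (\int[lebesgue_measure]_x (g x)%:E = 1)%E }.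

(** * Convolutions as densities of sums of independent variables *)

Section convolution_density.
Context {R : realType}.
Local Notation mu := (@lebesgue_measure R).
Implicit Types g : R -> R.

Lemma measurable_convolution_integrand g1 g2 :
  measurable_fun setT g1 -> measurable_fun setT g2 ->
  measurable_fun [set: R * R] (fun z => g1 (z.1 - z.2) * g2 z.2).
Proof.
move=> m1 m2; apply: measurable_funM; apply: measurableT_comp => //.
by apply: measurable_funB.
Qed.

(** A real-valued integral sends infinite values to 0, so finiteness must be proved: [g1 <= M]
    dominates the integrand by a multiple of the integrable [g2]. *)
Lemma convolutionE M g1 g2 x : bounded_density M g1 ->
  measurable_fun setT g2 -> (forall y, 0 <= g2 y) ->
  (\int[mu]_y (g2 y)%:E < +oo)%E ->
  (\int[mu]_y (g1 (x - y) * g2 y)%:E)%E = (convolution g1 g2 x)%:E.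
Proof.
move=> d1 m2 g20 i2; rewrite /convolution /Rintegral fineK//.
have M0 : 0 <= M by rewrite (le_trans (bd_ge0 d1 0))// (bd_le d1).
have m1x : measurable_fun setT (fun y : R => g1 (x - y)).
  apply: measurableT_comp; first exact: bd_measurable d1.
  exact: measurable_funB.
rewrite ge0_fin_numE; last first.
  by apply: integral_ge0 => y _; rewrite lee_fin mulr_ge0// (bd_ge0 d1).
apply: (@le_lt_trans _ _ (\int[mu]_y (M * g2 y)%:E)%E).
  apply: ge0_le_integral => //.
  - by move=> y _; rewrite lee_fin mulr_ge0// (bd_ge0 d1).
  - by apply/measurable_EFinP; exact: measurable_funM.
  - by apply/measurable_EFinP; exact: measurable_funM.
  - by move=> y _; rewrite lee_fin ler_wpM2r// (bd_le d1).
under eq_integral do rewrite EFinM.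
rewrite ge0_integralZl//; first by rewrite lte_mul_pinfty.
- exact/measurable_EFinP.
- by move=> y _; rewrite lee_fin.
Qed.

Lemma ge0_integral_shift_indic g (A : set R) y :
  measurable A -> measurable_fun setT g -> (forall x, 0 <= g x) ->
  (\int[mu]_x (g x * \1_((fun x : R => x + y) @^-1` A) x)%:E)%E =
  (\int[mu]_(x in A) (g (x - y))%:E)%E.
Proof.
move=> mA mg g0.
have mB : measurable ((fun x : R => x + y) @^-1` A).
  by apply: preimage_measurable => //; exact: measurable_funD.
transitivity (\int[mu]_(x in (fun x : R => x + y)%R @^-1` A) (g x)%:E)%E.
  by rewrite [RHS]integral_mkcond epatch_indic.
have -> : (fun x => x + y) = (fun x => 1 * x + y).
  by apply/funext => x; rewrite mul1r.
rewrite ge0_integral_affine//; apply: eq_integral => x _.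
by rewrite invr1 mul1r mulr1.
Qed.

End convolution_density.

Section independent_sum.
Context d (Omega : measurableType d) {R : realType} (P : probability Omega R).
Local Notation mu := (@lebesgue_measure R).

(** The event [F] will fix the jump counts at the two ends of the time window. On [F] the joint law
    of [X] and [Y] is a product density times [P F], first on rectangles and hence on the set where
    the sum lies in [A]. *)
Lemma independent_sum_density M (X Y : Omega -> R) (F : set Omega)
    (g1 g2 : R -> R) :
  measurable_fun setT X -> measurable_fun setT Y -> measurable F ->
  bounded_density M g1 -> measurable_fun setT g2 -> (forall y, 0 <= g2 y) ->
  (\int[mu]_y (g2 y)%:E < +oo)%E ->
  (forall A C : set R, measurable A -> measurable C ->
    P (X @^-1` A `&` Y @^-1` C `&` F) =
    (\int[mu]_(x in A) (g1 x)%:E * \int[mu]_(y in C) (g2 y)%:E * P F)%E) ->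
  forall A : set R, measurable A ->
    P ((fun w => X w + Y w) @^-1` A `&` F) =
    (\int[mu]_(x in A) (convolution g1 g2 x)%:E * P F)%E.
Proof.
move=> mX mY mF d1 m2 g20 i2 ind A mA.
have m1 := bd_measurable d1; have g10 := bd_ge0 d1.
have mG : measurable_fun [set: measurableTypeR R * measurableTypeR R]
    (fun z => g1 z.1 * g2 z.2).
  by apply: measurable_funM; exact: measurableT_comp.
have G0 : forall z : R * R, 0 <= g1 z.1 * g2 z.2.
  by move=> z; rewrite mulr_ge0.
have fF : P F \is a fin_num by exact: fin_num_measure.
have F0 : 0 <= fine (P F) by rewrite fine_ge0.
pose nu := mscale (NngNum F0) (density_measure (mu \x mu)%E mG G0).
have mXY : measurable_fun [set: Omega]
    (fun w => (X w, Y w) : measurableTypeR R * measurableTypeR R).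
  exact: measurable_fun_pair.
pose m' := pushforward_measure (mrestr P mF) mXY.
have density_rect (Q : set (R * R)) :
    measurable (Q : set (measurableTypeR R * measurableTypeR R)) ->
    nu Q = (P F *
      (\int[mu]_y \int[mu]_x (g1 x * g2 y * \1_Q (x, y))%:E))%E.
  move=> mQ; rewrite /nu/= /mscale/= fineK//; congr (_ * _)%E.
  rewrite /density_measure integral_mkcond epatch_indic fubini_tonelli2//=.
  - apply: emeasurable_funM; apply/measurable_EFinP => //.
  - by move=> z; rewrite /= -EFinM lee_fin mulr_ge0.
(* Rectangles are stable under intersection and generate the product sigma-algebra, so two finite
   measures that agree on them are equal. *)
have nuE : forall Q : set (measurableTypeR R * measurableTypeR R),
    measurable Q -> m' Q = nu Q.
  pose C : set (set (measurableTypeR R * measurableTypeR R)) :=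
    [set A `*` B | A in measurable & B in measurable].
  apply: (measure_unique C (fun=> setT)).
  - by rewrite measurable_prod_measurableType.
  - move=> _ _ [A1 mA1 [A2 mA2 <-]] [B1 mB1 [B2 mB2 <-]].
    rewrite -setXI; exists (A1 `&` B1); first exact: measurableI.
    by exists (A2 `&` B2) => //; exact: measurableI.
  - by move=> _; exists setT => //; exists setT => //; rewrite setXTT.
  - by rewrite bigcup_const.
  - move=> _ [B1 mB1 [B2 mB2 <-]].
    change (m' (B1 `*` B2) = nu (B1 `*` B2)).
    rewrite density_rect; last exact: measurableX.
    transitivity (P (X @^-1` B1 `&` Y @^-1` B2 `&` F)) => //.
    rewrite ind// muleC; congr (_ * _)%E.
    rewrite (integral_mkcond B2) epatch_indic/=.
    rewrite -ge0_integralZl//; first last.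
    + by apply: integral_ge0 => x _; rewrite lee_fin.
    + by move=> y _; rewrite -EFinM lee_fin mulr_ge0.
    + by apply: emeasurable_funM; apply/measurable_EFinP.
    apply: eq_integral => y _.
    rewrite (integral_mkcond B1) epatch_indic/=.
    rewrite -ge0_integralZr//; first last.
    + by rewrite -EFinM lee_fin mulr_ge0.
    + by move=> x _; rewrite -EFinM lee_fin mulr_ge0.
    + by apply: emeasurable_funM; apply/measurable_EFinP.
    apply: eq_integral => x _.
    rewrite -!EFinM !indicE in_setX/=; congr EFin.
    by case: (x \in B1); case: (y \in B2) => /=; ring.
  - move=> _; change (P ((fun w => (X w, Y w)) @^-1` setT `&` F) < +oo)%E.
    by rewrite preimage_setT setTI (le_lt_trans (probability_le1 P mF))// ltry.
pose Q : set (measurableTypeR R * measurableTypeR R) :=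
  (fun z => z.1 + z.2) @^-1` A.
have mQ : measurable Q.
  by apply: preimage_measurable => //; exact: measurable_funD.
transitivity (m' Q) => //.
rewrite nuE// density_rect// muleC; congr (_ * _)%E.
(* For fixed [y] a translation turns [g1 x] into [g1 (x - y)] and the condition on the sum into [x]
   in [A]; Tonelli then exchanges the two integrals. *)
transitivity (\int[mu]_y \int[mu]_x
    ((g1 (x - y) * g2 y)%:E * (\1_A x)%:E))%E; last first.
  rewrite -[LHS](@fubini_tonelli _ _ _ _ _ mu mu
    (fun z => ((g1 (z.1 - z.2) * g2 z.2)%:E * (\1_A z.1)%:E)%E)); first last.
  - by move=> z; rewrite -EFinM lee_fin mulr_ge0// mulr_ge0.
  - apply: emeasurable_funM; apply/measurable_EFinP.
      exact: measurable_convolution_integrand.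
    exact: measurableT_comp.
  rewrite [RHS]integral_mkcond epatch_indic; apply: eq_integral => x _ /=.
  rewrite -(convolutionE x d1)// -ge0_integralZr//.
  - apply/measurable_EFinP; apply: measurable_funM => //.
    by apply: measurableT_comp => //; exact: measurable_funB.
  - by move=> y _; rewrite lee_fin mulr_ge0.
apply: eq_integral => y _.
transitivity ((g2 y)%:E * \int[mu]_x (g1 x * \1_((fun x : R => x + y)%R @^-1` A) x)%:E)%E.
  have mB : measurable ((fun x : R => x + y) @^-1` A).
    by apply: preimage_measurable => //; exact: measurable_funD.
  rewrite -ge0_integralZl//.
  - by apply: eq_integral => x _; rewrite -EFinM mulrA (mulrC (g2 y)).
  - by apply/measurable_EFinP; apply: measurable_funM.
  - by move=> x _; rewrite lee_fin mulr_ge0.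
  - by rewrite lee_fin.
have m1y : measurable_fun setT (fun x : R => g1 (x - y)).
  by apply: measurableT_comp => //; exact: measurable_funB.
rewrite ge0_integral_shift_indic// integral_mkcond epatch_indic/= -ge0_integralZl//.
- by apply: eq_integral => x _; rewrite -!EFinM mulrA (mulrC (g2 y)).
- by apply: emeasurable_funM; apply/measurable_EFinP.
- by move=> x _; rewrite -EFinM lee_fin mulr_ge0.
- by rewrite lee_fin.
Qed.

End independent_sum.

Section convolution_sequence.
Context {R : realType}.
Local Notation mu := (@lebesgue_measure R).
Implicit Types g : R -> R.

Lemma convolution_bounded_density M N g1 g2 :
  bounded_density M g1 -> bounded_density N g2 ->
  bounded_density M (convolution g1 g2).
Proof.
move=> d1 d2.
have [m1 g10 g1M i1] := d1; have [m2 g20 _ i2] := d2.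
have cE x : (\int[mu]_y (g1 (x - y) * g2 y)%:E)%E = (convolution g1 g2 x)%:E.
  by apply: (convolutionE x d1) => //; rewrite i2 ltry.
have m12 := measurable_convolution_integrand m1 m2.
have m12' : measurable_fun [set: measurableTypeR R * measurableTypeR R]
  (fun z : R * R => (g1 (z.1 - z.2) * g2 z.2)%:E) by exact/measurable_EFinP.
have g120 z : (0 <= (g1 (z.1 - z.2) * g2 z.2)%:E)%E.
  by rewrite lee_fin mulr_ge0.
have m1x x : measurable_fun setT (fun y : R => g1 (x - y)).
  by apply: measurableT_comp => //; exact: measurable_funB.
split.
(* A convolution integrates the sections of a function on the plane, so it is measurable by
   Tonelli. *)
- apply/measurable_EFinP; rewrite (_ : _ \o _ = fubini_F mu
    (fun z : R * R => (g1 (z.1 - z.2) * g2 z.2)%:E)).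
    exact: measurable_fun_fubini_tonelli_F.
  by apply/funext => x /=; rewrite -cE.
- by move=> x; apply: Rintegral_ge0 => y _; exact: mulr_ge0.
- move=> x; rewrite -lee_fin -cE.
  rewrite -[leRHS]mule1 -i2 -ge0_integralZl//; first last.
  + by rewrite lee_fin (le_trans (g10 0)).
  + by move=> y _; rewrite lee_fin.
  + exact/measurable_EFinP.
  apply: ge0_le_integral => //.
  + by move=> y _; rewrite lee_fin mulr_ge0.
  + by apply/measurable_EFinP; exact: (measurable_funM (m1x x) m2).
  + by apply: emeasurable_funM => //; apply/measurable_EFinP.
  + by move=> y _; rewrite -EFinM lee_fin ler_wpM2r.
- under eq_integral do rewrite -cE.
  rewrite (@fubini_tonelli _ _ _ _ _ mu mu
    (fun z : R * R => (g1 (z.1 - z.2) * g2 z.2)%:E))//=.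
  rewrite -i2; apply: eq_integral => y _.
  under eq_integral do rewrite EFinM.
  rewrite ge0_integralZr//.
  + rewrite -ge0_integral_shift_indic// preimage_setT.
    under eq_integral do rewrite indicT mulr1.
    by rewrite i1 mul1e.
  + apply/measurable_EFinP; apply: measurableT_comp => //.
    exact: measurable_funB.
  + by move=> x _; rewrite lee_fin.
  + by rewrite lee_fin.
Qed.

(** Density of a sum of [k.+1] independent variables with densities [g m], ..., [g (m + k)]. It
    serves both the Gaussian increments, whose variances differ, and the identically distributed
    jumps; new factors go on the left to match [convolution_power]. *)
Fixpoint convolution_sequence (g : nat -> R -> R) (m k : nat) : R -> R :=
  if k is k'.+1 then
    convolution (g (m + k)%N) (convolution_sequence g m k')
  else g m.

Lemma convolution_sequence_bounded_density M (g : nat -> R -> R) m k :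
  (forall i, bounded_density (M i) (g i)) ->
  bounded_density (M (m + k)%N) (convolution_sequence g m k).
Proof.
move=> d; elim: k => [|k ih]/=; first by rewrite addn0.
exact: convolution_bounded_density (d _) ih.
Qed.

Lemma convolution_sequence_cst (g : R -> R) m k :
  convolution_sequence (fun=> g) m k = convolution_power g k.+1.
Proof. by elim: k => //= k ->. Qed.

End convolution_sequence.

Section mutually_independent_sum.
Context d (Omega : measurableType d) {R : realType} (P : probability Omega R).
Local Notation mu := (@lebesgue_measure R).

(** Adding a summand requires it to be independent of the partial sum, which mutual independence
    gives only through finite intersections. The induction therefore carries arbitrary events on the
    indices outside the block. *)
Lemma mutually_independent_sum M (X : nat -> Omega -> R) (g : nat -> R -> R)
    (m k : nat) :
  (forall i, measurable_fun setT (X i)) -> mutually_independent P X ->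
  (forall i, bounded_density (M i) (g i)) ->
  (forall i (A : set R), measurable A ->
    P (X i @^-1` A) = (\int[mu]_(x in A) (g i x)%:E)%E) ->
  forall (s : seq nat) (A : set R) (B : nat -> set R), uniq s ->
    {in s, forall i, (i < m)%N || (m + k < i)%N} ->
    measurable A -> (forall i, measurable (B i)) ->
  P ((fun w => \sum_(i < k.+1) X (m + i)%N w) @^-1` A `&`
     \bigcap_(i in [set` s]) (X i @^-1` B i)) =
  (\int[mu]_(x in A) (convolution_sequence g m k x)%:E *
   P (\bigcap_(i in [set` s]) (X i @^-1` B i)))%E.
Proof.
move=> mX ind dg Xg.
have mXB i (B : set R) : measurable B -> measurable (X i @^-1` B).
  by move=> mB; rewrite -[X in measurable X]setTI; exact: mX.
elim: k => [|k ih] s A B us sm mA mB.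
  have ms : m \notin s.
    by apply/negP => /sm; rewrite addn0 ltnn.
  pose B' i := if i == m then A else B i.
  have mB' i : measurable (B' i) by rewrite /B'; case: ifP.
  have ums : uniq (m :: s) by rewrite /= ms.
  have := ind _ _ ums mB'; rewrite bigcap_seq big_cons big_cons.
  rewrite {1 3}/B' eqxx Xg//=.
  have -> : (\big[setI/setT]_(j <- s) (X j @^-1` B' j)) =
      \bigcap_(i in [set` s]) (X i @^-1` B i).
    rewrite bigcap_seq; apply: eq_big_seq => i si; rewrite /B'.
    by case: eqP => // im; move: si; rewrite im (negbTE ms).
  have -> : (\prod_(j <- s) P (X j @^-1` B' j) =
      P (\bigcap_(i in [set` s]) (X i @^-1` B i)))%E.
    rewrite ind//; apply: eq_big_seq => i si; rewrite /B'.
    by case: eqP => // im; move: si; rewrite im (negbTE ms).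
  move=> <-; congr (P (_ `&` _)).
  by apply/funext => w; rewrite /= big_ord_recl big_ord0 addr0 addn0.
have mF : measurable (\bigcap_(i in [set` s]) (X i @^-1` B i)).
  by rewrite bigcap_seq; apply: bigsetI_measurable => i _; exact: mXB.
have mS : measurable_fun setT (fun w => \sum_(i < k.+1) X (m + i)%N w).
  by apply: measurable_sum.
have dc := convolution_sequence_bounded_density m k dg.
rewrite (_ : (fun w => \sum_(i < k.+2) X (m + i)%N w) =
  (fun w => X (m + k.+1)%N w + \sum_(i < k.+1) X (m + i)%N w)); last first.
  by apply/funext => w; rewrite big_ord_recr/= addrC.
apply: (independent_sum_density (mX _) mS mF (dg _)) => //.
- exact: bd_measurable dc.
- exact: bd_ge0 dc.
- by rewrite (bd_integral dc) ltry.
move=> A1 A2 mA1 mA2.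
have ms : (m + k.+1)%N \notin s by apply/negP => /sm; lia.
(* The event on the new summand joins the outside events, so the induction hypothesis applies to [s]
   enlarged by the new index. *)
pose B' i := if i == (m + k.+1)%N then A1 else B i.
have mB' i : measurable (B' i) by rewrite /B'; case: ifP.
have ums : uniq ((m + k.+1)%N :: s) by rewrite /= ms.
have sm' : {in (m + k.+1)%N :: s, forall i, (i < m)%N || (m + k < i)%N}.
  move=> i; rewrite inE => /orP[/eqP ->|/sm]; lia.
have B's : \bigcap_(i in [set` (m + k.+1)%N :: s]) (X i @^-1` B' i) =
    X (m + k.+1)%N @^-1` A1 `&` \bigcap_(i in [set` s]) (X i @^-1` B i).
  rewrite !bigcap_seq big_cons {1}/B' eqxx; congr (_ `&` _).
  apply: eq_big_seq => i si; rewrite /B'.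
  by case: eqP => // im; move: si; rewrite im (negbTE ms).
have := ih _ A2 B' ums sm' mA2 mB'; rewrite {1}B's => e.
rewrite (_ : _ `&` _ `&` _ = (fun w => \sum_(i < k.+1) X (m + i)%N w) @^-1` A2 `&`
  (X (m + k.+1)%N @^-1` A1 `&` \bigcap_(i in [set` s]) (X i @^-1` B i))); last first.
  by rewrite setICA setIA.
rewrite e (ind _ _ ums mB') big_cons {1}/B' eqxx Xg//.
rewrite [X in (_ * (_ * X))%E = _](_ : _ = P (\bigcap_(i in [set` s]) (X i @^-1` B i))).
  by rewrite muleCA muleA.
rewrite ind//; apply: eq_big_seq => i si; rewrite /B'.
by case: eqP => // im; move: si; rewrite im (negbTE ms).
Qed.

Corollary mutually_independent_sum_density M (X : nat -> Omega -> R)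
    (g : nat -> R -> R) (m k : nat) :
  (forall i, measurable_fun setT (X i)) -> mutually_independent P X ->
  (forall i, bounded_density (M i) (g i)) ->
  (forall i (A : set R), measurable A ->
    P (X i @^-1` A) = (\int[mu]_(x in A) (g i x)%:E)%E) ->
  forall A : set R, measurable A ->
  P ((fun w => \sum_(i < k.+1) X (m + i)%N w) @^-1` A) =
  (\int[mu]_(x in A) (convolution_sequence g m k x)%:E)%E.
Proof.
move=> mX ind dg Xg A mA.
have := @mutually_independent_sum M X g m k mX ind dg Xg [::] A (fun=> setT).
rewrite bigcap_seq big_nil setIT probability_setT mule1; apply => //.
Qed.

End mutually_independent_sum.

(** * Normal densities under affine maps and convolution *)

Section normal_density.
Context {R : realType}.
Local Notation mu := (@lebesgue_measure R).

Lemma normal_pdf_bounded_density (m s : R) : s != 0 ->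
  bounded_density (normal_peak s) (normal_pdf m s).
Proof.
move=> s0; split.
- exact: measurable_normal_pdf.
- by move=> x; exact: normal_pdf_ge0.
- by move=> x; exact: normal_pdf_ub.
- exact: integral_normal_pdf.
Qed.

Lemma normal_pdf_nz (m s x : R) : s != 0 ->
  normal_pdf m s x = normal_peak s * normal_fun m s x.
Proof. by move=> s0; rewrite /normal_pdf (negbTE s0). Qed.

Lemma normal_pdf_affine (m s a c x : R) : 0 < a -> s != 0 ->
  a^-1 * normal_pdf m s ((x - c) / a) = normal_pdf (a * m + c) (a * s) x.
Proof.
move=> a0 s0.
have as0 : a * s != 0 by rewrite mulf_neq0// gt_eqF.
rewrite !normal_pdf_nz// mulrA /normal_peak /normal_fun; congr (_ * expR _).
  have -> : (a * s) ^+ 2 * pi *+ 2 = a ^+ 2 * (s ^+ 2 * pi *+ 2) by ring.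
  by rewrite sqrtrM ?sqr_ge0// sqrtr_sqr gtr0_norm// invfM.
rewrite !mulr2n; field.
by rewrite !gt_eqF// addr_gt0// exprn_even_gt0.
Qed.

Lemma convolution_normal_pdf (s t : R) : 0 < s -> 0 < t ->
  convolution (normal_pdf 0 s) (normal_pdf 0 t) =
  normal_pdf 0 (Num.sqrt (s ^+ 2 + t ^+ 2)).
Proof.
move=> s0 t0; apply/funext => x.
have st0 : 0 < s ^+ 2 + t ^+ 2 by rewrite addr_gt0// exprn_gt0.
set S := Num.sqrt (s ^+ 2 + t ^+ 2).
have S0 : 0 < S by rewrite sqrtr_gt0.
have S2 : S ^+ 2 = s ^+ 2 + t ^+ 2 by rewrite sqr_sqrtr// ltW.
(* Completing the square in [y]: the last factor is a normal density in [y], so it integrates to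
   1. *)
have key y : normal_pdf 0 s (x - y) * normal_pdf 0 t y =
    normal_pdf 0 S x * normal_pdf (x * t ^+ 2 / S ^+ 2) (s * t / S) y.
  have stS : 0 < s * t / S by rewrite divr_gt0// mulr_gt0.
  rewrite !normal_pdf_nz ?gt_eqF// !mulrA.
  rewrite (mulrAC _ _ (normal_peak t)) (mulrAC _ _ (normal_peak (s * t / S))).
  rewrite -!mulrA -!expRD !mulrA; congr (_ * expR _).
    rewrite /normal_peak -!invfM; congr (_^-1).
    rewrite -!sqrtrM; first last.
    - by rewrite mulrn_wge0// mulr_ge0 ?sqr_ge0// pi_ge0.
    - by rewrite mulrn_wge0// mulr_ge0 ?sqr_ge0// pi_ge0.
    congr Num.sqrt; rewrite expr_div_n exprMn !mulr2n; field.
    by rewrite gt_eqF.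
  rewrite !subr0 expr_div_n exprMn S2 !mulr2n; field.
  by rewrite !gt_eqF// addr_gt0// exprn_gt0// mulr_gt0.
rewrite /convolution /Rintegral.
under eq_integral do rewrite key EFinM.
rewrite ge0_integralZl//.
- by rewrite integral_normal_pdf mule1.
- by apply/measurable_EFinP; exact: measurable_normal_pdf.
- by move=> y _; rewrite lee_fin normal_pdf_ge0.
- by rewrite lee_fin normal_pdf_ge0.
Qed.

Lemma convolution_sequence_normal_pdf (s : nat -> R) (m k : nat) :
  (forall i, 0 < s i) ->
  convolution_sequence (fun i => normal_pdf 0 (s i)) m k =
  normal_pdf 0 (Num.sqrt (\sum_(i < k.+1) s (m + i)%N ^+ 2)).
Proof.
move=> s0; elim: k => [|k ih] /=.
  by rewrite big_ord_recl big_ord0 addr0 addn0 sqrtr_sqr gtr0_norm.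
have S0 : 0 < \sum_(i < k.+1) s (m + i)%N ^+ 2.
  by rewrite big_ord_recl ltr_pwDl ?exprn_gt0// sumr_ge0// => i _; exact: sqr_ge0.
rewrite ih convolution_normal_pdf ?sqrtr_gt0//.
by rewrite sqr_sqrtr ?ltW// [in RHS]big_ord_recr/= addrC.
Qed.

End normal_density.

Lemma normal_prob_affine (R : realType) (s a c : R) (A : set R) :
  0 < a -> s != 0 -> measurable A ->
  normal_prob 0 s ((fun x => a * x + c) @^-1` A) = normal_prob c (a * s) A.
Proof.
move=> a0 s0 mA; rewrite /normal_prob ge0_integral_affine//.
- by apply: eq_integral => x _; rewrite normal_pdf_affine// mulr0 add0r.
- exact: measurable_normal_pdf.
- by move=> x; exact: normal_pdf_ge0.
Qed.

Lemma phi_thE (R : realType) (gamma sigma : R -> R) (t h x : R) :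
  0 < sigma_bar sigma t h -> 0 < h ->
  phi_th gamma sigma t h x =
  normal_pdf (h * average gamma t h) (sigma_bar sigma t h * Num.sqrt h) x.
Proof.
move=> s0 h0; rewrite /phi_th normal_pdf_affine ?oner_neq0//.
  by rewrite mulr0 add0r mulr1.
by rewrite mulr_gt0// sqrtr_gt0.
Qed.

(** * Bounds for the coefficients and their averages *)

Lemma itv_bounded_integrable (R : realType) (i : interval R) (f : R -> R) (M : R) :
  (lebesgue_measure ([set` i] : set R) < +oo)%E ->
  measurable_fun ([set` i] : set R) f ->
  (forall x, x \in i -> `|f x| <= M) ->
  lebesgue_measure.-integrable ([set` i] : set R) (EFin \o f).
Proof.
move=> fi mf fM; apply: measurable_bounded_integrable => //.
exists M; split; first exact: num_real.
by move=> N MN x /= xi; rewrite (le_trans (fM x xi))// ltW.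
Qed.

Lemma lebesgue_measure_cc (R : realType) (a b : R) : a <= b ->
  lebesgue_measure (`[a, b] : set R) = (b - a)%:E.
Proof.
rewrite le_eqVlt => /predU1P[->|ab]; first by rewrite lebesgue_measure_itv/= ltxx subrr.
by rewrite lebesgue_measure_itv/= lte_fin ab.
Qed.

Section bounded_away.
Context {R : realType}.
Local Notation mu := (@lebesgue_measure R).
Implicit Types (g : R -> R) (t h a b l u : R).

(** The value at 0 lies between the infimum and the supremum, which forces both to be finite. *)
Lemma locally_bounded_awayP g (T : R) : 0 < T -> locally_bounded_away g ->
  exists l u, [/\ 0 < l, l <= u & forall s, 0 <= s <= T -> l <= g s <= u].
Proof.
move=> T0 /(_ T T0)[+ +].
set i := ereal_inf _; set S := ereal_sup _ => i0 Sy.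
have lb s : 0 <= s <= T -> (i <= (g s)%:E)%E.
  by move=> sT; apply: ereal_inf_lbound; exists s => //=; rewrite in_itv.
have ub s : 0 <= s <= T -> ((g s)%:E <= S)%E.
  by move=> sT; apply: ereal_sup_ubound; exists s => //=; rewrite in_itv.
have o0 : 0 <= (0 : R) <= T by rewrite lexx ltW.
have iS := le_trans (lb _ o0) (ub _ o0).
have fi : i \is a fin_num.
  by rewrite ge0_fin_numE ?ltW// (le_lt_trans iS).
have fS : S \is a fin_num.
  by rewrite ge0_fin_numE// (le_trans _ iS)// ltW.
exists (fine i), (fine S); split.
- by rewrite fine_gt0// i0 -ge0_fin_numE ?ltW.
- exact: fine_le.
- by move=> s sT; rewrite -!lee_fin !fineK// lb// ub.
Qed.

Lemma bounded_away_integrable g a b l u : 0 <= a ->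
  measurable_fun (`[0, +oo[ : set R) g ->
  (forall s, a <= s <= b -> l <= g s <= u) ->
  mu.-integrable (`[a, b] : set R) (EFin \o g).
Proof.
move=> a0 mg gb; apply: (@itv_bounded_integrable _ _ _ (Num.max `|l| `|u|)).
- by rewrite lebesgue_measure_itv/=; case: ifP => _; rewrite ?ltry.
- apply: measurable_funS mg => // x /=; rewrite !in_itv/= andbT => /andP[ax _].
  exact: le_trans ax.
- move=> x; rewrite in_itv/= => /gb /andP[lg gu].
  rewrite le_max !ler_norml; have [g0|g0] := leP 0 (g x).
    apply/orP; right; rewrite (le_trans gu) ?ler_norm// andbT.
    by rewrite (le_trans _ g0)// oppr_le0.
  apply/orP; left; rewrite (le_trans (ltW g0))// andbT.
  by rewrite (le_trans _ lg)// lerNl -normrN ler_norm.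
Qed.

Lemma average_bounded g t h l u : 0 <= t -> 0 < h ->
  measurable_fun (`[0, +oo[ : set R) g ->
  (forall s, t <= s <= t + h -> l <= g s <= u) ->
  l <= average g t h <= u.
Proof.
move=> t0 h0 mg gb.
have ig := bounded_away_integrable t0 mg gb.
have cstE r : \int[mu]_(x in `[t, t + h]) r = r * h.
  by rewrite Rintegral_cst//= lebesgue_measure_cc ?lerDl ?ltW//= addrC addKr.
have ic r : mu.-integrable (`[t, t + h] : set R) (EFin \o cst r).
  apply: (@itv_bounded_integrable _ _ _ `|r|) => //.
  by rewrite lebesgue_measure_cc ?lerDl ?ltW// ltry.
rewrite /average mulrC ler_pdivlMr// ler_pdivrMr// -!cstE.
apply/andP; split; apply: le_Rintegral => //; try exact: ic;
  by move=> x; rewrite /= in_itv/= => /gb /andP[].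
Qed.

Lemma Rintegral_itv_chain g a b c M : a <= b -> b <= c ->
  measurable_fun (`[a, c] : set R) g ->
  (forall s, a <= s <= c -> `|g s| <= M) ->
  \int[mu]_(x in `[a, c]) g x =
  \int[mu]_(x in `[a, b]) g x + \int[mu]_(x in `[b, c]) g x.
Proof.
move=> ab bc mg gM.
have ig : mu.-integrable (`[a, c] : set R) (EFin \o g).
  apply: (@itv_bounded_integrable _ _ _ M) => //.
  by rewrite lebesgue_measure_cc ?ltry// (le_trans ab).
have sub : (`]b, c] : set R) `<=` `[a, c].
  move=> x /=; rewrite !in_itv/= => /andP[bx ->].
  by rewrite andbT (le_trans ab)// ltW.
rewrite -[X in _ = _ + X]Rintegral_itv_obnd_cbnd; last exact: integrableS ig.
rewrite -(@Rintegral_itvB _ g (BLeft a) (BRight c) b)//.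
by rewrite addrC subrK.
Qed.

End bounded_away.

(** * Approximation of [sigma] by step functions in L^2 *)

Section step_approximation.
Context {R : realType}.
Local Notation mu := (@lebesgue_measure R).
Implicit Types (u c : nat -> R).

Lemma nondecreasing_le u : (forall i, u i <= u i.+1) ->
  forall i j, (i <= j)%N -> u i <= u j.
Proof.
move=> ndu i j ij; rewrite -(subnK ij).
by elim: (j - i)%N => [|k ih]//; rewrite addSn (le_trans ih).
Qed.

Lemma exists_cell u N x : u 0%N < x <= u N ->
  exists2 i, (i < N)%N & u i < x <= u i.+1.
Proof.
move=> /andP[u0x xuN].
have ex : exists i, x <= u i by exists N.
case: (ex_minnP ex) => -[|i] xui mini; first by move: u0x; rewrite ltNge xui.
exists i; first exact: (mini N).
by rewrite xui andbT ltNge; apply/negP => /mini; rewrite ltnn.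
Qed.

Lemma step_functionE N u c x i : (forall i, u i <= u i.+1) -> (i < N)%N ->
  u i < x <= u i.+1 -> step_function N u c x = c i.
Proof.
move=> ndu iN /andP[uix xui]; rewrite /step_function (bigD1 (Ordinal iN))//=.
rewrite indicE mem_set/= ?in_itv/= ?uix// mulr1 big1 ?addr0// => j ji.
rewrite indicE memNset ?mulr0//= in_itv/= => /andP[ujx xuj].
move/eqP: ji; apply; apply/val_inj => /=; apply/eqP; rewrite eqn_leq.
apply/andP; split; rewrite leqNgt; apply/negP => /(nondecreasing_le ndu) H.
- by move: ujx; rewrite ltNge (le_trans xui).
- by move: uix; rewrite ltNge (le_trans xuj).
Qed.

Lemma measurable_step_function N u c : measurable_fun setT (step_function N u c).
Proof.
by apply: measurable_sum => i; apply: measurable_funM => //; exact: measurable_indic.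
Qed.

Variable sigma : R -> R.
Hypothesis sigma_cont : {within `[0, +oo[, continuous sigma}.
Hypothesis sigma_bounded : locally_bounded_away sigma.

Lemma measurable_sigma : measurable_fun (`[0, +oo[ : set R) sigma.
Proof. exact: subspace_continuous_measurable_fun. Qed.

Lemma measurable_sigma2 :
  measurable_fun (`[0, +oo[ : set R) (fun x => sigma x ^+ 2).
Proof. exact: measurable_funX measurable_sigma. Qed.

Lemma sigma_bar_bounded t h l v : 0 <= t -> 0 < h -> 0 <= l -> 0 <= v ->
  (forall s, t <= s <= t + h -> l <= sigma s <= v) ->
  l <= sigma_bar sigma t h <= v.
Proof.
move=> t0 h0 l0 v0 lv.
have /andP[la av] : l ^+ 2 <= average (fun x => sigma x ^+ 2) t h <= v ^+ 2.
  apply: average_bounded => //; first exact: measurable_sigma2.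
  move=> s /lv /andP[ls sv]; rewrite !lerXn2r ?nnegrE//.
  by rewrite (le_trans l0). by rewrite (le_trans l0).
rewrite -[l]ger0_norm// -sqrtr_sqr -[v]ger0_norm// -(sqrtr_sqr v).
by rewrite /sigma_bar !ler_wsqrtr.
Qed.

Lemma sigma_bar_sqr t h : 0 <= t -> 0 < h ->
  sigma_bar sigma t h ^+ 2 * h = \int[mu]_(x in `[t, t + h]) (sigma x ^+ 2).
Proof.
move=> t0 h0; rewrite sqr_sqrtr; first by rewrite /average mulrAC mulVf ?mul1r// gt_eqF.
rewrite /average; apply: mulr_ge0; first by rewrite invr_ge0 ltW.
by apply: Rintegral_ge0 => x _; exact: sqr_ge0.
Qed.

(* With the root mean square of sigma on each cell, the variance of the step
   integral is exactly the integral of sigma ^+ 2. *)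
Definition cell_coef u i := sigma_bar sigma (u i) (u i.+1 - u i).

Context (T : R) (N : nat -> nat) (u : nat -> nat -> R) (delta : nat -> R).
Hypothesis u0 : forall n, u n 0%N = 0.
Hypothesis ndu : forall n i, u n i <= u n i.+1.
Hypothesis uT : forall n, u n (N n) = T.
Hypothesis u_mesh : forall n i, u n i.+1 - u n i <= delta n.
Hypothesis delta0 : delta n @[n --> \oo] --> 0.

Let f n := step_function (N n) (u n) (cell_coef (u n)).

Lemma step_function_cvg x : 0 < x <= T -> f n x @[n --> \oo] --> sigma x.
Proof.
move=> /andP[x0 xT].
have T0 : 0 < T by rewrite (lt_le_trans x0).
have [l [v [l0 lev lv]]] := locally_bounded_awayP T0 sigma_bounded.
have sx0 : 0 < sigma x.
  by have /andP[] := lv x (introT andP (conj (ltW x0) xT)); move=> /(lt_le_trans l0).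
apply/cvgrPdist_le => e e0.
(* Capping the accuracy at [sigma x] keeps the lower bound [sigma x - eta] nonnegative, as bounding
   a root mean square requires. *)
pose eta := Num.min e (sigma x).
have eta0 : 0 < eta by rewrite lt_min e0 sx0.
move/subspace_continuousP : (sigma_cont).
have x0' : (`[0, +oo[%classic : set R) x by rewrite /= in_itv/= andbT ltW.
move=> /(_ x x0') /cvgrPdist_le /(_ eta eta0).
move=> /nbhs_ballP[d /= d0 sd].
move/cvgrPdist_lt : (delta0) => /(_ d d0).
apply: filterS => n; rewrite sub0r normrN => dn.
have [|i iN xi] := @exists_cell (u n) (N n) x; first by rewrite u0 uT x0.
have /andP[uix xui] := xi.
rewrite /f (step_functionE _ (ndu n) iN)//.
have ui0 : 0 <= u n i by rewrite -(u0 n) (nondecreasing_le (ndu n)).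
have /andP[] : sigma x - eta <= cell_coef (u n) i <= sigma x + eta.
  apply: sigma_bar_bounded => //.
  - by rewrite subr_gt0 (lt_le_trans uix).
  - by rewrite subr_ge0 ge_min lexx orbT.
  - by rewrite ltW// addr_gt0.
  rewrite addrC subrK => s /andP[uis sui].
  have : `|sigma x - sigma s| <= eta.
    apply: sd; last by rewrite /= in_itv/= andbT (le_trans ui0).
    rewrite /ball/= (le_lt_trans _ dn)// (le_trans _ (ler_norm _))//.
    rewrite (le_trans _ (u_mesh n i))// ler_norml.
    by apply/andP; split; lra.
  by rewrite ler_distl => /andP[]; lra.
have : eta <= e by rewrite ge_min lexx.
by rewrite ler_distl => *; apply/andP; split; lra.
Qed.

(** Dominated convergence: [sigma] and the cell coefficients lie in the same interval [[l, v]], so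
    the squared error is at most [v ^+ 2]. The cells are open on the left and miss the point 0,
    hence the detour through []0, T]]. *)
Lemma step_function_cvg_L2 : 0 <= T ->
  (\int[mu]_(x in `[0%R, T]) ((f n x - sigma x) ^+ 2)%:E)%E
     @[n --> \oo] --> 0%E.
Proof.
rewrite le_eqVlt => /predU1P[T0|T0].
  rewrite -T0 (_ : (fun _ => _) = cst 0%E); first exact: cvg_cst.
  by apply/funext => n; rewrite set_itv1 integral_set1.
have [l [v [l0 lev lv]]] := locally_bounded_awayP T0 sigma_bounded.
have v0 : 0 <= v by rewrite (le_trans (ltW l0)).
have ms : measurable_fun (`]0, T] : set R) sigma.
  by apply: measurable_funS measurable_sigma => // x /=; rewrite !in_itv/= andbT => /andP[/ltW].
have mf n : measurable_fun (`]0, T] : set R) (f n).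
  exact: measurable_funTS (measurable_step_function _ _ _).
have [_ _] : [/\ mu.-integrable `]0, T] (cst 0%E),
    [sequence (\int[mu]_(x in `]0%R, T])
       `|((f n x - sigma x) ^+ 2)%:E - cst 0 x|)%E]_n @ \oo --> 0%E
  & [sequence (\int[mu]_(x in `]0%R, T]) ((f n x - sigma x) ^+ 2)%:E)%E]_n
       @ \oo --> (\int[mu]_(x in `]0%R, T]) cst 0 x)%E].
  apply: (@dominated_convergence _ _ _ mu _ _
    (fun n x => ((f n x - sigma x) ^+ 2)%:E) (cst 0%E) (cst (v ^+ 2)%:E)) => //.
  - move=> n; apply/measurable_EFinP; apply: measurable_funX.
    exact: (measurable_funB (mf n) ms).
  - apply/aeW => x /=; rewrite in_itv/= => xT; apply: cvg_EFin.
      by near=> n.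
    have fx : f n x - sigma x @[n --> \oo] --> (0 : R).
      rewrite -(subrr (sigma x)); apply: cvgB; last exact: cvg_cst.
      exact: step_function_cvg.
    rewrite -(mulr0 (0 : R)); exact: (cvgM fx fx).
  - apply: (@itv_bounded_integrable _ _ (cst (v ^+ 2)) `|v ^+ 2|) => //.
    by rewrite lebesgue_measure_itv/= lte_fin T0 ltry.
  - apply/aeW => x n /=; rewrite in_itv/= => xT; rewrite lee_fin normrX.
    rewrite lerXn2r ?nnegrE// ler_distl.
    have /andP[x0 xT'] := xT.
    have /andP[ls sv] : l <= sigma x <= v by apply: lv; rewrite (ltW x0).
    have [|i iN xi] := @exists_cell (u n) (N n) x; first by rewrite u0 uT x0.
    rewrite /f (step_functionE _ (ndu n) iN)//.
    have ui0 : 0 <= u n i by rewrite -(u0 n) (nondecreasing_le (ndu n)).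
    have uiT : u n i.+1 <= T by rewrite -(uT n) (nondecreasing_le (ndu n)).
    have /andP[] : l <= cell_coef (u n) i <= v.
      apply: sigma_bar_bounded => //.
      + by rewrite subr_gt0; have /andP[/lt_le_trans] := xi; apply.
      + exact: ltW.
      rewrite addrC subrK => s /andP[uis sui]; apply: lv.
      by rewrite (le_trans ui0 uis) (le_trans sui).
    by move=> *; apply/andP; split; lra.
rewrite integral_cst// mul0e; apply: cvg_trans; apply: near_eq_cvg.
near=> n; rewrite /= integral_itv_obnd_cbnd//.
apply/measurable_EFinP; apply: measurable_funX; exact: (measurable_funB (mf n) ms).
Unshelve. all: by end_near. Qed.

End step_approximation.

(* A subdivision with n.+1 cells of [0, t] followed by n.+1 cells of [t, t + h],
   so that a single sequence of step functions serves both I t and I (t + h). *)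
Definition window (R : realType) (t h : R) (n i : nat) : R :=
  t * (minn i n.+1)%:R / n.+1%:R + h * (i - n.+1)%:R / n.+1%:R.

Section window.
Context {R : realType}.
Variables t h : R.
Hypotheses (t0 : 0 <= t) (h0 : 0 < h).

Lemma window0 n : window t h n 0 = 0.
Proof. by rewrite /window min0n sub0n !mulr0 !mul0r addr0. Qed.

Lemma window_left n : window t h n n.+1 = t.
Proof. by rewrite /window minnn subnn mulr0 mul0r addr0 mulfK. Qed.

Lemma window_right n i : window t h n (n.+1 + i) = t + h * i%:R / n.+1%:R.
Proof.
by rewrite /window (minn_idPr _) ?leq_addr// addKn mulfK.
Qed.

Lemma window_end n : window t h n (n.+1 + n.+1) = t + h.
Proof. by rewrite window_right mulfK. Qed.

Lemma window_step n i :
  window t h n i <= window t h n i.+1 <= window t h n i + (t + h) / n.+1%:R.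
Proof.
have n0 : 0 < n.+1%:R :> R by [].
rewrite /window; have [i_n|n_i] := ltnP i n.+1.
  rewrite (minn_idPl i_n).
  have -> : (i - n.+1 = 0)%N by lia.
  have -> : (i.+1 - n.+1 = 0)%N by lia.
  rewrite !mulr0 !mul0r !addr0 -[i.+1]addn1 natrD mulrDr mulr1 !mulrDl.
  rewrite lerDl divr_ge0//= ?(ltW n0)// lerD2l lerDl divr_ge0// ltW//.
rewrite (minn_idPr (leqW n_i)) subSn// -[(i - n.+1).+1]addn1 natrD.
rewrite mulrDr mulr1 !mulrDl addrA lerDl divr_ge0//= ?(ltW n0)// ?(ltW h0)//.
by rewrite lerD2l lerDr divr_ge0// ltW.
Qed.

Lemma window_mesh_cvg : (t + h) / n.+1%:R @[n --> \oo] --> (0 : R).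
Proof.
rewrite -(mulr0 (t + h)); apply: cvgMr; exact: cvg_harmonic.
Qed.

End window.

Lemma sum_cell_integral (R : realType) (sigma : R -> R) (u : nat -> R) k :
  {within `[0, +oo[, continuous sigma} -> locally_bounded_away sigma ->
  0 <= u 0%N -> (forall i, u i <= u i.+1) ->
  \sum_(i < k) \int[lebesgue_measure]_(x in `[u i, u i.+1]) (sigma x ^+ 2) =
  \int[lebesgue_measure]_(x in `[u 0%N, u k]) (sigma x ^+ 2).
Proof.
move=> sc sb u0 ndu; elim: k => [|k ih].
  by rewrite big_ord0 set_itv1 Rintegral_set1.
rewrite big_ord_recr/= ih.
have uk0 j : 0 <= u j by rewrite (le_trans u0)// (nondecreasing_le ndu).
have T0 : 0 < 1 + u k.+1 by rewrite ltr_pwDl.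
have [l [v [l0 lev lv]]] := locally_bounded_awayP T0 sb.
apply/esym/(@Rintegral_itv_chain _ _ _ _ _ (v ^+ 2)) => //.
- exact: nondecreasing_le.
- apply: measurable_funS (measurable_sigma2 sc) => // x /=; rewrite !in_itv/= andbT => /andP[ux _].
  exact: le_trans ux.
- move=> s /andP[us su].
  have /andP[ls sv] : l <= sigma s <= v.
    by apply: lv; rewrite (le_trans u0 us) (le_trans su)// lerDr.
  have s0 : 0 <= sigma s by rewrite (le_trans (ltW l0)).
  by rewrite normrX ger0_norm// lerXn2r ?nnegrE// (le_trans s0).
Qed.

(** * Law of the step integrals over a window *)

Section wiener_increment.
Context d (Omega : measurableType d) {R : realType} (P : probability Omega R).
Variables (W : R -> {RV P >-> R}) (sigma : R -> R).
Hypotheses (hW : wiener_process W).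
Hypothesis sigma_cont : {within `[0, +oo[, continuous sigma}.
Hypothesis sigma_bounded : locally_bounded_away sigma.
Variables t h : R.
Hypotheses (t0 : 0 <= t) (h0 : 0 < h).

Lemma sigma_bar_gt0 s e : 0 <= s -> 0 < e -> 0 < sigma_bar sigma s e.
Proof.
move=> s0 e0; have se0 : 0 < s + e by rewrite ltr_wpDl.
have [l [v [l0 lev lv]]] := locally_bounded_awayP se0 sigma_bounded.
have /andP[] : l <= sigma_bar sigma s e <= v.
  apply: sigma_bar_bounded => //; first exact: ltW.
    by rewrite (le_trans (ltW l0)).
  by move=> x /andP[sx xse]; apply: lv; rewrite (le_trans s0).
by move/(lt_le_trans l0).
Qed.

Definition window_sum n : Omega -> R := fun w =>
  \sum_(i < n.+1) cell_coef sigma (window t h n) (n.+1 + i) *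
    (W (window t h n (n.+1 + i).+1) w - W (window t h n (n.+1 + i)) w).

(** The two step integrals share their subdivision, so the cells before [t] cancel. *)
Lemma window_sumE n w :
  step_integral (fun s => W s : Omega -> R) (n.+1 + n.+1) (window t h n)
    (cell_coef sigma (window t h n)) w -
  step_integral (fun s => W s : Omega -> R) n.+1 (window t h n)
    (cell_coef sigma (window t h n)) w = window_sum n w.
Proof. by rewrite /step_integral big_split_ord/= addrAC subrr add0r. Qed.

Lemma measurable_window_sum n : measurable_fun setT (window_sum n).
Proof.
apply: measurable_sum => i; apply: measurable_funM => //.
exact: measurable_funB.
Qed.

(** Each term is a scaled independent increment whose variance is the integral of [sigma ^+ 2] over
    its cell. The variances add up to the integral over [[t, t + h]], so the law is the same for
    every [n]. *)
Lemma window_sum_law n (A : set R) : measurable A ->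
  P (window_sum n @^-1` A) = normal_prob 0 (sigma_bar sigma t h * Num.sqrt h) A.
Proof.
move=> mA.
pose v i := t + h * i%:R / n.+1%:R.
have n0 : 0 < n.+1%:R :> R by [].
have vS i : v i.+1 - v i = h / n.+1%:R.
  by rewrite /v -[i.+1]addn1 natrD; ring.
have hn0 : 0 < h / n.+1%:R by rewrite divr_gt0.
have v_lt i : v i < v i.+1 by rewrite -subr_gt0 vS.
have v0 i : 0 <= v i.
  by rewrite /v addr_ge0// divr_ge0// ?(ltW n0)// mulr_ge0// ltW.
pose c i := sigma_bar sigma (v i) (v i.+1 - v i).
have c0 i : 0 < c i by apply: sigma_bar_gt0 => //; rewrite subr_gt0.
pose D i w := W (v i.+1) w - W (v i) w.
pose X i w := c i * D i w.
pose sd i := c i * Num.sqrt (v i.+1 - v i).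
have sd0 i : 0 < sd i by rewrite mulr_gt0// sqrtr_gt0 subr_gt0.
have mD i : measurable_fun setT (D i) by exact: measurable_funB.
have mX i : measurable_fun setT (X i) by exact: measurable_funM.
have indD : mutually_independent P D.
  by apply: (wiener_indep hW) => // i; exact: ltW.
have mc i (B : set R) : measurable B -> measurable ((fun x : R => c i * x) @^-1` B).
  by move=> mB; apply: preimage_measurable => //; exact: measurable_funM.
have indX : mutually_independent P X.
  move=> s B us mB.
  by apply: (indD s (fun i => (fun x : R => c i * x) @^-1` B i) us) => i; exact: mc.
have XP i (B : set R) : measurable B ->
    P (X i @^-1` B) = (\int[lebesgue_measure]_(x in B) (normal_pdf 0 (sd i) x)%:E)%E.
  move=> mB; transitivity (P [set w | ((fun x : R => c i * x) @^-1` B)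
    (W (v i.+1) w - W (v i) w)]) => //.
  rewrite (wiener_normal hW (v0 i) (v_lt i) (mc i B mB)).
  rewrite (_ : (fun x : R => c i * x) = (fun x : R => c i * x + 0)); last first.
    by apply/funext => x; rewrite addr0.
  by rewrite normal_prob_affine// gt_eqF// sqrtr_gt0 subr_gt0.
have := @mutually_independent_sum_density _ _ _ P (fun i => normal_peak (sd i)) X
  (fun i => normal_pdf 0 (sd i)) 0 n mX indX.
have dX i : bounded_density (normal_peak (sd i)) (normal_pdf 0 (sd i)).
  by apply: normal_pdf_bounded_density; rewrite gt_eqF.
move=> /(_ dX XP A mA); rewrite [LHS](_ : _ = P (window_sum n @^-1` A)); last first.
  congr (P (_ @^-1` A)); apply/funext => w; apply: eq_bigr => i _.
  by rewrite add0n /X /c /D /cell_coef -addnS !window_right.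
move=> ->; rewrite (convolution_sequence_normal_pdf _ _ sd0) /normal_prob.
apply: eq_integral => x _; congr (normal_pdf 0 _ x)%:E.
rewrite -[RHS]ger0_norm -?sqrtr_sqr; last first.
  by rewrite mulr_ge0// ltW// sigma_bar_gt0.
congr Num.sqrt; rewrite exprMn (sqr_sqrtr (ltW h0)) sigma_bar_sqr//.
rewrite (eq_bigr (fun i : 'I_n.+1 => \int[lebesgue_measure]_(x in `[v i, v i.+1]) (sigma x ^+ 2))).
  rewrite sum_cell_integral//; last by move=> i; exact: ltW.
  by rewrite /v mulr0 mul0r addr0 mulfK.
move=> i _; rewrite add0n /sd exprMn (@sqr_sqrtr _ (v i.+1 - v i)); last by rewrite subr_ge0 ltW.
by rewrite sigma_bar_sqr ?subr_gt0// addrC subrK.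
Qed.

End wiener_increment.

(** * Laws of limits in probability *)

(** The open ray from [x] is the increasing union of the rays from [x + 1 / n.+1], so continuity
    from below removes the shift [e]. Rays are stable under intersection and generate the Borel
    sets. *)
Lemma finite_measure_eq_rays (R : realType)
    (m1 m2 : {measure set (measurableTypeR R) -> \bar R}) :
  (m1 setT < +oo)%E ->
  (forall x e : R, 0 < e ->
    (m1 `](x + e)%R, +oo[%classic <= m2 `]x, +oo[%classic)%E /\
    (m2 `](x + e)%R, +oo[%classic <= m1 `]x, +oo[%classic)%E) ->
  forall A : set R, measurable A -> m1 A = m2 A.
Proof.
move=> m1oo m12.
pose ray (x : R) : set (measurableTypeR R) := `]x, +oo[%classic.
have rayE x : \bigcup_n ray (x + n.+1%:R^-1) = ray x.
  apply/seteqP; split => y /=.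
    move=> [n _]; rewrite /ray /= !in_itv/= !andbT; apply: le_lt_trans.
    by rewrite lerDl invr_ge0.
  rewrite /ray/= in_itv/= andbT -subr_gt0 => xy.
  have [n _ /(_ n (leqnn n))] := near_infty_natSinv_lt (PosNum xy).
  by move=> /= ny; exists n => //=; rewrite in_itv/= andbT -ltrBrDl.
have ndray x : {homo (fun n => ray (x + n.+1%:R^-1)) : n k / (n <= k)%N >-> (n <= k)%O}.
  move=> n k nk; apply/subsetPset => y; rewrite /ray/= !in_itv/= !andbT.
  by apply: le_lt_trans; rewrite lerD2l lef_pV2 ?posrE ?ltr0n// ler_nat ltnS.
have mray x : measurable (ray x) by exact: measurable_itv.
have le_ray (n1 n2 : {measure set (measurableTypeR R) -> \bar R}) (x : R) :
    (forall e : R, 0 < e -> (n1 (ray (x + e)%R) <= n2 (ray x))%E) ->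
    (n1 (ray x) <= n2 (ray x))%E.
  move=> n12; rewrite -{1}(rayE x).
  apply: (cvge_to_le (nondecreasing_cvg_mu _ _ (ndray x))) => //.
    by rewrite rayE.
  by near=> n; apply: n12; rewrite invr_gt0.
move=> A mA; apply: (@measure_unique _ R (measurableTypeR R) (@RGenOInfty.G R)
  (fun n => ray (- n%:R)) _ _ _ _ m1 m2 _ _ A mA).
- exact: RGenOInfty.measurableE.
- move=> _ _ [x ->] [y ->]; exists (Num.max x y).
  apply/seteqP; split => z /=; rewrite !in_itv/= !andbT gt_max;
    by [move=> [-> ->]|move=> /andP[-> ->]].
- by move=> n; exists (- n%:R).
- apply/seteqP; split => // x _; exists (Num.bound `|x|) => //=; rewrite /ray/= in_itv/= andbT.
  rewrite ltrNl (le_lt_trans (ler_norm _))// normrN.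
  by apply: archi_boundP; exact: normr_ge0.
- move=> _ [x ->]; apply/eqP; rewrite eq_le; apply/andP; split;
  by apply: le_ray => e e0; have [] := m12 x e e0.
- move=> n; apply: le_lt_trans m1oo; apply: le_measure => //; rewrite inE//.
Unshelve. all: by end_near. Qed.

Section law_limit.
Context d (Omega : measurableType d) {R : realType} (P : probability Omega R).

Lemma markov_sqr (Y : Omega -> R) (e : R) : measurable_fun setT Y -> 0 < e ->
  ((e ^+ 2)%:E * P [set w | e <= `|Y w|]%R <= 'E_P[(fun w => Y w ^+ 2)%R])%E.
Proof.
move=> mY e0; have mA : measurable [set w | e <= `|Y w|].
  rewrite (_ : [set w | _] = (fun w => `|Y w|) @^-1` `[e, +oo[%classic); last first.
    by apply/seteqP; split => w /=; rewrite in_itv/= andbT.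
  rewrite -[X in measurable X]setTI.
  by apply: measurableT_comp.
rewrite -integral_cst// unlock.
have mY2 : measurable_fun setT (fun w => (Y w ^+ 2)%:E).
  by apply/measurable_EFinP; exact: measurable_funX.
apply: (@le_trans _ _ (\int[P]_(w in [set w | (e <= `|Y w|)%R]) (Y w ^+ 2)%:E)%E).
  apply: ge0_le_integral => //.
  - by move=> x _; rewrite lee_fin sqr_ge0.
  - exact: measurable_funTS.
  - move=> w /= ew; rewrite lee_fin -[leRHS]real_normK ?num_real//.
    by rewrite lerXn2r ?nnegrE// ltW.
apply: ge0_subset_integral => //.
by move=> x _; rewrite lee_fin sqr_ge0.
Qed.

(** All the [Z_ n] have the same law on [F], so it suffices to compare [Z] with a single well-chosen
    [Z_ n] on each ray, up to a shift [e] and a probability [eta]. *)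
Lemma limit_in_probability_law (Z_ : nat -> Omega -> R) (Z : Omega -> R)
    (F : set Omega) (nu : {measure set (measurableTypeR R) -> \bar R}) :
  (forall n, measurable_fun setT (Z_ n)) -> measurable_fun setT Z ->
  measurable F -> (nu setT < +oo)%E ->
  (forall n (A : set R), measurable A ->
    P (Z_ n @^-1` A `&` F) = (nu A * P F)%E) ->
  (forall e eta : R, 0 < e -> 0 < eta ->
    exists n, (P [set w | e <= `|Z_ n w - Z w|]%R <= eta%:E)%E) ->
  forall A : set R, measurable A -> P (Z @^-1` A `&` F) = (nu A * P F)%E.
Proof.
move=> mZ_ mZ mF nuoo law cvgZ.
have fF : P F \is a fin_num by exact: fin_num_measure.
have F0 : 0 <= fine (P F) by rewrite fine_ge0.
pose m1 := pushforward_measure (mrestr P mF) (mZ : measurable_fun _ (Z : Omega -> measurableTypeR R)).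
pose m2 := mscale (NngNum F0) nu.
have m2E B : m2 B = (nu B * P F)%E by rewrite /m2/= /mscale/= fineK// muleC.
move=> A mA; rewrite -m2E; change (m1 A = m2 A).
apply: finite_measure_eq_rays => //.
  change (P (Z @^-1` setT `&` F) < +oo)%E.
  by rewrite preimage_setT setTI (le_lt_trans (probability_le1 P mF))// ltry.
have mpre (Y : Omega -> R) (B : set R) : measurable_fun setT Y -> measurable B ->
    measurable (Y @^-1` B).
  by move=> mY mB; rewrite -[X in measurable X]setTI; exact: mY.
(* If [Y1] exceeds [x + e], then [Y2] exceeds [x] unless the two differ by at least [e]. *)
have close (Y1 Y2 : Omega -> R) (x e : R) : measurable_fun setT Y1 ->
    measurable_fun setT Y2 -> 0 < e ->
    (P (Y1 @^-1` `](x + e)%R, +oo[%classic `&` F) <=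
     P (Y2 @^-1` `]x, +oo[%classic `&` F) + P [set w | e <= `|Y1 w - Y2 w|]%R)%E.
  move=> mY1 mY2 e0.
  have m3 : measurable [set w | e <= `|Y1 w - Y2 w|].
    rewrite (_ : [set w | _] = (fun w => `|Y1 w - Y2 w|) @^-1` `[e, +oo[%classic); last first.
      by apply/seteqP; split => w /=; rewrite in_itv/= andbT.
    by apply: mpre => //; apply: measurableT_comp => //; exact: measurable_funB.
  have m2' : measurable (Y2 @^-1` `]x, +oo[%classic `&` F) by apply: measurableI => //; exact: mpre.
  apply: le_trans (measureU2 _ m2' m3).
  apply: le_measure; rewrite ?inE.
  - by apply: measurableI => //; exact: mpre.
  - exact: measurableU.
  move=> w /= []; rewrite !in_itv/= !andbT => xeY Fw.
  have [eY|eY] := leP e `|Y1 w - Y2 w|; first by right.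
  left; split => //.
  by move: eY; rewrite ltr_norml => /andP[_]; lra.
have le_lim (a b : \bar R) : (forall eta, 0 < eta -> exists n : nat,
    exists p : \bar R, (a <= b + p)%E /\ (p <= eta%:E)%E) -> (a <= b)%E.
  move=> H; apply/lee_addgt0Pr => eta /H[n [p [ab pe]]].
  by rewrite (le_trans ab)// leeD2l.
move=> x e e0.
change ((m1 `](x + e)%R, +oo[%classic <= m2 `]x, +oo[%classic)%E /\
  (m2 `](x + e)%R, +oo[%classic <= m1 `]x, +oo[%classic)%E).
rewrite !m2E; split; apply: le_lim => eta eta0.
- have [n Pn] := cvgZ e eta e0 eta0; exists n.
  exists (P [set w | e <= `|Z_ n w - Z w|]%R); split => //.
  rewrite -(law n)//.
  rewrite (_ : [set w | _] = [set w | e <= `|Z w - Z_ n w|]); first exact: close.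
  by apply/seteqP; split => w /=; rewrite distrC.
- have [n Pn] := cvgZ e eta e0 eta0; exists n.
  exists (P [set w | e <= `|Z_ n w - Z w|]%R); split => //.
  by rewrite -(law n)//; exact: close.
Qed.

End law_limit.

(** * Generated sigma-algebras and the increments of the Wiener integral *)

Section generated.
Context d (Omega : measurableType d) {R : realType} (P : probability Omega R).

Lemma generated_measurable {I : Type} {d'} {E : measurableType d'} (D : set I)
    (X : I -> Omega -> E) (i : I) : D i ->
  measurable_fun (setT : set (g_sigma_algebraType
    [set X i @^-1` A | i in D & A in (measurable : set (set E))])) (X i).
Proof.
move=> Di _ A mA; rewrite setTI; apply: sub_sigma_algebra.
by exists i => //; exists A.
Qed.

(** Membership in a generated sigma-algebra is measurability on the type [g_sigma_algebraType], so
    the closure properties of measurable functions apply to it. *)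
Lemma generated_preimage {I : Type} {d'} {E : measurableType d'}
    {d''} {E' : measurableType d''} (D : set I)
    (X : I -> Omega -> E) (Z : Omega -> E') (A : set E') :
  measurable_fun (setT : set (g_sigma_algebraType
    [set X i @^-1` A | i in D & A in (measurable : set (set E))])) Z ->
  measurable A -> generated_sigma_algebra D X (Z @^-1` A).
Proof. exact: preimage_measurable. Qed.

Lemma generated_setT {I : Type} {d'} {E : measurableType d'} (D : set I)
  (X : I -> Omega -> E) : generated_sigma_algebra D X setT.
Proof. exact: (@measurableT _ (g_sigma_algebraType
  [set X i @^-1` A | i in D & A in (measurable : set (set E))])). Qed.

Lemma generated_setI {I : Type} {d'} {E : measurableType d'} (D : set I)
  (X : I -> Omega -> E) (A B : set Omega) : generated_sigma_algebra D X A ->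
  generated_sigma_algebra D X B -> generated_sigma_algebra D X (A `&` B).
Proof. exact: (@measurableI _ (g_sigma_algebraType
  [set X i @^-1` A | i in D & A in (measurable : set (set E))])). Qed.

End generated.

Section increment_law.
Context d (Omega : measurableType d) {R : realType} (P : probability Omega R).
Variables (W I : R -> {RV P >-> R}) (sigma : R -> R).
Hypotheses (hW : wiener_process W).
Hypothesis sigma_cont : {within `[0, +oo[, continuous sigma}.
Hypothesis sigma_bounded : locally_bounded_away sigma.
Hypothesis hI : forall t, 0 <= t ->
  is_wiener_integral P (fun s => W s : Omega -> R) sigma t (I t).
Variables (FN FZ : set (set Omega)).
Hypothesis mFN : forall A, FN A -> measurable A.
Hypothesis mFZ : forall A, FZ A -> measurable A.
Hypothesis indep : independent3 P
  (generated_sigma_algebra `[0, +oo[ (fun t => W t : Omega -> R)) FN FZ.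
Variables t h : R.
Hypotheses (t0 : 0 <= t) (h0 : 0 < h).

Let FW : set (set Omega) :=
  generated_sigma_algebra `[0, +oo[ (fun t => W t : Omega -> R).

Let FWT : FW setT.
Proof. exact: generated_setT. Qed.

Lemma independent_setI E C : FN E -> FZ C -> P (E `&` C) = (P E * P C)%E.
Proof.
by move=> FE FC; have := indep FWT FE FC; rewrite setTI probability_setT mul1e.
Qed.

(** Independence is assumed for the events of [W], and [I] need not be measurable for them. The
    window sums are, and they carry independence over to the limit. *)
Lemma window_sum_generated n (A : set R) : measurable A ->
  FW (window_sum W sigma t h n @^-1` A).
Proof.
move=> mA; apply: generated_preimage => //.
have wpos i : (`[0, +oo[%classic : set R) (window t h n i).
  rewrite /= in_itv/= andbT -(window0 t h n).
  by apply: (nondecreasing_le _ (leq0n i)) => j; have /andP[] := window_step t0 h0 n j.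
apply: measurable_sum => i; apply: measurable_funM => //.
by apply: measurable_funB; apply: generated_measurable; exact: wpos.
Qed.

Lemma window_sum_cvg (e eta : R) : 0 < e -> 0 < eta ->
  exists n, (P [set w | e <= `|window_sum W sigma t h n w -
    (I (t + h) w - I t w)|]%R <= eta%:E)%E.
Proof.
move=> e0 eta0.
have th0 : 0 <= t + h by rewrite addr_ge0// ltW.
pose u n := window t h n.
have ndu n i : u n i <= u n i.+1 by have /andP[] := window_step t0 h0 n i.
have mesh n i : u n i.+1 - u n i <= (t + h) / n.+1%:R.
  by have /andP[_] := window_step t0 h0 n i; rewrite lerBlDl.
have hu (N : nat -> nat) s : (forall n, u n (N n) = s) ->
    forall m, 0 <= u m 0%N /\ (forall i, u m i <= u m i.+1) /\ u m (N m) <= s.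
  by move=> uN m; rewrite /u window0 lexx -/(u m) uN.
have close (s : R) (N : nat -> nat) : 0 <= s -> (forall n, u n (N n) = s) ->
    \forall n \near \oo, (P [set w | e / 2 <= `|step_integral
      (fun s => W s : Omega -> R) (N n) (u n) (cell_coef sigma (u n)) w - I s w|]%R
      <= (eta / 2)%:E)%E.
  move=> s0 uN.
  have := @step_function_cvg_L2 R sigma sigma_cont sigma_bounded s N u
    (fun n => (t + h) / n.+1%:R) (fun n => window0 t h n) ndu uN mesh
    (window_mesh_cvg t h) s0.
  move=> /(hI s0 (hu N s uN)) /fine_cvgP[fin].
  (* Chebyshev's inequality divides by [(e / 2) ^+ 2], so this accuracy leaves a probability of at
     most [eta / 2]. *)
  move/cvgrPdist_lt => /(_ ((e / 2) ^+ 2 * (eta / 2))).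
  have c0 : 0 < (e / 2) ^+ 2 * (eta / 2) by rewrite mulr_gt0 ?exprn_gt0// divr_gt0.
  move=> /(_ c0); apply: filterS2 fin => n fin.
  rewrite sub0r normrN => small.
  have mY : measurable_fun setT (fun w => step_integral (fun s => W s : Omega -> R)
      (N n) (u n) (cell_coef sigma (u n)) w - I s w).
    apply: measurable_funB => //; apply: measurable_sum => i.
    by apply: measurable_funM => //; exact: measurable_funB.
  have e20 : 0 < e / 2 by rewrite divr_gt0.
  have := markov_sqr P mY e20.
  move=> PE.
  have : ((((e / 2) ^+ 2)%:E * P [set w | (e / 2 <= `|step_integral
      (fun s => W s : Omega -> R) (N n) (u n) (cell_coef sigma (u n)) w - I s w|)%R])
      <= ((e / 2) ^+ 2)%:E * (eta / 2)%:E)%E.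
    rewrite (le_trans PE)// -EFinM -(fineK fin) lee_fin.
    by rewrite (le_trans (ler_norm _))// ltW.
  by rewrite lee_pmul2l ?lte_fin ?exprn_gt0.
have c1 := close t (fun n => n.+1) t0 (window_left t h).
have c2 := close (t + h) (fun n => (n.+1 + n.+1)%N) th0 (window_end t h).
near \oo => n; exists n.
have mY s N : measurable [set w | e / 2 <= `|step_integral (fun s => W s : Omega -> R)
    N (u n) (cell_coef sigma (u n)) w - I s w|].
  rewrite (_ : [set w | _] = (fun w => `|step_integral (fun s => W s : Omega -> R)
      N (u n) (cell_coef sigma (u n)) w - I s w|) @^-1` `[e / 2, +oo[%classic).
    apply: preimage_measurable => //; apply: measurableT_comp => //.
    apply: measurable_funB => //; apply: measurable_sum => i.
    by apply: measurable_funM => //; exact: measurable_funB.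
  by apply/seteqP; split => w /=; rewrite in_itv/= andbT.
have -> : eta%:E = ((eta / 2)%:E + (eta / 2)%:E)%E by rewrite -EFinD -splitr.
have d1 : (P [set w | e / 2 <= `|step_integral (fun s => W s : Omega -> R) n.+1
  (u n) (cell_coef sigma (u n)) w - I t w|]%R <= (eta / 2)%:E)%E by near: n.
have d2 : (P [set w | e / 2 <= `|step_integral (fun s => W s : Omega -> R) (n.+1 + n.+1)
  (u n) (cell_coef sigma (u n)) w - I (t + h) w|]%R <= (eta / 2)%:E)%E by near: n.
apply: le_trans (leeD d2 d1).
apply: le_trans (measureU2 P (mY (t + h) (n.+1 + n.+1)%N) (mY t n.+1)).
apply: le_measure; rewrite ?inE.
- rewrite (_ : [set w | _] = (fun w => `|window_sum W sigma t h n w -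
      (I (t + h) w - I t w)|) @^-1` `[e, +oo[%classic).
    apply: preimage_measurable => //; apply: measurableT_comp => //.
    apply: measurable_funB; first exact: measurable_window_sum.
    exact: measurable_funB.
  by apply/seteqP; split => w /=; rewrite in_itv/= andbT.
- by apply: measurableU; exact: mY.
move=> w /=; rewrite -window_sumE -/(u n).
set a := step_integral _ _ _ _ _; set b := step_integral _ _ _ _ _ => eab.
have [ea|ea] := leP (e / 2) `|a - I (t + h) w|; first by left.
right; move: eab ea.
have := ler_normD (a - I (t + h) w) (I t w - b).
rewrite (distrC (I t w)) (_ : a - _ + _ = a - b - (I (t + h) w - I t w)); last by ring.
lra.
Unshelve. all: by end_near. Qed.

Lemma wiener_integral_increment (E C : set Omega) (A : set R) :
  FN E -> FZ C -> measurable A ->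
  P ((fun w => I (t + h) w - I t w) @^-1` A `&` (E `&` C)) =
  (normal_prob 0 (sigma_bar sigma t h * Num.sqrt h) A * P (E `&` C))%E.
Proof.
move=> FE FC mA.
have mEC : measurable (E `&` C) by apply: measurableI; [exact: mFN|exact: mFZ].
apply: (@limit_in_probability_law _ _ _ P (window_sum W sigma t h)) => //.
- by move=> n; exact: measurable_window_sum.
- exact: measurable_funB.
- by rewrite (le_lt_trans (probability_le1 _ _))// ltry.
- move=> n B mB; rewrite setIA.
  rewrite (indep (window_sum_generated n mB) FE FC).
  by rewrite (window_sum_law hW)// independent_setI// muleA.
- exact: window_sum_cvg.
Qed.

End increment_law.

(** * The series of Poisson-weighted convolution powers *)

(** The function [H] of the overview; the number of jumps is written [k.+1], so the term without
    jumps is absent. *)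
Definition jump_intensity_density (R : realType) (phi f : R -> R) (La x : R) : R :=
  limn (fun n => \sum_(0 <= k < n) La ^+ k.+1 / k.+1`!%:R *
                   convolution phi (convolution_power f k.+1) x).

Section power_weighted_series.
Context {R : realType}.
Variables (La M : R) (a : nat -> R).
Hypotheses (La0 : 0 <= La) (a0 : forall k, 0 <= a k) (aM : forall k, a k <= M).

Let u n := \sum_(0 <= k < n) La ^+ k.+1 / k.+1`!%:R * a k.

Lemma sum_exp_coeff_le n :
  \sum_(0 <= k < n) La ^+ k / k`!%:R <= expR La.
Proof.
rewrite [leLHS](_ : _ = series (exp_coeff La) n); last first.
  by rewrite /series/=; apply: eq_bigr => k _; rewrite /exp_coeff.
apply: nondecreasing_cvgn_le; last exact: is_cvg_series_exp_coeff.
by apply: nondecreasing_series => k _ _; exact: exp_coeff_ge0.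
Qed.

Let term_ge0 k : 0 <= La ^+ k.+1 / k.+1`!%:R * a k.
Proof. by rewrite mulr_ge0// divr_ge0// exprn_ge0. Qed.

Let fact_le m k : La ^+ (k + m) / (k + m)`!%:R <= La ^+ m * (La ^+ k / k`!%:R).
Proof.
rewrite exprD mulrC mulrA -mulrA [leLHS](_ : _ = La ^+ m * (La ^+ k / (k + m)`!%:R)); last by ring.
rewrite ler_wpM2l ?exprn_ge0// ler_wpM2l ?exprn_ge0// lef_pV2 ?posrE ?ltr0n ?fact_gt0//.
by rewrite ler_nat leq_fact// leq_addr.
Qed.

Let M0 : 0 <= M. Proof. exact: le_trans (a0 0) (aM 0). Qed.

(** Since [(k + m)!] is at least [k!], factoring out [La ^+ m] leaves at most the exponential
    series. The case [m = 1] bounds the whole series, and [m = 2] the terms with two or more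
    jumps. *)
Let u_tail m n : \sum_(0 <= k < n) La ^+ (k + m) / (k + m)`!%:R <= La ^+ m * expR La.
Proof.
apply: le_trans (ler_wpM2l (exprn_ge0 m La0) (sum_exp_coeff_le n)).
by rewrite mulr_sumr; apply: ler_sum => k _; exact: fact_le.
Qed.

Lemma power_weighted_series_le n : u n <= M * (La * expR La).
Proof.
have := u_tail 1 n; rewrite expr1 => /(ler_wpM2l M0); apply: le_trans.
rewrite mulr_sumr; apply: ler_sum => k _; rewrite addn1 mulrC.
by rewrite ler_wpM2r// divr_ge0// exprn_ge0.
Qed.

Lemma power_weighted_series_nd : nondecreasing_seq u.
Proof.
apply/nondecreasing_seqP => n.
by rewrite /u big_nat_recr//= lerDl.
Qed.

Lemma cvg_power_weighted_series : cvgn u.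
Proof.
apply: nondecreasing_is_cvgn; first exact: power_weighted_series_nd.
by exists (M * (La * expR La)) => _ [n _ <-]; exact: power_weighted_series_le.
Qed.

(** The one-jump term is exact and everything else is of second order in [La]; this gives the
    leading term of the intensity. *)
Lemma lim_power_weighted_series_bounds :
  La * a 0%N <= limn u <= La * a 0%N + M * (La ^+ 2 * expR La).
Proof.
apply/andP; split.
  apply: le_trans (nondecreasing_cvgn_le power_weighted_series_nd cvg_power_weighted_series 1).
  by rewrite /u big_nat1 expr1 divr1.
apply: limr_le; first exact: cvg_power_weighted_series.
near=> n; have n0 : (0 < n)%N by near: n; exact: nbhs_infty_gt.
rewrite -(prednK n0) /u big_nat_recl// expr1 divr1 lerD2l.
have := u_tail 2 n.-1 => /(ler_wpM2l M0); apply: le_trans.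
rewrite mulr_sumr; apply: ler_sum => k _; rewrite addn2 mulrC.
by rewrite ler_wpM2r// divr_ge0// exprn_ge0.
Unshelve. all: by end_near. Qed.

Lemma lim_power_weighted_series_EFin :
  (limn u)%:E = (\sum_(0 <= k <oo) (La ^+ k.+1 / k.+1`!%:R * a k)%:E)%E.
Proof.
rewrite -EFin_lim; last exact: cvg_power_weighted_series.
by congr (limn _); apply/funext => n; rewrite /= sumEFin.
Qed.

End power_weighted_series.

(** * The loss in terms of the conditional densities *)

Section loss_formula.
Context d (Omega : measurableType d) {R : realType} (P : probability Omega R).
Variables (gamma sigma lambda f : R -> R) (M : R).
Variables (W I : R -> {RV P >-> R}) (N : R -> {RV P >-> nat}).
Variable zeta : nat -> {RV P >-> R}.
Hypothesis gamma_meas : measurable_fun (`[0, +oo[ : set R) gamma.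
Hypothesis lambda_meas : measurable_fun (`[0, +oo[ : set R) lambda.
Hypothesis gamma_bounded : locally_bounded_away gamma.
Hypothesis lambda_bounded : locally_bounded_away lambda.
Hypothesis sigma_bounded : locally_bounded_away sigma.
Hypothesis sigma_cont : {within `[0, +oo[, continuous sigma}.
Hypothesis df : bounded_density M f.
Hypothesis hW : wiener_process W.
Hypothesis hI : forall t, 0 <= t ->
  is_wiener_integral P (fun s => W s : Omega -> R) sigma t (I t).
Hypothesis hN : poisson_process lambda N.
Hypothesis hzeta : iid_with_density f zeta.
Hypothesis hindep : independent3 P
  (generated_sigma_algebra `[0, +oo[ (fun t => W t : Omega -> R))
  (generated_sigma_algebra `[0, +oo[ (fun t => N t : Omega -> nat))
  (generated_sigma_algebra setT (fun j => zeta j : Omega -> R)).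
Variables t h : R.
Hypotheses (t0 : 0 <= t) (h0 : 0 < h).

Local Notation mu := (@lebesgue_measure R).
Let FN := generated_sigma_algebra `[0, +oo[ (fun t => N t : Omega -> nat).
Let FZ := generated_sigma_algebra setT (fun j => zeta j : Omega -> R).
Let X := jump_diffusion gamma (fun t => I t : Omega -> R)
  (fun t => N t : Omega -> nat) (fun j => zeta j : Omega -> R).
Let c := h * average gamma t h.
Let s := sigma_bar sigma t h * Num.sqrt h.
Let La := h * average lambda t h.
Let Y w := X (t + h) w - X t w.
Let U w := I (t + h) w - I t w + c.

Let th0 : 0 <= t + h. Proof. by rewrite addr_ge0// ltW. Qed.
Let tth : t <= t + h. Proof. by rewrite lerDl ltW. Qed.
Let s0 : 0 < s.
Proof. by apply: mulr_gt0; [exact: sigma_bar_gt0|rewrite sqrtr_gt0]. Qed.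

Let averageE g : h * average g t h = \int[mu]_(x in `[t, t + h]) g x.
Proof. by rewrite /average mulrA mulfV ?mul1r// gt_eqF. Qed.

Let La0 : 0 < La.
Proof.
rewrite mulr_gt0//.
have [|l [v [l0 _ lv]]] := @locally_bounded_awayP _ _ (t + h) _ lambda_bounded.
  by rewrite ltr_wpDl.
suff /andP[] : l <= average lambda t h <= v by move=> /(lt_le_trans l0).
apply: average_bounded => // x /andP[tx xth]; apply: lv.
by rewrite xth (le_trans t0).
Qed.

Let drift : \int[mu]_(x in `[0, t + h]) gamma x -
  \int[mu]_(x in `[0, t]) gamma x = c.
Proof.
have [|l [v [l0 _ lv]]] := @locally_bounded_awayP _ _ (t + h) _ gamma_bounded.
  by rewrite ltr_wpDl.
rewrite /c averageE (@Rintegral_itv_chain _ gamma 0 t (t + h) v)//.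
- by rewrite addrAC subrr add0r.
- apply: measurable_funS gamma_meas => // x /=.
  by rewrite !in_itv/= andbT => /andP[].
- move=> x /lv /andP[lx xv]; rewrite ger0_norm//.
  by rewrite (le_trans _ lx)// ltW.
Qed.

Let FN_measurable A : FN A -> measurable A.
Proof.
apply: smallest_sub; first exact: sigma_algebra_measurable.
by move=> _ [i _ [B mB <-]]; exact: preimage_measurable.
Qed.

Let FZ_measurable A : FZ A -> measurable A.
Proof.
apply: smallest_sub; first exact: sigma_algebra_measurable.
by move=> _ [i _ [B mB <-]]; exact: preimage_measurable.
Qed.

Let FZT : FZ setT. Proof. exact: generated_setT. Qed.

Let U_law (E C : set Omega) (A : set R) : FN E -> FZ C -> measurable A ->
  P (U @^-1` A `&` (E `&` C)) = (normal_prob c s A * P (E `&` C))%E.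
Proof.
move=> FE FC mA.
pose A' := (fun x : R => 1 * x + c) @^-1` A.
have mA' : measurable A'.
  by apply: preimage_measurable => //; apply: measurable_funD => //.
have UE : U @^-1` A = (fun w => I (t + h) w - I t w) @^-1` A'.
  by apply/seteqP; split => w; rewrite /A' /U /= mul1r.
rewrite UE.
apply: (etrans (@wiener_integral_increment _ _ _ P W I sigma hW sigma_cont
  sigma_bounded hI FN FZ FN_measurable FZ_measurable hindep t h t0 h0 E C A'
  FE FC mA')).
by rewrite normal_prob_affine ?mul1r// gt_eqF.
Qed.

(** Fixing the count [m] at time [t], and not only the number [k] of new jumps, makes the jumps of
    the window a deterministic block of [zeta] starting at index [m]. *)
Let E m k := N t @^-1` [set m] `&` N (t + h) @^-1` [set (m + k)%N].
Let D k := [set w | N (t + h) w = (N t w + k)%N].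

Let FE m k : FN (E m k).
Proof.
by apply: generated_setI; apply: generated_preimage => //;
  apply: generated_measurable; rewrite /= in_itv/= andbT.
Qed.

Let DE k : D k = \bigcup_m E m k.
Proof.
apply/seteqP; split => [w Dw|w [m _ [/= Nt Nth]]].
  by exists (N t w) => //; split.
by rewrite /D/= Nt Nth.
Qed.

Let FD k : FN (D k).
Proof.
rewrite DE; apply: (@bigcup_measurable _ (g_sigma_algebraType
  [set N i @^-1` A | i in `[0%R, +oo[ & A in (measurable : set (set nat))])) => m _; exact: FE.
Qed.

Let trivE k : trivIset setT (E ^~ k).
Proof. by move=> i j _ _ [w [[/= <- _] [/= <- _]]]. Qed.

Let D_law k : P (D k) = (La ^+ k / k`!%:R * expR (- La))%:E.
Proof.
have tth' : t < t + h by rewrite ltrDl.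
by rewrite (poisson_law hN t0 tth' k) -averageE /poisson_pmf -/La La0.
Qed.

Let S m k w := \sum_(i < k.+1) zeta (m + i)%N w.

Let mS m k : measurable_fun setT (S m k).
Proof. exact: measurable_sum. Qed.

Let FS m k (A : set R) : measurable A -> FZ (S m k @^-1` A).
Proof.
move=> mA; apply: generated_preimage => //; apply: measurable_sum => i.
exact: generated_measurable.
Qed.

Let S_law m k (A : set R) : measurable A ->
  P (S m k @^-1` A) = (\int[mu]_(x in A) (convolution_power f k.+1 x)%:E)%E.
Proof.
move=> mA; rewrite -(convolution_sequence_cst f m).
have [zf zind] := hzeta.
exact: (@mutually_independent_sum_density _ _ _ P (fun=> M)
  (fun j => zeta j : Omega -> R) (fun=> f)).
Qed.

Let dfk k : bounded_density M (convolution_power f k.+1).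
Proof.
by rewrite -(convolution_sequence_cst f 0); exact: (convolution_sequence_bounded_density _ _ (fun=> df)).
Qed.

Let dphi : bounded_density (normal_peak s) (normal_pdf c s).
Proof. by apply: normal_pdf_bounded_density; rewrite gt_eqF. Qed.

Let mU : measurable_fun setT U.
Proof. by apply: measurable_funD => //; exact: measurable_funB. Qed.

Let US_law m k (A : set R) : measurable A ->
  P ((fun w => U w + S m k w) @^-1` A `&` E m k.+1) =
  (\int[mu]_(x in A)
    (convolution (normal_pdf c s) (convolution_power f k.+1) x)%:E *
   P (E m k.+1))%E.
Proof.
move=> mA.
apply: (independent_sum_density mU (mS m k) _ dphi) => //.
- by apply: FN_measurable; exact: FE.
- exact: (bd_measurable (dfk k)).
- exact: (bd_ge0 (dfk k)).
- by rewrite (bd_integral (dfk k)) ltry.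
move=> A1 A2 mA1 mA2.
rewrite -setIA (setIC _ (E m k.+1)) U_law//; last exact: FS.
rewrite (@independent_setI _ _ _ _ W FN FZ hindep)//; first by rewrite S_law// muleA muleAC.
exact: FS.
Qed.

Let Y_E m k w : E m k w -> Y w = U w + \sum_(i < k) zeta (m + i)%N w.
Proof.
move=> [/= Nt Nth]; rewrite /Y /X /jump_diffusion Nt Nth big_split_ord/= /U -drift.
by ring.
Qed.

Lemma measurable_random_sum (K : {RV P >-> nat}) :
  measurable_fun setT (fun w => \sum_(j < K w) zeta j w).
Proof.
move=> _ A mA; rewrite setTI.
rewrite (_ : _ @^-1` _ = \bigcup_n (K @^-1` [set n] `&`
    (fun w => \sum_(j < n) zeta j w) @^-1` A)).
  apply: bigcup_measurable => n _; apply: measurableI; apply: preimage_measurable => //.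
  exact: measurable_sum.
apply/seteqP; split => [w Aw|w [n _ [/= <-]]//].
by exists (K w).
Qed.

Let mY : measurable_fun setT Y.
Proof.
by apply: measurable_funB; (apply: measurable_funD; last exact: measurable_random_sum);
  exact: measurable_funD.
Qed.

Let N_decreasing_measurable : measurable [set w | (N (t + h) w < N t w)%N].
Proof.
rewrite (_ : [set w | _] = \bigcup_m \bigcup_k (N (t + h) @^-1` [set m] `&`
    N t @^-1` [set (m + k.+1)%N])).
  by do 2 (apply: bigcup_measurable => ? _); apply: measurableI;
    apply: preimage_measurable.
apply/seteqP; split => [w /= lt|w [m _ [k _ [/= -> ->]]]]; last by lia.
exists (N (t + h) w) => //; exists (N t w - N (t + h) w).-1 => //; split => //=.
by lia.
Qed.

(** Paths of [N] are nondecreasing only almost surely, so the event [N (t + h) <> N t] is the event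
    of at least one new jump up to this null set. *)
Let N_decreasing_null : P [set w | (N (t + h) w < N t w)%N] = 0%E.
Proof.
apply/negligibleP => //.
apply: negligibleS (poisson_paths hN) => w /= lt [mono _].
by have := mono t (t + h) t0 tth; lia.
Qed.

(** On each [E m k.+1] the increment has the same density whatever [m] is, so its integral [J]
    factors out of the sum over [m]. For this [J] must be finite: it is at most the total mass 1. *)
Let YD_law k (A : set R) : measurable A ->
  P (Y @^-1` A `&` D k.+1) = ((\int[mu]_(x in A)
    (convolution (normal_pdf c s) (convolution_power f k.+1) x)%:E) * P (D k.+1))%E.
Proof.
move=> mA.
have mE m j : measurable (E m j) by apply: FN_measurable.
rewrite {1}DE setI_bigcupr measure_bigcup//=; first last.
- move=> i j _ _ [w [[_ Ei] [_ Ej]]]; apply: (@trivE k.+1) => //.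
  by exists w.
- by move=> i _; apply: measurableI => //; exact: preimage_measurable.
set J := (\int[mu]_(x in A) _)%E.
have J0 : (0 <= J)%E.
  apply: integral_ge0 => x _; rewrite lee_fin.
  exact: (bd_ge0 (convolution_bounded_density dphi (dfk k))).
have fJ : J \is a fin_num.
  rewrite ge0_fin_numE// (@le_lt_trans _ _ 1%E) ?ltry//.
  rewrite -(bd_integral (convolution_bounded_density dphi (dfk k))).
  apply: ge0_subset_integral => //.
    apply/measurable_EFinP; exact: (bd_measurable (convolution_bounded_density dphi (dfk k))).
  by move=> x _; rewrite lee_fin (bd_ge0 (convolution_bounded_density dphi (dfk k))).
rewrite DE measure_bigcup//= -(fineK fJ) -nneseriesZl; last by move=> i _.
rewrite (fineK fJ); apply: eq_eseriesr => m _.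
rewrite -US_law//; congr (P _); apply/seteqP; split => w [/= Aw Ew]; split => //=.
  by rewrite -(Y_E Ew).
by rewrite (Y_E Ew).
Qed.

Let H x := jump_intensity_density (normal_pdf c s) f La x.

(** The Poisson probabilities are the coefficients of [H] times [expR (- La)], and nonnegativity
    lets the sum over the number of jumps pass under the integral. *)
Lemma loss_jump (A : set R) : measurable A ->
  P [set w | A (Y w) /\ N (t + h) w <> N t w] =
  ((expR (- La))%:E * \int[mu]_(x in A) (H x)%:E)%E.
Proof.
move=> mA.
have mD k : measurable (D k) by exact: FN_measurable.
have dck k := convolution_bounded_density dphi (dfk k).
have -> : [set w | A (Y w) /\ N (t + h) w <> N t w] =
    \bigcup_k (Y @^-1` A `&` D k.+1) `|`
    (Y @^-1` A `&` [set w | (N (t + h) w < N t w)%N]).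
  apply/seteqP; split => [w [/= Aw /eqP]|w].
    rewrite neq_ltn => /orP[lt|lt]; first by right.
    left; exists (N (t + h) w - N t w).-1 => //; split => //.
    by rewrite /D/=; lia.
  by move=> [[k _ [/= Aw]]|[/= Aw lt]]; rewrite /D/= => *; split => //; lia.
have mlt := N_decreasing_measurable.
rewrite measureU0; first last.
- apply: subset_measure0 N_decreasing_null => //.
  + by apply: measurableI => //; exact: preimage_measurable.
- by apply: measurableI => //; exact: preimage_measurable.
- by apply: bigcup_measurable => k _; apply: measurableI => //; exact: preimage_measurable.
have mYD k : measurable (Y @^-1` A `&` D k.+1).
  by apply: measurableI => //; exact: preimage_measurable.
rewrite measure_semi_bigcup//; first last.
- exact: bigcup_measurable.
- by move=> i j _ _ [w [[_ +] [_ +]]]; rewrite /D/=; lia.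
transitivity (\sum_(0 <= k <oo) ((expR (- La))%:E * \int[mu]_(x in A)
  (La ^+ k.+1 / k.+1`!%:R *
     convolution (normal_pdf c s) (convolution_power f k.+1) x)%:E))%E.
  apply: eq_eseriesr => k _; apply: (etrans (YD_law k mA)); rewrite D_law.
  under [in RHS]eq_integral do rewrite EFinM.
  rewrite ge0_integralZl//.
  - by rewrite muleA -EFinM muleC (mulrC (expR _)).
  - by apply/measurable_EFinP/measurable_funTS; exact: (bd_measurable (dck k)).
  - by move=> x _; rewrite lee_fin (bd_ge0 (dck k)).
  - by rewrite lee_fin divr_ge0// exprn_ge0// ltW.
have term0 k x : 0 <= La ^+ k.+1 / k.+1`!%:R *
    convolution (normal_pdf c s) (convolution_power f k.+1) x.
  by rewrite mulr_ge0 ?(bd_ge0 (dck k))// divr_ge0// exprn_ge0// ltW.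
rewrite nneseriesZl; last first.
  by move=> k _; apply: integral_ge0 => x _; rewrite lee_fin.
rewrite -integral_nneseries//.
- congr (_ * _)%E; apply: eq_integral => x _.
  rewrite /H /jump_intensity_density.
  rewrite -(@lim_power_weighted_series_EFin R La (normal_peak s)
    (fun k => convolution (normal_pdf c s) (convolution_power f k.+1) x))//.
  + exact: ltW.
  + by move=> k; exact: (bd_ge0 (dck k)).
  + by move=> k; exact: (bd_le (dck k)).
- move=> k; apply/measurable_EFinP/measurable_funTS; apply: measurable_funM => //.
  exact: (bd_measurable (dck k)).
- by move=> k x _; rewrite lee_fin.
Qed.

Lemma loss_no_jump (A : set R) : measurable A ->
  P [set w | A (Y w) /\ N (t + h) w = N t w] =
  ((expR (- La))%:E * normal_prob c s A)%E.
Proof.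
move=> mA.
have -> : [set w | A (Y w) /\ N (t + h) w = N t w] = U @^-1` A `&` (D 0 `&` setT).
  rewrite setIT; apply/seteqP; split => w [/= Aw]; rewrite /D/= addn0 => Nw; split => //=.
    suff <- : Y w = U w by [].
    by rewrite (@Y_E (N t w) 0) ?big_ord0 ?addr0//; split => //=; rewrite addn0.
  suff -> : Y w = U w by [].
  by rewrite (@Y_E (N t w) 0) ?big_ord0 ?addr0//; split => //=; rewrite addn0.
by rewrite U_law// setIT D_law expr0 fact0 divr1 mul1r muleC.
Qed.

Lemma loss_formula B :
  loss P X (fun t => N t : Omega -> nat) t h B =
  ((expR (- La))%:E * (normal_prob c s (~` `[(- B)%R, B]%classic) +
    \int[mu]_(x in `[(- B)%R, B]) (H x)%:E))%E.
Proof.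
rewrite /loss.
rewrite (_ : [set w | B < _ /\ _] = [set w | (~` `[- B, B]) (Y w) /\ N (t + h) w = N t w]).
  rewrite (_ : [set w | _ <= B /\ _] = [set w | (`[- B, B]%classic) (Y w) /\ N (t + h) w <> N t w]).
    have nu0 : (0 <= normal_prob c s (~` `[(- B)%R, B]%classic))%E.
      exact: measure_ge0.
    have H0 : (0 <= \int[mu]_(x in `[(- B)%R, B]) (H x)%:E)%E.
      apply: integral_ge0 => x _; rewrite lee_fin /H /jump_intensity_density.
      have dck k := convolution_bounded_density dphi (dfk k).
      have /andP[+ _] := @lim_power_weighted_series_bounds R La (normal_peak s)
        (fun k => convolution (normal_pdf c s) (convolution_power f k.+1) x) (ltW La0)
        (fun k => bd_ge0 (dck k) x) (fun k => bd_le (dck k) x).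
      by apply: le_trans; rewrite mulr_ge0 ?(ltW La0)// (bd_ge0 (dck 0)).
    rewrite loss_no_jump; last by apply: measurableC.
    by rewrite (ge0_muleDr _ nu0 H0) -(loss_jump (measurable_itv _)).
  by apply/seteqP; split => w /=; rewrite in_itv/= -ler_norml.
by apply/seteqP; split => w /=; rewrite in_itv/= -ler_norml => -[Bw Nw]; split => //;
  [apply/negP; rewrite -ltNge|rewrite ltNge; apply/negP].
Qed.

End loss_formula.

(** * First-order condition for a minimum over symmetric intervals *)

Section symmetric_minimum.
Context {R : realType}.
Local Notation mu := (@lebesgue_measure R).
Variable g : R -> R.
Hypothesis cg : continuous g.

Lemma continuous_itv_integrable (i : interval R) (a b : R) :
  ([set` i] `<=` `[a, b])%classic -> mu.-integrable [set` i] (EFin \o g).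
Proof.
move=> iab; apply: (@integrableS _ _ _ mu `[a, b]%classic) => //.
apply: continuous_compact_integrable; first exact: segment_compact.
exact: continuous_subspaceT.
Qed.

Lemma Rintegral_symmetric_itv (B C : R) : 0 <= B -> B <= C ->
  \int[mu]_(x in `[- C, C]) g x = \int[mu]_(x in `[- B, B]) g x +
    (\int[mu]_(x in `]B, C]) g x + \int[mu]_(x in `[- C, - B[) g x).
Proof.
move=> B0 BC.
have iC : mu.-integrable `[- C, C] (EFin \o g).
  exact: (@continuous_itv_integrable _ (- C) C).
rewrite -(@Rintegral_itvB _ g (BLeft (- C)) (BRight C) B iC)//=; last first.
  by rewrite bnd_simp; lra.
have iB : mu.-integrable `[- C, B] (EFin \o g).
  by apply: (@continuous_itv_integrable _ (- C) C) => x /=; rewrite !in_itv/=; lra.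
have : \int[mu]_(x in `[- C, B]) g x - \int[mu]_(x in `[- C, - B]) g x =
    \int[mu]_(x in `](- B), B]) g x.
  by apply: Rintegral_itvB => //; rewrite bnd_simp; lra.
rewrite Rintegral_itv_obnd_cbnd; last first.
  by apply: (@continuous_itv_integrable _ (- C) C) => x /=; rewrite !in_itv/=; lra.
rewrite -[in X in _ - X = _](@Rintegral_itv_bndo_bndc _ _ (- B)); last first.
  by apply: (@continuous_itv_integrable _ (- C) C) => x /=; rewrite !in_itv/=; lra.
by lra.
Qed.

Lemma Rintegral_itv_le (i : interval R) (a b l v : R) :
  ([set` i] `<=` `[a, b])%classic -> mu [set` i] = l%:E ->
  (forall x, x \in i -> g x <= v) -> \int[mu]_(x in [set` i]) g x <= v * l.
Proof.
move=> iab il gv.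
have -> : v * l = \int[mu]_(x in [set` i]) v by rewrite Rintegral_cst//= il.
apply: le_Rintegral => //; first exact: continuous_itv_integrable iab.
apply: (@itv_bounded_integrable _ _ (cst v) `|v|) => //.
by rewrite il ltry.
Qed.

Lemma Rintegral_itv_ge (i : interval R) (a b l v : R) :
  ([set` i] `<=` `[a, b])%classic -> mu [set` i] = l%:E ->
  (forall x, x \in i -> v <= g x) -> v * l <= \int[mu]_(x in [set` i]) g x.
Proof.
move=> iab il gv.
have -> : v * l = \int[mu]_(x in [set` i]) v by rewrite Rintegral_cst//= il.
apply: le_Rintegral => //; last exact: continuous_itv_integrable iab.
apply: (@itv_bounded_integrable _ _ (cst v) `|v|) => //.
by rewrite il ltry.
Qed.

Variable B : R.
Hypothesis B0 : 0 <= B.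
Hypothesis Bmin : forall C, 0 <= C ->
  \int[mu]_(x in `[- B, B]) g x <= \int[mu]_(x in `[- C, C]) g x.

Let near_g (e : R) : 0 < e -> exists2 d : R, 0 < d & forall x,
  (B - d <= x <= B + d -> g B - e <= g x <= g B + e) /\
  (- B - d <= x <= - B + d -> g (- B) - e <= g x <= g (- B) + e).
Proof.
move=> e0.
have cB := @cg B; have cNB := @cg (- B).
move/cvgrPdist_le : cB => /(_ e e0) /nbhs_ballP[d1 /= d10 h1].
move/cvgrPdist_le : cNB => /(_ e e0) /nbhs_ballP[d2 /= d20 h2].
have d12 : 0 < Num.min d1 d2 by rewrite lt_min d10.
have dd1 : Num.min d1 d2 <= d1 by rewrite ge_min lexx.
have dd2 : Num.min d1 d2 <= d2 by rewrite ge_min lexx orbT.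
exists (Num.min d1 d2 / 2); first by rewrite divr_gt0.
move=> x; split => /andP[x1 x2]; rewrite -ler_distl distrC.
- by apply: h1; rewrite /ball/= distrC ltr_norml; apply/andP; split; lra.
- by apply: h2; rewrite /ball/= distrC ltr_norml; apply/andP; split; lra.
Qed.

(** Otherwise widening the interval slightly on both sides would lower the integral. This comparison
    is possible even at [B = 0]. *)
Lemma symmetric_minimum_ge0 : 0 <= g B + g (- B).
Proof.
rewrite leNgt; apply/negP => gB.
(* An error of a quarter of the gap at each endpoint leaves half of the gap, which keeps its
   sign. *)
have [|d d0 near] := @near_g (- (g B + g (- B)) / 4); first by lra.
have BBd : B <= B + d by rewrite lerDl ltW.
have := Bmin (le_trans B0 BBd); rewrite (Rintegral_symmetric_itv B0 BBd) lerDl.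
apply/negP; rewrite -ltNge.
have i1 : \int[mu]_(x in `]B, B + d]) g x <= (g B - (g B + g (- B)) / 4) * d.
  apply: (@Rintegral_itv_le _ B (B + d)).
  - by move=> x /=; rewrite !in_itv/= => /andP[/ltW -> ->].
  - by rewrite lebesgue_measure_itv/= lte_fin ltrDl d0 -EFinD addrC addKr.
  - move=> x; rewrite in_itv/= => /andP[x1 x2].
    have [hx _] := near x; have /hx/andP[] : B - d <= x <= B + d; last by lra.
    by apply/andP; split; lra.
have i2 : \int[mu]_(x in `[- (B + d), - B[) g x <= (g (- B) - (g B + g (- B)) / 4) * d.
  apply: (@Rintegral_itv_le _ (- (B + d)) (- B)).
  - by move=> x /=; rewrite !in_itv/= => /andP[-> /ltW ->].
  - rewrite lebesgue_measure_itv/= lte_fin ltrN2 ltrDl d0 -EFinD; congr EFin; ring.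
  - move=> x; rewrite in_itv/= => /andP[x1 x2].
    have [_ hx] := near x; have /hx/andP[] : - B - d <= x <= - B + d; last by lra.
    by apply/andP; split; lra.
have : (g B + g (- B)) * d < 0 by rewrite nmulr_rlt0.
by lra.
Qed.

(** The reverse inequality comes from shrinking the interval, for which [B] must be positive. *)
Lemma symmetric_minimum_eq0 : 0 < B -> g B + g (- B) = 0.
Proof.
move=> Bp; apply/eqP; rewrite eq_le symmetric_minimum_ge0 andbT leNgt.
apply/negP => gB.
have [|d' d'0 near'] := @near_g ((g B + g (- B)) / 4); first by lra.
pose d := Num.min d' B.
have d0 : 0 < d by rewrite lt_min d'0.
have dB : d <= B by rewrite ge_min lexx orbT.
have dd' : d <= d' by rewrite ge_min lexx.
have Bd0 : 0 <= B - d by lra.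
have BdB : B - d <= B by lra.
have := Bmin Bd0; rewrite (Rintegral_symmetric_itv Bd0 BdB) gerDl.
apply/negP; rewrite -ltNge.
have i1 : (g B - (g B + g (- B)) / 4) * d <= \int[mu]_(x in `](B - d), B]) g x.
  apply: (@Rintegral_itv_ge _ (B - d) B).
  - by move=> x /=; rewrite !in_itv/= => /andP[/ltW -> ->].
  - by rewrite lebesgue_measure_itv/= lte_fin ltrBlDr ltrDl d0 -EFinD; congr EFin; ring.
  - move=> x; rewrite in_itv/= => /andP[x1 x2].
    have [hx _] := near' x; have /hx/andP[] : B - d' <= x <= B + d'; last by lra.
    by apply/andP; split; lra.
have i2 : (g (- B) - (g B + g (- B)) / 4) * d <= \int[mu]_(x in `[- B, - (B - d)[) g x.
  apply: (@Rintegral_itv_ge _ (- B) (- (B - d))).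
  - by move=> x /=; rewrite !in_itv/= => /andP[-> /ltW ->].
  - by rewrite lebesgue_measure_itv/= lte_fin ltrN2 ltrBlDr ltrDl d0 -EFinD; congr EFin; ring.
  - move=> x; rewrite in_itv/= => /andP[x1 x2].
    have [_ hx] := near' x; have /hx/andP[] : - B - d' <= x <= - B + d'; last by lra.
    by apply/andP; split; lra.
have : 0 < (g B + g (- B)) * d by rewrite mulr_gt0.
by lra.
Qed.

End symmetric_minimum.

(** * Convolution with a normal density: tails, approximation, modulus of continuity *)

Section gaussian_convolution.
Context {R : realType}.
Local Notation mu := (@lebesgue_measure R).
Implicit Types c m s x y d e : R.

(* The normal density is dominated by Num.sqrt 2 * expR (- d ^+ 2 / (4 * s ^+ 2))
   times the normal density of variance 2 * s ^+ 2 outside radius d. *)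
Definition gauss_tail s d := Num.sqrt 2 * expR (- d ^+ 2 / (4 * s ^+ 2)).

Lemma gauss_tail_ge0 s d : 0 <= gauss_tail s d.
Proof. by rewrite mulr_ge0// expR_ge0. Qed.

Lemma normal_pdf_reflect c s x y : s != 0 ->
  normal_pdf c s (x - y) = normal_pdf (x - c) s y.
Proof.
move=> s0; rewrite !normal_pdf_nz// /normal_fun.
by have -> : (x - y - c) ^+ 2 = (y - (x - c)) ^+ 2 by ring.
Qed.

Lemma normal_prob_tail m s d : 0 < s -> 0 <= d ->
  (normal_prob m s [set y | d <= `|y - m|]%R <= (gauss_tail s d)%:E)%E.
Proof.
move=> s0 d0.
have r2 : 0 < Num.sqrt 2 :> R by rewrite sqrtr_gt0.
have r22 : Num.sqrt 2 ^+ 2 = 2 :> R by rewrite sqr_sqrtr.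
have mT : measurable [set y : R | d <= `|y - m|].
  rewrite (_ : [set y | _] = (fun y => `|y - m|) @^-1` `[d, +oo[%classic); last first.
    by apply/seteqP; split => y /=; rewrite in_itv/= andbT.
  apply: preimage_measurable => //; apply: measurableT_comp => //.
  exact: measurable_funB.
have le_pdf y : d <= `|y - m| ->
    normal_pdf m s y <= gauss_tail s d * normal_pdf m (Num.sqrt 2 * s) y.
  move=> dy; rewrite !normal_pdf_nz ?gt_eqF ?mulr_gt0//.
  have -> : normal_peak s = Num.sqrt 2 * normal_peak (Num.sqrt 2 * s).
    rewrite /normal_peak exprMn r22.
    have -> : 2 * s ^+ 2 * pi *+ 2 = 2 * (s ^+ 2 * pi *+ 2) by ring.
    by rewrite (sqrtrM _ (ler0n R 2)) invfM mulrA mulfV ?mul1r// gt_eqF.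
  rewrite /gauss_tail [leRHS](_ : _ = Num.sqrt 2 * normal_peak (Num.sqrt 2 * s) *
    (expR (- d ^+ 2 / (4 * s ^+ 2)) * normal_fun m (Num.sqrt 2 * s) y)); last by ring.
  rewrite ler_wpM2l ?mulr_ge0 ?normal_peak_ge0//.
  rewrite /normal_fun -expRD ler_expR exprMn r22.
  have : d ^+ 2 <= (y - m) ^+ 2 by rewrite -(real_normK (num_real (y - m))) lerXn2r ?nnegrE.
  move=> dy2; rewrite -subr_ge0.
  rewrite (_ : _ - _ = ((y - m) ^+ 2 - d ^+ 2) / (4 * s ^+ 2)).
    by rewrite divr_ge0 ?subr_ge0// mulr_ge0// sqr_ge0.
  have q0 : 0 < s ^+ 2 by rewrite exprn_gt0.
  move: (d ^+ 2) ((y - m) ^+ 2) (s ^+ 2) q0 => u v q q0.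
  by rewrite !mulr2n; field; rewrite !gt_eqF ?addr_gt0 ?mulr_gt0.
apply: (@le_trans _ _ (\int[mu]_(y in [set y | (d <= `|y - m|)%R])
    ((gauss_tail s d)%:E * (normal_pdf m (Num.sqrt 2 * s) y)%:E))%E).
  apply: ge0_le_integral => //.
  - by move=> y _; rewrite lee_fin normal_pdf_ge0.
  - by apply/measurable_EFinP/measurable_funTS; exact: measurable_normal_pdf.
  - apply: emeasurable_funM => //.
    by apply/measurable_EFinP/measurable_funTS; exact: measurable_normal_pdf.
rewrite ge0_integralZl//.
- rewrite -[leRHS]mule1; apply: lee_wpmul2l; first by rewrite lee_fin gauss_tail_ge0.
  exact: (probability_le1 (normal_prob m (Num.sqrt 2 * s)) mT).
- by apply/measurable_EFinP/measurable_funTS; exact: measurable_normal_pdf.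
- by move=> y _; rewrite lee_fin normal_pdf_ge0.
- by rewrite lee_fin gauss_tail_ge0.
Qed.

Lemma normal_convolutionE c s (g : R -> R) x : 0 < s -> measurable_fun setT g ->
  (forall y, 0 <= g y) -> (\int[mu]_y (g y)%:E < +oo)%E ->
  (convolution (normal_pdf c s) g x)%:E =
  (\int[mu]_y (normal_pdf (x - c) s y * g y)%:E)%E.
Proof.
move=> s0 mg g0 ig; have sn0 : s != 0 by rewrite gt_eqF.
apply: etrans (esym (convolutionE x (normal_pdf_bounded_density c sn0) mg g0 ig)) _.
by apply: eq_integral => y _; rewrite normal_pdf_reflect.
Qed.

(** A constant plus a multiple of the indicator of a tail set is the envelope with which densities
    are compared below. *)
Lemma integral_normal_pdf_simple m s (a N : R) (T : set R) : 0 <= a -> 0 <= N ->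
  measurable T ->
  (\int[mu]_y (normal_pdf m s y * (a + N * \1_T y))%:E =
   a%:E + N%:E * normal_prob m s T)%E.
Proof.
move=> a0 N0 mT.
have mp : measurable_fun setT (fun y => (normal_pdf m s y)%:E).
  by apply/measurable_EFinP; exact: measurable_normal_pdf.
have p0 y : (0 <= (normal_pdf m s y)%:E)%E by rewrite lee_fin normal_pdf_ge0.
have mi : measurable_fun setT (fun y => (normal_pdf m s y)%:E * (\1_T y)%:E)%E.
  by apply: emeasurable_funM => //; apply/measurable_EFinP; exact: measurable_indic.
have i0 y : (0 <= (normal_pdf m s y)%:E * (\1_T y)%:E)%E by rewrite mule_ge0.
transitivity (\int[mu]_y (a%:E * (normal_pdf m s y)%:E +
    N%:E * ((normal_pdf m s y)%:E * (\1_T y)%:E)))%E.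
  by apply: eq_integral => y _; rewrite -!EFinM -EFinD; congr EFin; ring.
rewrite ge0_integralD//; first last.
- exact: measurable_funeM.
- by move=> y _; rewrite mule_ge0.
- exact: measurable_funeM.
- by move=> y _; rewrite mule_ge0.
rewrite !ge0_integralZl// integral_normal_pdf mule1; congr (_ + _ * _)%E.
by rewrite /normal_prob [RHS]integral_mkcond epatch_indic.
Qed.

Lemma normal_convolution_le c s g N x : 0 < s -> bounded_density N g ->
  convolution (normal_pdf c s) g x <= N.
Proof.
move=> s0 [mg g0 gN ig]; have N0 := le_trans (g0 0) (gN 0).
rewrite -lee_fin normal_convolutionE//; last by rewrite ig ltry.
apply: (@le_trans _ _ (N%:E + 0%:E * normal_prob (x - c) s setT)%E); last first.
  by rewrite mul0e adde0.
rewrite -integral_normal_pdf_simple//.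
apply: ge0_le_integral => //.
- by move=> y _; rewrite lee_fin mulr_ge0// normal_pdf_ge0.
- by apply/measurable_EFinP; apply: measurable_funM => //; exact: measurable_normal_pdf.
- apply/measurable_EFinP; apply: measurable_funM; first exact: measurable_normal_pdf.
  by apply: measurable_funD => //; apply: measurable_funM => //; exact: measurable_indic.
- by move=> y _; rewrite lee_fin mul0r addr0 ler_wpM2l// normal_pdf_ge0.
Qed.

(** Reflection turns the convolution into an average of [f] around [x - c]. There [f] is within [e]
    of [A] on the ball of radius [d], and within [M] of it outside, where the Gaussian mass is a
    tail. *)
Lemma normal_convolution_approx c s f M A e d x : 0 < s ->
  bounded_density M f -> 0 <= A <= M -> 0 <= e -> 0 <= d ->
  (forall y, `|y - (x - c)| < d -> `|f y - A| <= e) ->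
  `|convolution (normal_pdf c s) f x - A| <= e + M * gauss_tail s d.
Proof.
move=> s0 [mf f0 fM if1] /andP[A0 AM] e0 d0 fA.
have M0 : 0 <= M by exact: le_trans A0 AM.
pose m := x - c; pose T := [set y : R | d <= `|y - m|].
have mT : measurable T.
  rewrite (_ : T = (fun y => `|y - m|) @^-1` `[d, +oo[%classic); last first.
    by apply/seteqP; split => y /=; rewrite in_itv/= andbT.
  apply: preimage_measurable => //; apply: measurableT_comp => //.
  exact: measurable_funB.
have tail := normal_prob_tail m s0 d0.
have cE := @normal_convolutionE c s f x s0 mf f0.
have {}cE := cE (eq_ind _ (fun z => (z < +oo)%E) (ltry 1) _ (esym if1)).
have mpf (g : R -> R) : measurable_fun setT g ->
    measurable_fun setT (fun y => (normal_pdf m s y * g y)%:E).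
  by move=> mg; apply/measurable_EFinP; apply: measurable_funM => //; exact: measurable_normal_pdf.
have mind (a N : R) : measurable_fun setT (fun y : R => a + N * \1_T y).
  by apply: measurable_funD => //; apply: measurable_funM => //; exact: measurable_indic.
have fe y : A - e - M * \1_T y <= f y <= A + e + M * \1_T y.
  rewrite indicE; have [yT|yT] := leP d `|y - m|.
    rewrite mem_set// mulr1; have := f0 y; have := fM y.
    by move=> *; apply/andP; split; lra.
  rewrite memNset ?mulr0; last by rewrite /T/=; apply/negP; rewrite -ltNge.
  have := fA y yT; rewrite ler_distl => /andP[? ?]; apply/andP; split; lra.
have up : ((convolution (normal_pdf c s) f x)%:E <= (A + e)%:E + M%:E * normal_prob m s T)%E.
  rewrite cE -integral_normal_pdf_simple ?addr_ge0//.
  apply: ge0_le_integral => //.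
  - by move=> y _; rewrite lee_fin mulr_ge0// normal_pdf_ge0.
  - exact: mpf.
  - exact: mpf.
  - by move=> y _; rewrite lee_fin ler_wpM2l ?normal_pdf_ge0//; have /andP[] := fe y.
(* The lower bound is arranged as a sum, so that only integrals of nonnegative functions are
   compared. *)
have lo : (A%:E <= (convolution (normal_pdf c s) f x)%:E + (e%:E + M%:E * normal_prob m s T))%E.
  rewrite cE -integral_normal_pdf_simple// -ge0_integralD//; first last.
  - exact: mpf.
  - move=> y _; rewrite lee_fin mulr_ge0 ?normal_pdf_ge0// addr_ge0// mulr_ge0//.
  - exact: mpf.
  - by move=> y _; rewrite lee_fin mulr_ge0// normal_pdf_ge0.
  rewrite -[leLHS]mule1 -(integral_normal_pdf m s) -ge0_integralZl//; first last.
  - by move=> y _; rewrite lee_fin normal_pdf_ge0.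
  - by apply/measurable_EFinP; exact: measurable_normal_pdf.
  apply: ge0_le_integral => //.
  - by move=> y _; rewrite mule_ge0// lee_fin normal_pdf_ge0.
  - by apply: measurable_funeM; apply/measurable_EFinP; exact: measurable_normal_pdf.
  - by apply: emeasurable_funD; exact: mpf.
  move=> y _; rewrite -EFinM -EFinD lee_fin -mulrDr mulrC ler_wpM2l ?normal_pdf_ge0//.
  by have /andP[] := fe y; lra.
have nuT : (M%:E * normal_prob m s T <= (M * gauss_tail s d)%:E)%E.
  by rewrite EFinM; apply: lee_wpmul2l.
rewrite ler_distl; apply/andP; split.
  rewrite -lee_fin; have := le_trans lo (leeD2l _ (leeD2l e%:E nuT)).
  by rewrite -!EFinD !lee_fin; lra.
by rewrite -lee_fin (le_trans up)// (le_trans (leeD2l _ nuT))// -EFinD lee_fin; lra.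
Qed.

(** For [0 <= u <= v], write [v^2 - u^2 = (v - u)^2 + 2 u (v - u)]. Then [1 - exp(-z) <= z] and
    [2 u exp(-u^2) <= 1] suffice, the latter because [1 + u^2 >= 2 u]. *)
Lemma gauss_modulus (a b : R) :
  `|expR (- a ^+ 2) - expR (- b ^+ 2)| <= `|a - b| + `|a - b| ^+ 2.
Proof.
have key (u v : R) : 0 <= u -> u <= v ->
    `|expR (- u ^+ 2) - expR (- v ^+ 2)| <= (v - u) + (v - u) ^+ 2.
  move=> u0 uv; have vu2 : u ^+ 2 <= v ^+ 2 by rewrite lerXn2r ?nnegrE// (le_trans u0).
  rewrite ger0_norm; last by rewrite subr_ge0 ler_expR lerN2.
  have -> : expR (- v ^+ 2) = expR (- u ^+ 2) * expR (- (v ^+ 2 - u ^+ 2)).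
    by rewrite -expRD; congr expR; ring.
  have h1 : 1 - expR (- (v ^+ 2 - u ^+ 2)) <= v ^+ 2 - u ^+ 2.
    by have := expR_ge1Dx (- (v ^+ 2 - u ^+ 2)); lra.
  have e1 : expR (- u ^+ 2) <= 1 by rewrite -expR0 ler_expR oppr_le0 sqr_ge0.
  have e2 : 2 * u * expR (- u ^+ 2) <= 1.
    have := expR_ge1Dx (u ^+ 2); have := expR_gt0 (u ^+ 2).
    rewrite expRN ler_pdivrMr ?expR_gt0// mul1r => _ h.
    have := sqr_ge0 (u - 1); rewrite sqrrB1 => h'; lra.
  apply: (@le_trans _ _ (expR (- u ^+ 2) * (v ^+ 2 - u ^+ 2))).
    by rewrite -{1}(mulr1 (expR (- u ^+ 2))) -mulrBr ler_wpM2l// expR_ge0.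
  have -> : expR (- u ^+ 2) * (v ^+ 2 - u ^+ 2) =
      expR (- u ^+ 2) * (v - u) ^+ 2 + (2 * u * expR (- u ^+ 2)) * (v - u) by ring.
  rewrite addrC lerD//; first by rewrite -[leRHS]mul1r ler_wpM2r// subr_ge0.
  by rewrite -[leRHS]mul1r ler_wpM2r// sqr_ge0.
have key' (u v : R) : u <= v -> 0 <= u ->
    `|expR (- u ^+ 2) - expR (- v ^+ 2)| <= `|u - v| + `|u - v| ^+ 2.
  move=> uv u0; rewrite (distrC u) (ger0_norm (_ : 0 <= v - u)) ?subr_ge0//.
  exact: key.
have keyn (u v : R) : 0 <= u -> 0 <= v ->
    `|expR (- u ^+ 2) - expR (- v ^+ 2)| <= `|u - v| + `|u - v| ^+ 2.
  move=> u0 v0; have [uv|vu] := leP u v; first exact: key'.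
  by rewrite distrC (distrC u); apply: key' => //; exact: ltW.
rewrite -(real_normK (num_real a)) -(real_normK (num_real b)).
apply: le_trans (keyn _ _ (normr_ge0 a) (normr_ge0 b)) _.
have := ler_dist_dist a b => ab; rewrite lerD// lerXn2r ?nnegrE//.
Qed.

(** A modulus of continuity of the normal density, the same at all points. It survives convolution
    with any probability density, and summing over the number of jumps gives the continuity of the
    jump intensity. *)
Definition gauss_osc s d := normal_peak s * (d / (Num.sqrt 2 * s) + (d / (Num.sqrt 2 * s)) ^+ 2).

Lemma normal_pdf_osc c s x y : 0 < s ->
  `|normal_pdf c s x - normal_pdf c s y| <= gauss_osc s `|x - y|.
Proof.
move=> s0; rewrite !normal_pdf_nz ?gt_eqF// -mulrBr normrM ger0_norm ?normal_peak_ge0//.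
rewrite ler_wpM2l ?normal_peak_ge0//.
have q0 : 0 < Num.sqrt 2 * s by rewrite mulr_gt0// sqrtr_gt0.
have fE z : normal_fun c s z = expR (- ((z - c) / (Num.sqrt 2 * s)) ^+ 2).
  rewrite /normal_fun mulNr expr_div_n exprMn sqr_sqrtr//.
  by rewrite [in RHS]mulr_natl.
rewrite !fE; apply: le_trans (gauss_modulus _ _) _.
rewrite -mulrBl (_ : x - c - (y - c) = x - y); last by ring.
by rewrite normrM normfV (gtr0_norm q0).
Qed.

Lemma normal_convolution_osc c s g N x y : 0 < s -> bounded_density N g ->
  convolution (normal_pdf c s) g x <=
  convolution (normal_pdf c s) g y + gauss_osc s `|x - y|.
Proof.
move=> s0 [mg g0 gN ig]; have sn0 : s != 0 by rewrite gt_eqF.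
have df := normal_pdf_bounded_density c sn0.
have fin : (\int[mu]_z (g z)%:E < +oo)%E by rewrite ig ltry.
have mc (z : R) : measurable_fun setT (fun u : R => (normal_pdf c s (z - u) * g u)%:E : \bar R).
  apply/measurable_EFinP; apply: measurable_funM => //.
  apply: measurableT_comp; first exact: measurable_normal_pdf.
  exact: measurable_funB.
have osc0 : 0 <= gauss_osc s `|x - y|.
  by rewrite mulr_ge0 ?normal_peak_ge0// addr_ge0 ?sqr_ge0// divr_ge0// mulr_ge0// ltW.
rewrite -lee_fin EFinD -(convolutionE x df mg g0 fin) -(convolutionE y df mg g0 fin).
have -> : (gauss_osc s `|x - y|)%:E = (\int[mu]_z ((gauss_osc s `|x - y|)%:E * (g z)%:E))%E.
  rewrite ge0_integralZl ?ig ?mule1//; first exact/measurable_EFinP.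
  by move=> z _; rewrite lee_fin.
rewrite -ge0_integralD//; first last.
- by apply: measurable_funeM; exact/measurable_EFinP.
- by move=> z _; rewrite mule_ge0// lee_fin.
- exact: mc.
- by move=> z _; rewrite lee_fin mulr_ge0// normal_pdf_ge0.
apply: ge0_le_integral => //.
- by move=> z _; rewrite lee_fin mulr_ge0// normal_pdf_ge0.
- exact: mc.
- apply: emeasurable_funD; first exact: mc.
  by apply: measurable_funeM; exact/measurable_EFinP.
move=> z _; rewrite -EFinM -EFinD lee_fin -mulrDl ler_wpM2r//.
have := normal_pdf_osc c (x - z) (y - z) s0.
rewrite (_ : x - z - (y - z) = x - y); last by ring.
by rewrite ler_distl => /andP[]; lra.
Qed.

End gaussian_convolution.

(** * Jump intensity and the conditions satisfied by a minimum of the loss *)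

Section jump_intensity.
Context {R : realType}.
Local Notation mu := (@lebesgue_measure R).
Variables (c s La M : R) (f : R -> R).
Hypotheses (s0 : 0 < s) (La0 : 0 <= La) (df : bounded_density M f).
Local Notation phi := (normal_pdf c s).
Local Notation H := (jump_intensity_density phi f La).

Let a k x := convolution phi (convolution_power f k.+1) x.

Let dfk k : bounded_density M (convolution_power f k.+1).
Proof.
rewrite -(convolution_sequence_cst f 0).
exact: (convolution_sequence_bounded_density _ _ (fun=> df)).
Qed.

Let a_ge0 x k : 0 <= a k x.
Proof.
have sn0 : s != 0 by rewrite gt_eqF.
exact: (bd_ge0 (convolution_bounded_density (normal_pdf_bounded_density c sn0) (dfk k))).
Qed.

Let a_le x k : a k x <= M.
Proof. exact: normal_convolution_le (dfk k). Qed.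

Lemma jump_intensity_bounds x :
  La * convolution phi f x <= H x <=
  La * convolution phi f x + M * (La ^+ 2 * expR La).
Proof. exact: (lim_power_weighted_series_bounds La0 (a_ge0 x) (a_le x)). Qed.

Lemma jump_intensity_ge0 x : 0 <= H x.
Proof.
have /andP[+ _] := jump_intensity_bounds x; apply: le_trans.
by rewrite mulr_ge0//; exact: (a_ge0 x 0).
Qed.

Lemma jump_intensity_le x : H x <= M * (La * expR La).
Proof.
apply: limr_le; first exact: (cvg_power_weighted_series La0 (a_ge0 x) (a_le x)).
by apply: nearW => n; exact: (power_weighted_series_le La0 (a_ge0 x) (a_le x)).
Qed.

Lemma jump_intensity_osc x y :
  H x <= H y + La * expR La * gauss_osc s `|x - y|.
Proof.
apply: limr_le; first exact: (cvg_power_weighted_series La0 (a_ge0 x) (a_le x)).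
have osc0 : 0 <= gauss_osc s `|x - y|.
  by rewrite mulr_ge0 ?normal_peak_ge0// addr_ge0 ?sqr_ge0// divr_ge0// mulr_ge0// ltW.
apply: nearW => n.
have := nondecreasing_cvgn_le (power_weighted_series_nd La0 (a_ge0 y))
  (cvg_power_weighted_series La0 (a_ge0 y) (a_le y)) n.
(* Every convolution power has the same modulus, so the total oscillation is a weighted series with
   constant coefficients. *)
have := @power_weighted_series_le _ La (gauss_osc s `|x - y|)
  (fun=> gauss_osc s `|x - y|) La0 (fun=> osc0) (fun=> lexx _) n.
rewrite -/(jump_intensity_density phi f La y) => h1 h2.
rewrite mulrC -mulrA in h1; rewrite -mulrA.
apply: (@le_trans _ _ (\sum_(0 <= k < n) La ^+ k.+1 / k.+1`!%:R * a k y +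
   \sum_(0 <= k < n) La ^+ k.+1 / k.+1`!%:R * gauss_osc s `|x - y|)).
  rewrite -big_split/=; apply: ler_sum => k _; rewrite -mulrDr.
  rewrite ler_wpM2l ?divr_ge0 ?exprn_ge0//.
  exact: normal_convolution_osc (dfk k).
apply: lerD; first exact: h2.
by rewrite (le_trans h1)// mulrA (mulrC _ (gauss_osc _ _)) mulrA.
Qed.

Lemma continuous_jump_intensity : continuous H.
Proof.
move=> x; apply/cvgrPdist_le => e e0.
pose q := Num.sqrt 2 * s.
have q0 : 0 < q by rewrite mulr_gt0// sqrtr_gt0.
pose D := La * expR La * normal_peak s.
have D0 : 0 <= D by rewrite !mulr_ge0 ?expR_ge0 ?normal_peak_ge0.
have D1 : 0 < 2 * (D + 1) by rewrite mulr_gt0// ltr_wpDl.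
(* With [z] the distance in units of [q], [z <= 1] gives [z + z ^+ 2 <= 2 * z], and the second bound
   makes [2 * D * z] at most [e]; the 1 in [D + 1] keeps the denominator positive. *)
pose d := q * Num.min 1 (e / (2 * (D + 1))).
have d0 : 0 < d by rewrite mulr_gt0// lt_min ltr01 divr_gt0.
have key u v : `|u - v| < d -> H u - H v <= e.
  move=> uv; have := jump_intensity_osc u v.
  rewrite /gauss_osc -/q; set z := `|u - v| / q.
  have z0 : 0 <= z by rewrite divr_ge0// ltW.
  have zm : z < Num.min 1 (e / (2 * (D + 1))) by rewrite ltr_pdivrMr// mulrC.
  have z1 : z < 1 by move: zm; rewrite lt_min => /andP[].
  have ze : z * (2 * (D + 1)) < e.
    by move: zm; rewrite lt_min => /andP[_]; rewrite ltr_pdivlMr.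
  rewrite mulrA -/D => osc.
  have z2 : z ^+ 2 <= z by rewrite expr2 ler_piMl// ltW.
  have Dz : D * (z + z ^+ 2) <= D * (2 * z).
    by rewrite ler_wpM2l// mulr_natl mulr2n lerD2l.
  move: Dz ze z0 osc; clear -D0 e0; move: D (H u) (H v) z D0 => D' Hu Hv z' *.
  by lra.
near=> y.
have xy : `|x - y| < d.
  by near: y; apply/nbhs_ballP; exists d => // y; rewrite /ball.
rewrite ler_norml; apply/andP; split; last exact: key.
have := key y x; rewrite distrC => /(_ xy).
by rewrite lerNl opprB.
Unshelve. all: by end_near. Qed.

Let g x := H x - phi x.

Let continuous_phi : continuous phi.
Proof. by apply: continuous_normal_pdf; rewrite gt_eqF. Qed.

Lemma continuous_jump_difference : continuous g.
Proof.
move=> x; apply: (@cvgB _ R^o); first exact: continuous_jump_intensity.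
exact: continuous_phi.
Qed.

Let EFin_Rintegral (i : interval R) (u v : R) (k : R -> R) :
  continuous k -> ([set` i] `<=` `[u, v])%classic ->
  (\int[mu]_(x in [set` i]) k x)%:E = (\int[mu]_(x in [set` i]) (k x)%:E)%E.
Proof.
move=> ck iuv; rewrite /Rintegral fineK//.
exact: (integrable_fin_num _ (continuous_itv_integrable ck iuv)).
Qed.

Lemma loss_real B : 0 <= B ->
  ((expR (- La))%:E * (normal_prob c s (~` `[(- B)%R, B]%classic) +
    \int[mu]_(x in `[(- B)%R, B]) (H x)%:E))%E =
  (expR (- La) * (1 + \int[mu]_(x in `[- B, B]) g x))%:E.
Proof.
move=> B0; rewrite probability_setC//.
have sub : (`[- B, B] `<=` `[- B, B])%classic by [].
rewrite -(EFin_Rintegral continuous_jump_intensity sub).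
rewrite [X in (1 - X + _)%E](_ : _ = (\int[mu]_(x in `[- B, B]) phi x)%:E); last first.
  by rewrite (EFin_Rintegral continuous_phi sub).
rewrite -EFinB -EFinD -EFinM RintegralB//.
- by congr EFin; ring.
- exact: (continuous_itv_integrable continuous_jump_intensity sub).
- exact: (continuous_itv_integrable continuous_phi sub).
Qed.

Variable B : R.
Hypothesis B0 : 0 <= B.
Hypothesis Bmin : forall C : R, 0 <= C ->
  \int[mu]_(x in `[- B, B]) g x <= \int[mu]_(x in `[- C, C]) g x.

(** Only the one-sided first-order inequality is used, so the bound holds before [B] is known to be
    positive. *)
Lemma minimum_pdf_le : phi B <= 2 * (M * (La * expR La)).
Proof.
have := symmetric_minimum_ge0 continuous_jump_difference B0 Bmin.
have := jump_intensity_le B; have := jump_intensity_le (- B).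
have := normal_pdf_ge0 c s (- B); rewrite /g.
by move: (H B) (H (- B)) (phi B) (phi (- B)) (M * _) => *; lra.
Qed.

Lemma minimum_first_order : 0 < B -> phi B + phi (- B) = H B + H (- B).
Proof.
move=> Bp; have := symmetric_minimum_eq0 continuous_jump_difference B0 Bmin Bp.
by rewrite /g; move: (H B) (H (- B)) (phi B) (phi (- B)) => *; lra.
Qed.

(** If [2 * b <= B], lowering the threshold to [b] would save at least the jump mass [b * (k1 + k2)]
    lying between [b] and [2 * b] on both sides. It would cost at most the Gaussian tail beyond [b],
    contradicting minimality. *)
Lemma minimum_lt (b k1 k2 : R) : 0 < b -> 0 <= c <= b ->
  (forall x, b <= x <= 2 * b -> k1 <= H x) ->
  (forall x, b <= x <= 2 * b -> k2 <= H (- x)) ->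
  gauss_tail s (b - c) < b * (k1 + k2) -> B < 2 * b.
Proof.
move=> b0 /andP[c0 cb] Hk1 Hk2 tail; rewrite ltNge; apply/negP => bB.
have cg := continuous_jump_difference.
have bB' : b <= B by lra.
have := Bmin (ltW b0).
rewrite (Rintegral_symmetric_itv cg (ltW b0) bB') gerDl.
apply/negP; rewrite -ltNge.
have sub1 : (`]b, B] `<=` `[- B, B])%classic.
  by move=> x /=; rewrite !in_itv/= => /andP[? ?]; apply/andP; split; lra.
have sub2 : (`[- B, - b[ `<=` `[- B, B])%classic.
  by move=> x /=; rewrite !in_itv/= => /andP[? ?]; apply/andP; split; lra.
have split_g (i : interval R) : ([set` i] `<=` `[- B, B])%classic ->
    \int[mu]_(x in [set` i]) g x =
    \int[mu]_(x in [set` i]) H x - \int[mu]_(x in [set` i]) phi x.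
  move=> sub; rewrite RintegralB//.
  - exact: (continuous_itv_integrable continuous_jump_intensity sub).
  - exact: (continuous_itv_integrable continuous_phi sub).
rewrite !split_g//.
have H_sub (i j : interval R) : ([set` i] `<=` [set` j])%classic -> ([set` j] `<=` `[- B, B])%classic ->
    \int[mu]_(x in [set` i]) H x <= \int[mu]_(x in [set` j]) H x.
  move=> ij jB; rewrite -lee_fin (EFin_Rintegral continuous_jump_intensity jB).
  rewrite (EFin_Rintegral continuous_jump_intensity (subset_trans ij jB)).
  apply: ge0_subset_integral => //.
    apply/measurable_EFinP/measurable_funTS; apply: continuous_measurable_fun.
    exact: continuous_jump_intensity.
  by move=> x _; rewrite lee_fin jump_intensity_ge0.
(* The lower bounds on [H] reach only to [2 * b]; beyond, nonnegativity is enough. *)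
have h1 : k1 * b <= \int[mu]_(x in `]b, B]) H x.
  apply: (@le_trans _ _ (\int[mu]_(x in `]b, 2 * b]) H x)).
    apply: (Rintegral_itv_ge continuous_jump_intensity (a := b) (b := 2 * b)).
    - by move=> x /=; rewrite !in_itv/= => /andP[/ltW -> ->].
    - rewrite lebesgue_measure_itv/= lte_fin ifT; last by lra.
      by rewrite -EFinD; congr EFin; ring.
    - by move=> x; rewrite in_itv/= => /andP[/ltW ? ?]; apply: Hk1; apply/andP.
  apply: H_sub => // x /=; rewrite !in_itv/= => /andP[-> x2b].
  exact: le_trans bB.
have h2 : k2 * b <= \int[mu]_(x in `[- B, - b[) H x.
  apply: (@le_trans _ _ (\int[mu]_(x in `[- (2 * b), - b[) H x)).
    apply: (Rintegral_itv_ge continuous_jump_intensity (a := - (2 * b)) (b := - b)).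
    - by move=> x /=; rewrite !in_itv/= => /andP[-> /ltW ->].
    - rewrite lebesgue_measure_itv/= lte_fin ifT; last by lra.
      by rewrite -EFinD; congr EFin; ring.
    - move=> x; rewrite in_itv/= => /andP[? ?]; rewrite -(opprK x); apply: Hk2.
      by apply/andP; split; lra.
  apply: H_sub => // x /=; rewrite !in_itv/= => /andP[x2b ->].
  by rewrite andbT (le_trans _ x2b)// lerN2.
have h3 : \int[mu]_(x in `]b, B]) phi x + \int[mu]_(x in `[- B, - b[) phi x <=
    gauss_tail s (b - c).
  rewrite -lee_fin EFinD (EFin_Rintegral continuous_phi sub1).
  rewrite (EFin_Rintegral continuous_phi sub2).
  have bc0 : 0 <= b - c by lra.
  apply: le_trans (normal_prob_tail c s0 bc0).
  have disj : [disjoint `]b, B]%classic & `[(- B)%R, (- b)%R[%classic].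
    apply/disj_setPS => x [/=]; rewrite !in_itv/= => /andP[? _] /andP[_ ?].
    by lra.
  rewrite -ge0_integral_setU//; first last.
  - by move=> x _; rewrite lee_fin normal_pdf_ge0.
  - by apply/measurable_EFinP/measurable_funTS; exact: measurable_normal_pdf.
  apply: ge0_subset_integral => //.
  - exact: measurableU.
  - rewrite (_ : [set y | _] = (fun y => `|y - c|) @^-1` `[b - c, +oo[%classic); last first.
      by apply/seteqP; split => y /=; rewrite in_itv/= andbT.
    apply: preimage_measurable => //; apply: measurableT_comp => //.
    exact: measurable_funB.
  - by apply/measurable_EFinP/measurable_funTS; exact: measurable_normal_pdf.
  - by move=> x _; rewrite lee_fin normal_pdf_ge0.
  - move=> x [/=|/=]; rewrite in_itv/= => /andP[? ?].
      by rewrite ger0_norm; lra.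
    by rewrite ltr0_norm; lra.
have fin (p q u v w z r : R) : p <= u -> q <= v -> w + z <= r -> r < p + q ->
    0 < u - w + (v - z) by lra.
apply: fin h1 h2 h3 _; apply: lt_le_trans tail _.
by rewrite mulrDr (mulrC k1) (mulrC k2).
Qed.

End jump_intensity.

(** The balls of radius [x - c] around [x - c] and [- x - c] each stay on one side of 0 and within
    [2 * x] of it, so a one-sided slope controls [f] on them despite the possible jump at 0. *)
Lemma normal_convolution_sides (R : realType) (c s x M K A C : R) (f : R -> R) :
  0 < s -> bounded_density M f -> 0 <= A <= M -> 0 <= C <= M -> 0 <= K ->
  (forall y, 0 <= y -> `|f y - A| <= K * y) ->
  (forall y, y < 0 -> `|f y - C| <= K * - y) -> 0 <= c <= x ->
  `|convolution (normal_pdf c s) f x - A| <= 2 * K * x + M * gauss_tail s (x - c) /\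
  `|convolution (normal_pdf c s) f (- x) - C| <= 2 * K * x + M * gauss_tail s (x - c).
Proof.
move=> s0 df A0M C0M K0 fA fC /andP[c0 cx].
have e0 : 0 <= 2 * K * x by rewrite !mulr_ge0// (le_trans c0).
have d0 : 0 <= x - c by lra.
split; apply: normal_convolution_approx => //.
- move=> y; rewrite ltr_distl => /andP[y1 y2].
  apply: (@le_trans _ _ (K * y)); first by apply: fA; lra.
  by rewrite (mulrC 2) -mulrA ler_wpM2l//; lra.
- move=> y; rewrite ltr_distl => /andP[y1 y2].
  apply: (@le_trans _ _ (K * - y)); first by apply: fC; lra.
  by rewrite (mulrC 2) -mulrA ler_wpM2l//; lra.
Qed.

(** * Elementary small-time inequalities *)

Section small_time.
Context {R : realType}.
Implicit Types (a b e h k s x y : R).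

Lemma near_powR_le a e : 0 < a -> 0 < e -> \forall h \near 0^'+, h `^ a <= e.
Proof.
move=> a0 e0; have ea0 : 0 < e `^ a^-1 by rewrite powR_gt0.
near=> h; have h0 : 0 < h by near: h; exact: nbhs_right_gt.
have he : h <= e `^ a^-1 by near: h; exact: nbhs_right_le.
have -> : e = (e `^ a^-1) `^ a by rewrite -powRrM mulVf ?gt_eqF// powRr1// ltW.
by apply: ge0_ler_powR; rewrite ?nnegrE ?ltW.
Unshelve. all: by end_near. Qed.

Lemma near_mul_powR_le k a e : 0 <= k -> 0 < a -> 0 < e ->
  \forall h \near 0^'+, k * h `^ a <= e.
Proof.
move=> k0 a0 e0; have k1 : 0 < k + 1 by rewrite ltr_wpDl.
near=> h.
have : h `^ a <= e / (k + 1) by near: h; apply: near_powR_le => //; exact: divr_gt0.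
rewrite ler_pdivlMr// => he; apply: le_trans he.
by rewrite mulrC ler_wpM2l ?powR_ge0// lerDl.
Unshelve. all: by end_near. Qed.

Lemma near_mul_le k e : 0 <= k -> 0 < e -> \forall h \near 0^'+, k * h <= e.
Proof.
move=> k0 e0; near=> h; have h0 : 0 < h by near: h; exact: nbhs_right_gt.
rewrite -[in leLHS](powRr1 (ltW h0)).
by near: h; exact: near_mul_powR_le.
Unshelve. all: by end_near. Qed.

Lemma expRN_le_inv x : 0 < x -> expR (- x) <= x^-1.
Proof.
move=> x0; rewrite expRN lef_pV2 ?posrE ?expR_gt0//.
by have := expR_ge1Dx x; lra.
Qed.

Lemma near_expR_powR_le k b : 0 < k -> 0 < b ->
  \forall h \near 0^'+, Num.sqrt 2 * expR (- (k * h `^ (- b))) <= h ^+ 2.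
Proof.
move=> k0 b0; pose n := (Num.truncn (4 / b)).+1.
have n0 : 0 < n%:R :> R by rewrite ltr0n.
have nb : 2 <= b / 2 * n%:R.
  have : 4 / b < n%:R by rewrite truncnS_gt// divr_ge0// ltW.
  by rewrite ltr_pdivrMr//; lra.
near=> h; have h0 : 0 < h by near: h; exact: nbhs_right_gt.
have h1 : h <= 1 by near: h; exact: nbhs_right_le.
pose w := h `^ (b / 2).
have w0 : 0 < w by rewrite powR_gt0.
have wk : n%:R / k * w <= 1 / 2.
  rewrite /w; near: h; apply: near_mul_powR_le; rewrite ?divr_gt0//.
  by rewrite divr_ge0// ltW.
have -> : h `^ (- b) = (w ^+ 2)^-1.
  rewrite powRN; congr (_^-1); rewrite expr2 -powRD; last by rewrite (gt_eqF h0) implybT.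
  by congr (_ `^ _); field.
pose u := k * (w ^+ 2)^-1 / n%:R.
have u0 : 0 < u by rewrite divr_gt0// mulr_gt0// invr_gt0 exprn_gt0.
have -> : k * (w ^+ 2)^-1 = u *+ n by rewrite -mulr_natr divfK// gt_eqF.
rewrite -mulNrn -[X in expR X]mulr_natr expRM_natr.
have uw : expR (- u) <= w / 2.
  apply: le_trans (expRN_le_inv u0) _.
  have -> : u^-1 = (n%:R / k * w) * w.
    by rewrite /u; field; rewrite !gt_eqF.
  by have := ler_wpM2r (ltW w0) wk; lra.
have r2 : Num.sqrt 2 <= 2 :> R.
  rewrite -[leRHS]ger0_norm// -sqrtr_sqr ler_wsqrtr//.
  by rewrite expr2; lra.
apply: (@le_trans _ _ (2 * (w / 2) ^+ n)).
  apply: ler_pM; rewrite ?sqrtr_ge0 ?exprn_ge0 ?expR_ge0//.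
  apply: lerXn2r; rewrite ?nnegrE ?expR_ge0//.
  by rewrite divr_ge0 ?(ltW w0).
apply: (@le_trans _ _ (w ^+ n)).
  rewrite exprMn mulrCA -[leRHS]mulr1 ler_wpM2l ?exprn_ge0 ?(ltW w0)//.
  rewrite /n exprS mulrA mulfV ?mul1r//.
  by rewrite exprn_ile1// invf_le1//; lra.
rewrite -(powR_mulrn n (ltW w0)) -powRrM -(powR_mulrn 2 (ltW h0)).
by apply: ger_powR => //; rewrite h0.
Unshelve. all: by end_near. Qed.

Lemma ln_le_dist x : `|x - 1| <= 1 / 2 -> `|ln x| <= 2 * `|x - 1|.
Proof.
move=> x1; have := x1; rewrite ler_distl => /andP[xl xu].
have x0 : 0 < x by lra.
have up : ln x <= x - 1.
  have -> : x = 1 + (x - 1) by lra.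
  by rewrite (_ : 1 + (x - 1) - 1 = x - 1); [apply: le_ln1Dx; lra|lra].
have lo : - ln x <= x^-1 - 1.
  rewrite -lnV ?posrE//.
  have -> : x^-1 = 1 + (x^-1 - 1) by lra.
  rewrite (_ : 1 + (x^-1 - 1) - 1 = x^-1 - 1); last by lra.
  apply: le_ln1Dx; have : 0 < x^-1 by rewrite invr_gt0.
  by lra.
have inv_le : x^-1 - 1 <= 2 * `|x - 1|.
  have -> : x^-1 - 1 = (1 - x) / x by field; rewrite gt_eqF.
  rewrite ler_pdivrMr//; have := ler_norm (1 - x); rewrite distrC.
  have : `|x - 1| <= 2 * `|x - 1| * x.
    by rewrite mulrAC ler_peMl//; lra.
  by lra.
rewrite ler_norml; apply/andP; split; first by lra.
by have := ler_norm (x - 1); have := normr_ge0 (x - 1); lra.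
Qed.

Lemma sqrt_dist_le x y : 0 <= x -> 1 <= y ->
  `|Num.sqrt x - Num.sqrt y| <= `|x - y|.
Proof.
move=> x0 y1; have y0 : 0 <= y by lra.
have sy : 1 <= Num.sqrt y by rewrite -sqrtr1 ler_wsqrtr.
rewrite -{2}(sqr_sqrtr x0) -{2}(sqr_sqrtr y0) subr_sqr normrM.
rewrite ler_peMr// ger0_norm ?addr_ge0 ?sqrtr_ge0//.
by have := sqrtr_ge0 x; lra.
Qed.

Lemma normal_peakE s : 0 < s -> normal_peak s = (Num.sqrt (2 * pi : R) * s)^-1.
Proof.
move=> s0; rewrite /normal_peak; congr (_^-1).
have -> : s ^+ 2 * pi *+ 2 = s ^+ 2 * (2 * pi) by ring.
by rewrite sqrtrM ?sqr_ge0// sqrtr_sqr gtr0_norm// mulrC.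
Qed.

End small_time.

Lemma perturbed_sum_dist (R : realType) (y z u v e1 e2 e3 a c : R) :
  u <= y -> y <= u + e2 -> v <= z -> z <= v + e2 -> e2 <= e3 -> 0 <= e3 ->
  a - e1 <= u -> u <= a + e1 -> c - e1 <= v -> v <= c + e1 ->
  `|y + z - (a + c)| <= 2 * e1 + 2 * e3.
Proof. by move=> *; rewrite ler_norml; apply/andP; split; lra. Qed.

(* By loss_formula and loss_real the loss is an increasing affine function of
   this integral, with g, sg, la the averages of the coefficients. *)
Definition threshold_minimum (R : realType) (f : R -> R) (g sg la h B : R) :=
  let phi := normal_pdf (h * g) (sg * Num.sqrt h) in
  let H := jump_intensity_density phi f (h * la) in
  0 <= B /\ forall C : R, 0 <= C ->
    \int[lebesgue_measure]_(x in `[- B, B]) (H x - phi x) <=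
    \int[lebesgue_measure]_(x in `[- C, C]) (H x - phi x).

(* A and C are the right and left limits of f at 0. *)
Record regular_density (R : realType) (M K A C : R) (f : R -> R) : Prop :=
  RegularDensity {
  rd_bounded : bounded_density M f;
  rd_right : 0 <= A <= M;
  rd_left : 0 <= C <= M;
  rd_gt0 : 0 < A + C;
  rd_slope : 0 <= K;
  rd_right_slope : forall y : R, 0 <= y -> `|f y - A| <= K * y;
  rd_left_slope : forall y : R, y < 0 -> `|f y - C| <= K * - y }.

(** * Estimates at a minimum, for fixed values of the averaged coefficients *)

Section main_estimates.
Context {R : realType}.
Variables (f : R -> R) (M K A C Gm s1 s2 l1 l2 : R).
Hypothesis rf : regular_density M K A C f.
Hypotheses (Gm0 : 0 <= Gm) (s10 : 0 < s1) (s12 : s1 <= s2).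
Hypotheses (l10 : 0 < l1) (l12 : l1 <= l2).

Let df := rd_bounded rf.
Let A0M := rd_right rf.
Let C0M := rd_left rf.
Let AC0 := rd_gt0 rf.
Let K0 := rd_slope rf.
Let fA := rd_right_slope rf.
Let fC := rd_left_slope rf.
Let M0 : 0 <= M. Proof. by have /andP[] := A0M; exact: le_trans. Qed.
Let s20 : 0 < s2. Proof. exact: lt_le_trans s12. Qed.
Let l20 : 0 < l2. Proof. exact: lt_le_trans l12. Qed.

Let r2p := Num.sqrt (2 * pi : R).
Let r2p0 : 0 < r2p. Proof. by rewrite sqrtr_gt0 mulr_gt0// pi_gt0. Qed.

(** Constant [C2] in [exp(-(B - c)^2 / (2 s^2)) <= C2 h^(3/2)]: one power of [h] comes from the jump
    intensity, the half power from the peak of the normal density. *)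
Definition exp_const := r2p * s2 * (2 * (M * (l2 * expR l2))).
Let C2 := exp_const.

Let C20 : 0 <= C2.
Proof. by rewrite /C2 /exp_const !mulr_ge0 ?expR_ge0// ltW. Qed.

Section one_step.
Variables g sg la h B : R.
Hypotheses (g0 : 0 <= g <= Gm) (sg0 : s1 <= sg <= s2) (la0 : l1 <= la <= l2).
Hypotheses (h0 : 0 < h) (h1 : h <= 1).
Let c := h * g.
Let s := sg * Num.sqrt h.
Let La := h * la.
Let phi := normal_pdf c s.
Let H := jump_intensity_density phi f La.
Hypothesis Bmin : threshold_minimum f g sg la h B.

Let rh0 : 0 < Num.sqrt h. Proof. by rewrite sqrtr_gt0. Qed.
Let rh1 : Num.sqrt h <= 1. Proof. by rewrite -sqrtr1 ler_wsqrtr. Qed.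
Let rhh : Num.sqrt h * Num.sqrt h = h.
Proof. by rewrite -expr2 sqr_sqrtr// ltW. Qed.
Let sgp : 0 < sg. Proof. by have /andP[? _] := sg0; exact: lt_le_trans s10 _. Qed.
Let sp : 0 < s. Proof. exact: mulr_gt0. Qed.
Let lap : 0 < la. Proof. by have /andP[? _] := la0; exact: lt_le_trans l10 _. Qed.
Let Lap : 0 < La. Proof. exact: mulr_gt0. Qed.
Let c0 : 0 <= c. Proof. by have /andP[? _] := g0; rewrite mulr_ge0// ltW. Qed.
Let cG : c <= h * Gm. Proof. by have /andP[_ ?] := g0; rewrite ler_wpM2l// ltW. Qed.
Let s_sqr : s ^+ 2 = sg ^+ 2 * h. Proof. by rewrite exprMn sqr_sqrtr// ltW. Qed.
Let B0 : 0 <= B. Proof. by have [] := Bmin. Qed.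

Let LaE : La * expR La <= h * (l2 * expR l2).
Proof.
have /andP[_ lal] := la0; rewrite -mulrA ler_wpM2l ?(ltW h0)//.
apply: ler_pM; rewrite ?expR_ge0 ?(ltW lap)//.
by rewrite ler_expR (le_trans _ lal)// /La -[leRHS]mul1r ler_wpM2r// ltW.
Qed.

Let phiE x : phi x = (r2p * s)^-1 * normal_fun c s x.
Proof. by rewrite /phi normal_pdf_nz ?gt_eqF// normal_peakE. Qed.

Lemma minimum_normal_fun_le : normal_fun c s B <= C2 * (h * Num.sqrt h).
Proof.
have [_ Bmin'] := Bmin.
have := minimum_pdf_le sp (ltW Lap) df B0 Bmin'.
rewrite -/phi phiE mulrC ler_pdivrMr ?mulr_gt0// => le1.
apply: le_trans le1 _.
apply: (@le_trans _ _ (2 * (M * (h * (l2 * expR l2))) * (r2p * (s2 * Num.sqrt h)))).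
  have /andP[_ sgs] := sg0.
  apply: ler_pM; rewrite ?mulr_ge0 ?expR_ge0 ?(ltW h0) ?(ltW lap) ?(ltW sgp) ?(ltW r2p0)//.
  - by rewrite ler_wpM2l// ler_wpM2l.
  - by rewrite ler_wpM2l ?(ltW r2p0)// ler_wpM2r// ltW.
by rewrite /C2 /exp_const le_eqVlt; apply/orP; left; apply/eqP; ring.
Qed.

(** The tail factor has half the exponent of the normal density, so it is the square root of a
    quantity of order [h^(3/2)]; the resulting [h^(3/4)] is weakened to [h^(1/2)]. *)
Lemma minimum_tail_le : gauss_tail s (B - c) <= Num.sqrt 2 * Num.sqrt C2 * Num.sqrt h.
Proof.
rewrite -mulrA ler_wpM2l ?sqrtr_ge0//.
have -> : expR (- (B - c) ^+ 2 / (4 * s ^+ 2)) = Num.sqrt (normal_fun c s B).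
  rewrite /normal_fun -[LHS]ger0_norm ?expR_ge0// -sqrtr_sqr; congr Num.sqrt.
  rewrite -expRM_natl; congr expR; rewrite mulr2n; field.
  by rewrite gt_eqF// gt_eqF ?addr_gt0 ?exprn_gt0.
rewrite -sqrtrM// ler_wsqrtr// (le_trans minimum_normal_fun_le)//.
rewrite mulrA -[leRHS]mulr1; apply: ler_wpM2l => //.
by rewrite mulr_ge0// ltW.
Qed.

(** For [0 <= B <= c] the distance [c - B] is of order [h], so the exponent is small and the
    Gaussian factor at least 1/2, whereas at a minimum it is at most [C2 * h]. *)
Lemma drift_lt_minimum :
  h * (Gm ^+ 2 / (2 * s1 ^+ 2)) <= 1 / 4 -> C2 * h <= 1 / 4 -> c < B.
Proof.
move=> hG hC; rewrite ltNge; apply/negP => Bc.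
have : 1 / 2 <= normal_fun c s B.
  rewrite /normal_fun mulNr.
  have : (B - c) ^+ 2 / (s ^+ 2 *+ 2) <= 1 / 4.
    apply: le_trans hG.
    rewrite ler_pdivrMr; last by rewrite mulrn_wgt0// exprn_gt0.
    have Bc2 : (B - c) ^+ 2 <= (h * Gm) ^+ 2.
      rewrite -(sqrrN (B - c)); apply: lerXn2r; rewrite ?nnegrE ?mulr_ge0 ?(ltW h0)//.
        by rewrite opprB subr_ge0.
      by move: cG B0; lra.
    apply: (le_trans Bc2); rewrite s_sqr exprMn.
    have s1s : s1 ^+ 2 <= sg ^+ 2.
      by have /andP[? _] := sg0; apply: lerXn2r; rewrite ?nnegrE ?(ltW s10) ?(ltW sgp).
    have -> : h * (Gm ^+ 2 / (2 * s1 ^+ 2)) * (sg ^+ 2 * h *+ 2) =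
        (h ^+ 2 * Gm ^+ 2) * (sg ^+ 2 / s1 ^+ 2).
      by rewrite mulr2n; field; rewrite gt_eqF.
    rewrite ler_peMr ?(mulr_ge0 (sqr_ge0 _) (sqr_ge0 _))//.
    by rewrite ler_pdivlMr ?exprn_gt0// mul1r.
  have := expR_ge1Dx (- ((B - c) ^+ 2 / (s ^+ 2 *+ 2))).
  by move: (_ / (s ^+ 2 *+ 2)) (expR _) => u v; lra.
have := minimum_normal_fun_le.
have : C2 * (h * Num.sqrt h) <= C2 * h.
  by rewrite ler_wpM2l// ler_piMr// ltW.
by move: (normal_fun _ _ _) (C2 * (h * _)) hC => u v; lra.
Qed.

Hypothesis cB : c < B.

Let Bp : 0 < B. Proof. exact: le_lt_trans cB. Qed.

Let x := 2 * B * g / sg ^+ 2.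
Let x0 : 0 <= x.
Proof. by have /andP[? _] := g0; rewrite divr_ge0 ?sqr_ge0// !mulr_ge0. Qed.

Let S := H B + H (- B).
Let q := (B - c) ^+ 2 / (2 * s ^+ 2).

(** Here [expR (- x)] is the ratio [phi (- B) / phi B]: its exponent [2 B c / s^2] equals [x]
    because the factors [h] in [c] and [s^2] cancel. *)
Lemma minimum_equation : (r2p * s)^-1 * expR (- q) * (1 + expR (- x)) = S.
Proof.
have [_ Bmin'] := Bmin.
have := minimum_first_order sp (ltW Lap) df B0 Bmin' Bp.
rewrite -/phi -/H -/S => <-; rewrite !phiE mulrDr mulr1 -mulrA -expRD.
rewrite /normal_fun /q /x /c s_sqr; congr (_ * expR _ + _ * expR _).
  by rewrite mulNr mulr_natl.
by rewrite mulr2n; field; rewrite !gt_eqF ?addr_gt0 ?exprn_gt0.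
Qed.

Lemma minimum_threshold : B = c + Num.sqrt (2 * h * sg ^+ 2) *
  Num.sqrt (ln (1 + expR (- 2 * B * g / sg ^+ 2)) -
    ln (Num.sqrt (2 * pi * h * sg ^+ 2) * S)).
Proof.
have -> : - 2 * B * g / sg ^+ 2 = - x by rewrite /x; ring.
have ->: Num.sqrt (2 * pi * h * sg ^+ 2) = r2p * s.
  have -> : 2 * pi * h * sg ^+ 2 = (2 * pi) * s ^+ 2 by rewrite s_sqr; ring.
  by rewrite sqrtrM ?mulr_ge0 ?pi_ge0// sqrtr_sqr gtr0_norm.
have e0 : 0 < 1 + expR (- x) by rewrite addr_gt0// expR_gt0.
have rs0 : 0 < r2p * s by rewrite mulr_gt0.
have -> : r2p * s * S = expR (- q) * (1 + expR (- x)).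
  by rewrite -minimum_equation -(mulrA _^-1) mulVKf ?gt_eqF.
rewrite lnM ?posrE ?expR_gt0// expRK opprD opprK addrCA subrr addr0.
have -> : 2 * h * sg ^+ 2 = 2 * s ^+ 2 by rewrite s_sqr; ring.
have s20' : 0 < 2 * s ^+ 2 by rewrite mulr_gt0// exprn_gt0.
rewrite -sqrtrM ?(ltW s20')// /q mulrCA mulfV ?mulr1 ?gt_eqF//.
(* The root of the square is [B - c] and not [c - B] because [c < B]. *)
by rewrite sqrtr_sqr ger0_norm ?subr_ge0 ?(ltW cB)// addrC subrK.
Qed.

(** Stands for [h] to a power below 1/2; the estimates use only the three comparisons that
    follow. *)
Variable hb : R.
Hypothesis rh_hb : Num.sqrt h <= hb.
Hypothesis h_hb : h <= hb.
Hypothesis B_hb : B <= 2 * hb.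

(** Error of the convolutions at [B] and [- B], in units of [hb]: the slope contributes [2 K B], at
    most [4 K hb], and the Gaussian tail the rest. The next constant adds, for each of the two
    points, the contribution of two or more jumps. *)
Definition convolution_const := 4 * K + M * (Num.sqrt 2 * Num.sqrt C2).
Definition intensity_const := 2 * convolution_const + 2 * (M * (l2 * expR l2)).
Let C4 := convolution_const.
Let C5 := intensity_const.

Let hb0 : 0 < hb. Proof. exact: lt_le_trans rh_hb. Qed.

Let conv_approx :
  `|convolution phi f B - A| <= C4 * hb /\ `|convolution phi f (- B) - C| <= C4 * hb.
Proof.
have cB' : 0 <= c <= B by rewrite c0 ltW.
have [a1 a2] := normal_convolution_sides sp df A0M C0M K0 fA fC cB'.
suff le4 : 2 * K * B + M * gauss_tail s (B - c) <= C4 * hb.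
  by split; [exact: le_trans a1 _|exact: le_trans a2 _].
rewrite /C4 /convolution_const [leRHS]mulrDl; apply: lerD.
  have -> : 4 * K * hb = 2 * K * (2 * hb) by ring.
  by rewrite ler_wpM2l// mulr_ge0.
rewrite -mulrA ler_wpM2l// (le_trans minimum_tail_le)//.
by rewrite ler_wpM2l// mulr_ge0 ?sqrtr_ge0.
Qed.

Lemma intensity_ratio : `|S / (La * (A + C)) - 1| <= C5 / (A + C) * hb.
Proof.
have [a1 a2] := conv_approx.
have LaAC : 0 < La * (A + C) by exact: mulr_gt0.
have -> : S / (La * (A + C)) - 1 = (S - La * (A + C)) / (La * (A + C)).
  by rewrite mulrBl mulfV// gt_eqF.
rewrite normrM normfV (gtr0_norm LaAC) ler_pdivrMr//.
have -> : C5 / (A + C) * hb * (La * (A + C)) = La * (C5 * hb).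
  by field; rewrite gt_eqF.
have /andP[b1 b2] := jump_intensity_bounds c sp (ltW Lap) df B.
have /andP[b3 b4] := jump_intensity_bounds c sp (ltW Lap) df (- B).
have r_le : M * (La ^+ 2 * expR La) <= La * (M * (l2 * expR l2) * hb).
  have -> : M * (La ^+ 2 * expR La) = La * (M * (La * expR La)) by ring.
  rewrite ler_wpM2l ?(ltW Lap)// -mulrA ler_wpM2l// (le_trans LaE)//.
  by rewrite mulrC ler_wpM2l// mulr_ge0 ?expR_ge0 ?(ltW l20).
rewrite -/phi -/H in b1 b2 b3 b4.
move: a1; rewrite ler_distl => /andP[a1 a1'].
move: a2; rewrite ler_distl => /andP[a2 a2'].
have m1 := ler_wpM2l (ltW Lap) a1; have m1' := ler_wpM2l (ltW Lap) a1'.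
have m2 := ler_wpM2l (ltW Lap) a2; have m2' := ler_wpM2l (ltW Lap) a2'.
have P0 : 0 <= La * (M * (l2 * expR l2) * hb).
  by rewrite (mulr_ge0 (ltW Lap))// (mulr_ge0 _ (ltW hb0))// (mulr_ge0 M0)// mulr_ge0 ?expR_ge0// ltW.
have C5E : La * (C5 * hb) = 2 * (La * (C4 * hb)) + 2 * (La * (M * (l2 * expR l2) * hb)).
  by rewrite /C5 /intensity_const -/C4; ring.
rewrite C5E mulrDr.
rewrite mulrBr in m1; rewrite mulrDr in m1'; rewrite mulrBr in m2; rewrite mulrDr in m2'.
exact: perturbed_sum_dist b1 b2 b3 b4 r_le P0 m1 m1' m2 m2'.
Qed.

(** The first summand bounds [x], that is, the influence of [phi (- B)]; the second bounds the
    logarithm of the intensity ratio, with a factor 2 lost in linearizing the logarithm. The outer 2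
    is that of [2 * q]. *)
Definition asymptotic_const := 2 * (4 * Gm / s1 ^+ 2 + 2 * (C5 / (A + C))).
Let C6 := asymptotic_const.
Let Q := 3 * ln (1 / h) - 2 * ln (r2p * ((A + C) / 2) * sg * la).

Lemma minimum_exponent : 4 * Gm / s1 ^+ 2 * hb <= 1 / 2 ->
  C5 / (A + C) * hb <= 1 / 2 -> `|2 * q - Q| <= C6 * hb.
Proof.
move=> n1 n2.
have xle : x <= 4 * Gm / s1 ^+ 2 * hb.
  have /andP[g0' gG] := g0; have /andP[s1s _] := sg0.
  rewrite /x.
  have -> : 4 * Gm / s1 ^+ 2 * hb = (2 * (2 * hb) * Gm) / s1 ^+ 2 by ring.
  apply: ler_pM.
  - by rewrite !mulr_ge0.
  - by rewrite invr_ge0 sqr_ge0.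
  - by apply: ler_pM => //; [rewrite mulr_ge0|rewrite ler_wpM2l].
  - by rewrite lef_pV2 ?posrE ?exprn_gt0//; apply: lerXn2r; rewrite ?nnegrE ?(ltW s10) ?(ltW sgp).
(* Both [u] and [v] are close to 1. Normalized by them, the minimum equation has the logarithm [Q]
   plus [2 * (ln u - ln v)]; the [3 / 2 * ln h] in it comes from [La] and [s]. *)
pose u := (1 + expR (- x)) / 2; pose v := S / (La * (A + C)).
have ex1 : expR (- x) <= 1 by rewrite -expR0 ler_expR oppr_le0.
have ex2 := expR_ge1Dx (- x); have ex0 := expR_gt0 (- x).
have u1 : `|u - 1| <= x / 2.
  by rewrite /u ler_distl; move: ex1 ex2; move: (expR _) => z *; apply/andP; split; lra.
have u2 : `|u - 1| <= 1 / 2 by apply: le_trans u1 _; move: xle n1 x0; lra.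
have v1 : `|v - 1| <= C5 / (A + C) * hb := intensity_ratio.
have v2 : `|v - 1| <= 1 / 2 by exact: le_trans n2.
have up : 0 < u by move: u2; rewrite ler_distl => /andP[]; lra.
have vp : 0 < v by move: v2; rewrite ler_distl => /andP[]; lra.
have lnu := ln_le_dist u2; have lnv := ln_le_dist v2.
have rs0 : 0 < r2p * s by rewrite mulr_gt0.
have LaAC : 0 < La * (A + C) by exact: mulr_gt0.
have D0 : 0 < r2p * ((A + C) / 2) * sg * la.
  by rewrite !mulr_gt0// divr_gt0.
have key : expR (- q) * u = v * (r2p * ((A + C) / 2) * sg * la * (h * Num.sqrt h)).
  have := minimum_equation; rewrite -(divfK (lt0r_neq0 LaAC) S) -/v => eq1.
  have := congr1 (fun z => z * (r2p * s) / 2) eq1.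
  have -> : (r2p * s)^-1 * expR (- q) * (1 + expR (- x)) * (r2p * s) / 2 = expR (- q) * u.
    by rewrite /u; move: (r2p * s) rs0 => z z0; field; rewrite gt_eqF.
  by move=> ->; rewrite /s /La; field.
have hr0 : 0 < h * Num.sqrt h by rewrite mulr_gt0.
have lkey : - q + ln u = ln v + (ln (r2p * ((A + C) / 2) * sg * la) + 3 / 2 * ln h).
  have := congr1 (@ln R) key.
  have Dhr0 := mulr_gt0 D0 hr0.
  rewrite (lnM (expR_gt0 _) up) expRK (lnM vp Dhr0) (lnM D0 hr0) => ->.
  rewrite (lnM h0 rh0) -powR12_sqrt ?(ltW h0)// ln_powR.
  by congr (_ + (_ + _)); field.
have lnh : ln (1 / h) = - ln h by rewrite div1r lnV ?posrE.
rewrite /Q lnh.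
have -> : 2 * q - (3 * - ln h - 2 * ln (r2p * ((A + C) / 2) * sg * la)) =
    2 * (ln u - ln v).
  move: lkey; move: (ln h) (ln u) (ln v) (ln _) => *; lra.
rewrite normrM ger0_norm// /C6 /asymptotic_const -mulrA ler_wpM2l//.
apply: le_trans (ler_normB _ _) _.
rewrite [leRHS]mulrDl; apply: lerD.
  by apply: le_trans lnu _; apply: le_trans _ xle; move: u1; lra.
by apply: le_trans lnv _; rewrite -mulrA ler_wpM2l.
Qed.

(** The drift [c] is of order [h] and goes into the error. Since [1 <= Q], the square root does not
    enlarge the error on the exponent, which is then multiplied by [s]. *)
Lemma minimum_asymptotics : 4 * Gm / s1 ^+ 2 * hb <= 1 / 2 ->
  C5 / (A + C) * hb <= 1 / 2 -> 1 <= Q ->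
  `|B - Num.sqrt h * sg * Num.sqrt Q| <= (Gm + s2 * C6) * (Num.sqrt h * hb).
Proof.
move=> n1 n2 Q1; have ex := minimum_exponent n1 n2.
have q0 : 0 <= 2 * q.
  by rewrite mulr_ge0// divr_ge0 ?sqr_ge0// mulr_ge0// sqr_ge0.
have BE : B = c + s * Num.sqrt (2 * q).
  have -> : 2 * q = ((B - c) / s) ^+ 2.
    by rewrite /q expr_div_n; field; rewrite gt_eqF.
  rewrite sqrtr_sqr ger0_norm ?divr_ge0 ?subr_ge0 ?(ltW cB) ?(ltW sp)//.
  by rewrite mulrC divfK ?gt_eqF// addrC subrK.
have -> : B - Num.sqrt h * sg * Num.sqrt Q = c + s * (Num.sqrt (2 * q) - Num.sqrt Q).
  by rewrite {1}BE (mulrC (Num.sqrt h)) -/s mulrBr addrA.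
apply: le_trans (ler_normD _ _) _; rewrite [leRHS]mulrDl; apply: lerD.
  rewrite ger0_norm// (le_trans cG)// mulrC ler_wpM2l//.
  by rewrite -{1}rhh ler_wpM2l// ltW.
rewrite normrM (gtr0_norm sp).
have sqC6 := le_trans (sqrt_dist_le q0 Q1) ex.
apply: (le_trans (ler_wpM2l (ltW sp) sqC6)).
have -> : s2 * C6 * (Num.sqrt h * hb) = s2 * Num.sqrt h * (C6 * hb) by ring.
apply: ler_wpM2r; first exact: le_trans (normr_ge0 _) ex.
by have /andP[_ sgs] := sg0; rewrite ler_wpM2r// ltW.
Qed.

End one_step.
End main_estimates.

(** * Estimates uniform over the ranges of the averaged coefficients *)

Section uniform_estimates.
Context {R : realType}.
Variables (f : R -> R) (M K A C Gm s1 s2 l1 l2 : R).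
Hypothesis rf : regular_density M K A C f.
Hypotheses (Gm0 : 0 <= Gm) (s10 : 0 < s1) (s12 : s1 <= s2).
Hypotheses (l10 : 0 < l1) (l12 : l1 <= l2).

Let AC0 := rd_gt0 rf.
Let K0 := rd_slope rf.
Let M0 : 0 <= M. Proof. by have /andP[] := rd_right rf; exact: le_trans. Qed.
Let s20 : 0 < s2. Proof. exact: lt_le_trans s12. Qed.

Lemma near_drift_lt_minimum : \forall h \near 0^'+, forall g sg la B : R,
  0 <= g <= Gm -> s1 <= sg <= s2 -> l1 <= la <= l2 ->
  threshold_minimum f g sg la h B -> h * g < B.
Proof.
near=> h => g sg la B g0 sg0 la0 Bmin.
have h0 : 0 < h by near: h; exact: nbhs_right_gt.
apply: (drift_lt_minimum rf Gm0 s10 s12 l10 l12 g0 sg0 la0 h0 _ Bmin).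
- by near: h; exact: nbhs_right_le.
- rewrite mulrC; near: h; apply: near_mul_le; last by rewrite divr_gt0.
  by rewrite divr_ge0 ?sqr_ge0// mulr_ge0// sqr_ge0.
- apply: le_trans (ler_wpM2r (ltW h0) (ler_norm _)) _.
  by near: h; apply: near_mul_le; rewrite ?divr_gt0.
Unshelve. all: by end_near. Qed.

(** The exponent [d^2 / (4 s^2)] is at least [h^(2 be - 1) / (16 s2^2)], which tends to infinity
    when [be < 1/2]. *)
Lemma gauss_tail_powR_le (be h s d : R) : 0 < h -> 0 < s -> s <= s2 * Num.sqrt h ->
  h `^ be / 2 <= d ->
  gauss_tail s d <= Num.sqrt 2 * expR (- ((16 * s2 ^+ 2)^-1 * h `^ (- (1 - 2 * be)))).
Proof.
move=> h0 s0 ss2 bd; rewrite ler_wpM2l ?sqrtr_ge0// ler_expR mulNr lerN2.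
have hb0 : 0 < h `^ be by rewrite powR_gt0.
rewrite ler_pdivlMr; last by rewrite mulr_gt0// exprn_gt0.
have s_sqr : s ^+ 2 <= s2 ^+ 2 * h.
  rewrite -[X in _ * X](sqr_sqrtr (ltW h0)) -exprMn.
  by apply: lerXn2r => //; rewrite nnegrE ?(ltW s0)// mulr_ge0 ?sqrtr_ge0// ltW.
have d_sqr : (h `^ be / 2) ^+ 2 <= d ^+ 2.
  apply: lerXn2r => //; rewrite nnegrE ?(le_trans _ bd)// ?divr_ge0 ?powR_ge0//.
apply: le_trans d_sqr.
have -> : h `^ (- (1 - 2 * be)) = (h `^ be) ^+ 2 / h.
  have -> : - (1 - 2 * be) = be + be - 1 by ring.
  by rewrite powRB ?(gt_eqF h0) ?implybT// powRr1 ?ltW// powRD ?(gt_eqF h0) ?implybT.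
have -> : (h `^ be / 2) ^+ 2 =
    (16 * s2 ^+ 2)^-1 * ((h `^ be) ^+ 2 / h) * (4 * (s2 ^+ 2 * h)).
  by field; rewrite !gt_eqF.
rewrite ler_wpM2l//; last by rewrite ler_wpM2l.
by rewrite !(mulr_ge0, invr_ge0, divr_ge0, sqr_ge0) ?ltW.
Qed.

(** Applied at [b = h ^ be], the comparison of losses opposes a Gaussian tail below [h ^ 2] to a
    jump mass of order [h ^ (1 + be)]. *)
Lemma near_minimum_lt_powR (be : R) : 0 < be < 1 / 2 ->
  \forall h \near 0^'+, forall g sg la B : R,
  0 <= g <= Gm -> s1 <= sg <= s2 -> l1 <= la <= l2 ->
  threshold_minimum f g sg la h B -> B < 2 * h `^ be.
Proof.
move=> /andP[be0 be1].
have add_eighth (u v w : R) : u <= w / 8 -> v <= w / 8 -> u + v <= w / 4 by lra.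
have le_half (u v w : R) : 0 < v -> v <= w -> u <= v / 2 -> u <= w by lra.
have sub_half (u v w : R) : v <= w -> u <= v / 2 -> v / 2 <= w - u by lra.
have quarter_lt (u v : R) : 0 < u -> u <= v -> u / 4 < v / 2 by lra.
have dist_ge (u v w e : R) : `|u - v| <= e -> e <= w -> v - w <= u.
  by rewrite ler_distl => /andP[+ _]; lra.
near=> h => g sg la B g0 sg0 la0 Bmin.
have h0 : 0 < h by near: h; exact: nbhs_right_gt.
have h1 : h <= 1 by near: h; exact: nbhs_right_le.
have rh0 : 0 < Num.sqrt h by rewrite sqrtr_gt0.
have hb0 : 0 < h `^ be by rewrite powR_gt0.
have /andP[g0' gG] := g0; have /andP[s1s ss2] := sg0; have /andP[l1l ll2] := la0.
have sgp : 0 < sg := lt_le_trans s10 s1s.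
have lap : 0 < la := lt_le_trans l10 l1l.
have sp : 0 < sg * Num.sqrt h by exact: mulr_gt0.
have Lap : 0 < h * la by exact: mulr_gt0.
have hE : h = h `^ (1 - be) * h `^ be.
  by rewrite -powRD ?(gt_eqF h0) ?implybT// subrK powRr1// ltW.
have cb : h * g <= h `^ be / 2.
  have G2 : Gm * h `^ (1 - be) <= 1 / 2.
    by near: h; apply: near_mul_powR_le => //; lra.
  apply: (@le_trans _ _ (Gm * h `^ (1 - be) * h `^ be)).
    by rewrite -mulrA -hE mulrC ler_wpM2r// ltW.
  by have := ler_wpM2r (ltW hb0) G2; rewrite (mulrC (1 / 2)) mul1r.
have tail (d : R) : h `^ be / 2 <= d -> gauss_tail (sg * Num.sqrt h) d <= h ^+ 2.
  move=> bd; apply: le_trans (gauss_tail_powR_le h0 sp _ bd) _.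
    by rewrite ler_wpM2r// ltW.
  near: h; apply: near_expR_powR_le; last by lra.
  by rewrite invr_gt0 mulr_gt0// exprn_gt0.
have h2h : h ^+ 2 <= h by rewrite expr2 ler_piMl// ltW.
have small : 4 * K * h `^ be + M * h <= (A + C) / 4.
  have : 4 * K * h `^ be <= (A + C) / 8.
    by near: h; apply: near_mul_powR_le; rewrite ?divr_gt0// mulr_ge0.
  have : M * h <= (A + C) / 8 by near: h; apply: near_mul_le; rewrite ?divr_gt0.
  by move=> *; exact: add_eighth.
have sides (x : R) : h `^ be <= x <= 2 * h `^ be ->
    0 <= h * g <= x /\
    2 * K * x + M * gauss_tail (sg * Num.sqrt h) (x - h * g) <= (A + C) / 4.
  move=> /andP[bx xb]; split.
    by apply/andP; split; [rewrite mulr_ge0// ltW|exact: le_half cb].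
  apply: le_trans small; apply: lerD.
    have -> : 4 * K * h `^ be = 2 * K * (2 * h `^ be) by ring.
    by rewrite ler_wpM2l// mulr_ge0.
  rewrite ler_wpM2l// (le_trans _ h2h)// tail//.
  exact: sub_half cb.
(* One of the two lower bounds may be negative when [f] is small on one side of 0; only their sum
   [h * la * (A + C) / 2] has to be positive. *)
apply: (minimum_lt sp (ltW Lap) (rd_bounded rf) Bmin.2 hb0
  (k1 := h * la * (A - (A + C) / 4)) (k2 := h * la * (C - (A + C) / 4))).
- by apply/andP; split; [rewrite mulr_ge0// ltW|exact: le_half cb].
- move=> x /sides[cx le4].
  have /andP[+ _] := jump_intensity_bounds (h * g) sp (ltW Lap) (rd_bounded rf) x.
  apply: le_trans; rewrite ler_wpM2l ?(ltW Lap)//.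
  have [+ _] := normal_convolution_sides sp (rd_bounded rf) (rd_right rf) (rd_left rf)
    K0 (rd_right_slope rf) (rd_left_slope rf) cx.
  by move=> /dist_ge; apply.
- move=> x /sides[cx le4].
  have /andP[+ _] := jump_intensity_bounds (h * g) sp (ltW Lap) (rd_bounded rf) (- x).
  apply: le_trans; rewrite ler_wpM2l ?(ltW Lap)//.
  have [_ +] := normal_convolution_sides sp (rd_bounded rf) (rd_right rf) (rd_left rf)
    K0 (rd_right_slope rf) (rd_left_slope rf) cx.
  by move=> /dist_ge; apply.
- apply: (@le_lt_trans _ _ (h ^+ 2)).
    by apply: tail; exact: sub_half cb.
  have -> : h * la * (A - (A + C) / 4) + h * la * (C - (A + C) / 4) =
    h * (la * (A + C) / 2) by field.
  (* Dividing by [h * h ^ be] leaves [h ^ (1 - be)] against a positive constant. *)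
  rewrite expr2 mulrCA (ltr_pM2l h0) [ltLHS]hE mulrC (ltr_pM2l hb0).
  apply: (@le_lt_trans _ _ (l1 * (A + C) / 4)).
    near: h; apply: near_powR_le; first by lra.
    by rewrite divr_gt0// mulr_gt0.
  have := ler_wpM2r (ltW AC0) l1l; have := mulr_gt0 l10 AC0.
  by move=> *; exact: quarter_lt.
Unshelve. all: by end_near. Qed.

Lemma near_minimum_asymptotics (al e : R) : 0 < al < 1 / 2 -> 0 < e ->
  \forall h \near 0^'+, forall g sg la B : R,
  0 <= g <= Gm -> s1 <= sg <= s2 -> l1 <= la <= l2 ->
  threshold_minimum f g sg la h B ->
  `|B - Num.sqrt h * sg * Num.sqrt (3 * ln (1 / h) -
      2 * ln (Num.sqrt (2 * pi) * ((A + C) / 2) * sg * la))| <=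
  e * h `^ (1 / 2 + al).
Proof.
(* With [be] halfway between [al] and 1/2, the threshold bound still applies, and the error
   [sqrt h * h ^ be] exceeds the required order by [h ^ (be - al)], which absorbs all constants. *)
move=> /andP[al0 al1] e0; pose be := (al + 1 / 2) / 2.
have be0 : 0 < be by rewrite /be; lra.
have be1 : be < 1 / 2 by rewrite /be; lra.
have beal : 0 < be - al by rewrite /be; lra.
have be01 : 0 < be < 1 / 2 by rewrite be0.
pose D := Num.sqrt (2 * pi) * ((A + C) / 2) * s2 * l2.
have r2p0 : 0 < Num.sqrt (2 * pi : R) by rewrite sqrtr_gt0 mulr_gt0// pi_gt0.
pose C7 := Gm + s2 * asymptotic_const M K A C Gm s1 s2 l2.
have exponent_ge1 (u v w : R) :
    u <= v -> v <= `|v| -> w <= - ((1 + 2 * `|v|) / 3) -> 1 <= 3 * - w - 2 * u.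
  by move: `|v| => z; lra.
near=> h => g sg la B g0 sg0 la0 Bmin.
have h0 : 0 < h by near: h; exact: nbhs_right_gt.
have h1 : h <= 1 by near: h; exact: nbhs_right_le.
have hb_le (x : R) : be <= x -> h `^ x <= h `^ be by apply: ger_powR; rewrite h0.
have hb0 := powR_ge0 h be.
have rhE : Num.sqrt h = h `^ (1 / 2) by rewrite -powR12_sqrt ?(ltW h0)// mul1r.
have /andP[s1s ss2] := sg0; have /andP[l1l ll2] := la0.
have cB : h * g < B.
  by move: g sg la B g0 sg0 la0 Bmin {s1s ss2 l1l ll2}; near: h; exact: near_drift_lt_minimum.
have Bb : B < 2 * h `^ be.
  by move: g sg la B g0 sg0 la0 Bmin {s1s ss2 l1l ll2 cB}; near: h; exact: near_minimum_lt_powR.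
have small (k : R) : k * h `^ be <= `|k| * h `^ be by rewrite ler_wpM2r ?ler_norm.
apply: (@le_trans _ _ (C7 * (Num.sqrt h * h `^ be))); last first.
  rewrite (_ : Num.sqrt h * h `^ be = h `^ (be - al) * h `^ (1 / 2 + al)); last first.
    rewrite rhE -!powRD ?(gt_eqF h0) ?implybT//.
    by congr (_ `^ _); ring.
  rewrite mulrA ler_wpM2r ?powR_ge0//.
  apply: (@le_trans _ _ (`|C7| * h `^ (be - al))).
    by rewrite ler_wpM2r ?powR_ge0 ?ler_norm.
  by near: h; exact: near_mul_powR_le.
apply: (minimum_asymptotics rf Gm0 s10 s12 l10 l12 g0 sg0 la0 h0 h1 Bmin cB) => //.
- by rewrite rhE hb_le// ltW.
- by rewrite -[leLHS]powRr1 ?(ltW h0)// hb_le//; lra.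
- exact: ltW.
- apply: le_trans (small _) _.
  by near: h; apply: near_mul_powR_le; rewrite ?normr_ge0// divr_gt0.
- apply: le_trans (small _) _.
  by near: h; apply: near_mul_powR_le; rewrite ?normr_ge0// divr_gt0.
(* Taking [s2] and [l2] in [D] bounds the logarithm for all admissible [sg] and [la], so a single
   condition on [h] makes the quantity under the root at least 1. *)
- have lnD : ln (Num.sqrt (2 * pi) * ((A + C) / 2) * sg * la) <= ln D.
    have sgp : 0 < sg := lt_le_trans s10 s1s.
    have lap : 0 < la := lt_le_trans l10 l1l.
    have l20 : 0 < l2 := lt_le_trans l10 l12.
    have AC20 : 0 < (A + C) / 2 by rewrite divr_gt0.
    have c0 := mulr_gt0 r2p0 AC20.
    rewrite ler_ln ?posrE ?mulr_gt0// /D.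
    apply: ler_pM => //; [by rewrite mulr_ge0 ?(ltW c0) ?(ltW sgp)|exact: ltW|].
    by rewrite ler_wpM2l ?(ltW c0).
  have hD : h <= expR (- ((1 + 2 * `|ln D|) / 3)).
    by near: h; apply: nbhs_right_le; exact: expR_gt0.
  have : ln h <= - ((1 + 2 * `|ln D|) / 3).
    by rewrite -[leRHS]expRK ler_ln ?posrE ?expR_gt0.
  rewrite div1r lnV ?posrE//; have := ler_norm (ln D).
  exact: exponent_ge1 lnD.
Unshelve. all: by end_near. Qed.

End uniform_estimates.

(** * Regularity at 0 of the jump density, and the value of [C0] *)

Section mixture.
Context {R : realType}.
Local Notation mu := (@lebesgue_measure R).
Implicit Types (D : set R) (u : R -> R) (M : R).

(** Within distance [d] of 0 the difference quotient is at most [|g| + 1]; farther away boundedness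
    gives the slope [|M| / d]. The sum of the two serves everywhere on [E]. *)
Lemma slope_at0_le D (E : set R) u M (b g : R) : 0 < b ->
  (forall y, E y -> `|y| < b -> D y) ->
  (forall y, E y -> `|u y - u 0| <= M) ->
  (u y - u 0) / (y - 0) @[y --> within D 0^'] --> g ->
  exists2 K : R, 0 <= K & forall y : R, E y -> `|u y - u 0| <= K * `|y|.
Proof.
move=> b0 ED uM /cvgrPdist_lt /(_ 1 ltr01).
move=> /nbhs_ballP[r /= r0 ru].
pose d := Num.min b r.
have d0 : 0 < d by rewrite lt_min b0.
exists (`|g| + 1 + `|M| / d) => [|y Ey]; first by rewrite !addr_ge0// divr_ge0// ltW.
have [->|y0] := eqVneq y 0; first by rewrite subrr !normr0 mulr0.
have yp : 0 < `|y| by rewrite normr_gt0.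
have [yd|dy] := ltP `|y| d.
  move: yd; rewrite lt_min => /andP[yb yr].
  have := ru y _ y0 (ED y Ey yb); rewrite /ball/= sub0r normrN => /(_ yr).
  rewrite subr0 => near_g.
  have : `|(u y - u 0) / y| <= `|g| + 1.
    rewrite -(subrKC g ((u y - u 0) / y)) (le_trans (ler_normD _ _))//.
    by rewrite lerD2l distrC ltW.
  rewrite normrM normfV ler_pdivrMr// => /le_trans; apply.
  by rewrite ler_wpM2r// lerDl divr_ge0// ltW.
apply: le_trans (uM y Ey) _; apply: le_trans (ler_norm M) _.
apply: (@le_trans _ _ (`|M| / d * `|y|)).
  by rewrite mulrAC -mulrA ler_peMr// ler_pdivlMr// mul1r.
by rewrite ler_wpM2r// lerDr addr_ge0.
Qed.

Lemma Rintegral_itv_bounds (i : interval R) u M (l k v : R) :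
  mu [set` i] = l%:E -> measurable_fun setT u -> (forall x, `|u x| <= M) ->
  (forall x, x \in i -> k <= u x <= v) ->
  k * l <= \int[mu]_(x in [set` i]) u x <= v * l.
Proof.
move=> il mu_ uM uv.
have cstE r : r * l = \int[mu]_(x in [set` i]) r by rewrite Rintegral_cst//= il.
have ic r : mu.-integrable [set` i] (EFin \o cst r).
  by apply: (@itv_bounded_integrable _ _ _ `|r|) => //; rewrite il ltry.
have iu : mu.-integrable [set` i] (EFin \o u).
  apply: (@itv_bounded_integrable _ _ _ M) => //; first by rewrite il ltry.
  exact: measurable_funTS.
rewrite !cstE; apply/andP; split; apply: le_Rintegral => //; try exact: ic;
  by move=> x /= /uv /andP[].
Qed.

Variables (p : R) (fp fm : R -> R) (a b : R).
Hypotheses (p01 : 0 <= p <= 1).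
Hypotheses (dfp : one_sided_density `[0, +oo[ 0^'+ fp).
Hypotheses (dfm : one_sided_density `]-oo, 0] 0^'- fm).
Local Notation f := (mixture_density p fp fm).
Local Notation A := (p * fp 0).
Local Notation C := ((1 - p) * fm 0).

Let p0 : 0 <= p. Proof. by have /andP[] := p01. Qed.
Let q0 : 0 <= 1 - p. Proof. by rewrite subr_ge0; have /andP[] := p01. Qed.
Let p1 : p <= 1. Proof. by have /andP[] := p01. Qed.
Let q1 : 1 - p <= 1. Proof. by rewrite gerBl. Qed.

Lemma mixture_density_ge x : 0 <= x -> f x = p * fp x.
Proof.
move=> x0; rewrite /mixture_density !indicE !mem_setE !in_itv/= x0 ltNge x0/=.
by rewrite mulr1 mulr0 addr0.
Qed.

Lemma mixture_density_lt x : x < 0 -> f x = (1 - p) * fm x.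
Proof.
move=> x0; rewrite /mixture_density !indicE !mem_setE !in_itv/= x0 leNgt x0/=.
by rewrite mulr1 mulr0 add0r.
Qed.

Let f_patchE : f = (fun x => p * (fp \_ (`[0, +oo[ : set R)) x +
  (1 - p) * (fm \_ (`]-oo, 0[ : set R)) x).
Proof. by apply/funext => x; rewrite !patch_indic/= !mulrA. Qed.

Let mfm : measurable_fun (`]-oo, 0[ : set R) fm.
Proof.
apply: measurable_funS (osd_measurable dfm) => // x /=.
by rewrite !in_itv/=; exact: ltW.
Qed.

Let m_patch (D : set R) (u : R -> R) : measurable D -> measurable_fun D u ->
  measurable_fun setT (u \_ D).
Proof. by move=> mD mu_; apply/(measurable_restrict _ mD) => //; rewrite setTI. Qed.

Let fp_ge0 x : 0 <= x -> 0 <= fp x.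
Proof. by move=> x0; apply: (osd_ge0 dfp); rewrite /= in_itv/= x0. Qed.

Let fm_ge0 x : x <= 0 -> 0 <= fm x.
Proof. by move=> x0; apply: (osd_ge0 dfm); rewrite /= in_itv/= x0. Qed.

Lemma mixture_bounded_density : exists M, bounded_density M f /\
  [/\ forall x, 0 <= x -> fp x <= M & forall x, x <= 0 -> fm x <= M].
Proof.
have [Mp fpM] := osd_bounded dfp; have [Mm fmM] := osd_bounded dfm.
have fpM' x : 0 <= x -> fp x <= Num.max Mp Mm.
  by move=> x0; rewrite le_max fpM//= in_itv/= x0.
have fmM' x : x <= 0 -> fm x <= Num.max Mp Mm.
  by move=> x0; rewrite le_max fmM ?orbT//= in_itv/=.
exists (Num.max Mp Mm); split=> //; split.
- rewrite f_patchE; apply: measurable_funD; apply: measurable_funM => //.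
    by apply: m_patch => //; exact: osd_measurable dfp.
  exact: m_patch.
- move=> x; have [x0|x0] := leP 0 x.
    by rewrite mixture_density_ge// mulr_ge0// fp_ge0.
  by rewrite mixture_density_lt// mulr_ge0// fm_ge0// ltW.
- move=> x; have [x0|x0] := leP 0 x.
    by rewrite mixture_density_ge// (le_trans _ (fpM' x x0))// ler_piMl// fp_ge0.
  rewrite mixture_density_lt// (le_trans _ (fmM' x (ltW x0)))// ler_piMl//.
  by rewrite fm_ge0// ltW.
- rewrite f_patchE.
  have patch_ge0 (D : set R) (u : R -> R) : (forall x, D x -> 0 <= u x) ->
      forall x, (0 <= ((u \_ D) x)%:E)%E.
    by move=> u0 x; rewrite lee_fin patchE; case: ifPn => // /set_mem /u0.
  have int_patch (D : set R) (u : R -> R) :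
      (\int[mu]_x ((u \_ D) x)%:E = \int[mu]_(x in D) (u x)%:E)%E.
    by rewrite [RHS]integral_mkcond; apply: eq_integral => x _; rewrite !patchE; case: ifP.
  have mp : measurable_fun setT (EFin \o (fp \_ (`[0, +oo[ : set R))).
    apply/measurable_EFinP; apply: m_patch => //; exact: osd_measurable dfp.
  have mm : measurable_fun setT (EFin \o (fm \_ (`]-oo, 0[ : set R))).
    by apply/measurable_EFinP; exact: m_patch.
  have pp := patch_ge0 _ _ (osd_ge0 dfp).
  have pm : forall x, (0 <= ((fm \_ (`]-oo, 0[ : set R)) x)%:E)%E.
    by apply: patch_ge0 => x /=; rewrite in_itv/= => /ltW; exact: fm_ge0.
  under eq_integral do rewrite EFinD !EFinM.
  rewrite ge0_integralD//; last 4 first.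
  - by move=> x _; rewrite mule_ge0 ?pp ?pm// lee_fin.
  - exact: measurable_funeM.
  - by move=> x _; rewrite mule_ge0 ?pp ?pm// lee_fin.
  - exact: measurable_funeM.
  rewrite !ge0_integralZl_EFin// !int_patch (osd_integral dfp).
  (* The mixture takes [fm] on the open half-line, while its unit mass is on the closed one; the
     endpoint is negligible. *)
  rewrite (integral_itv_bndo_bndc (a := -oo%O)); last exact/measurable_EFinP.
  by rewrite (osd_integral dfm) !mule1 -EFinD addrC subrK.
Qed.

Hypotheses (b0 : 0 < b) (fpC1 : C1_on `[0, b[ fp).
Hypotheses (a0 : a < 0) (fmC1 : C1_on `]a, 0] fm).

Lemma mixture_regular_density : exists M K, regular_density M K A C f.
Proof.
have [M [df [fpM fmM]]] := mixture_bounded_density.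
have dist_le (u v : R) : 0 <= u <= M -> 0 <= v <= M -> `|u - v| <= M.
  by move=> /andP[? ?] /andP[? ?]; rewrite ler_norml; apply/andP; split; lra.
have [gp _ fp_slope] := fpC1; have [gm _ fm_slope] := fmC1.
have [Kp Kp0 fpK] : exists2 K : R, 0 <= K & forall y : R, `[0, +oo[%classic y ->
    `|fp y - fp 0| <= K * `|y|.
  apply: (slope_at0_le (D := `[0, b[) (M := M) b0 _ _ (fp_slope 0 _)).
  - by move=> y /=; rewrite !in_itv/= andbT => y0; rewrite ger0_norm// y0.
  - move=> y /=; rewrite in_itv/= andbT => y0.
    by apply: dist_le; rewrite fp_ge0// fpM.
  - by rewrite /= in_itv/= lexx.
have [Km Km0 fmK] : exists2 K : R, 0 <= K & forall y : R, `]-oo, 0]%classic y ->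
    `|fm y - fm 0| <= K * `|y|.
  apply: (slope_at0_le (D := `]a, 0]) (b := - a) (M := M) _ _ _ (fm_slope 0 _)).
  - by rewrite oppr_gt0.
  - by move=> y /=; rewrite !in_itv/= => y0; rewrite ler0_norm// ltrN2 y0 => ->.
  - move=> y /=; rewrite in_itv/= => y0.
    by apply: dist_le; rewrite fm_ge0// fmM.
  - by rewrite /= in_itv/= a0 lexx.
have fp0 := osd_gt0 dfp; have fm0 := osd_gt0 dfm.
have scale_le (r u v k z : R) : 0 <= r -> r <= 1 -> `|u - v| <= k ->
    k <= z -> `|r * u - r * v| <= z.
  move=> r0 r1 uvk kz; rewrite -mulrBr normrM ger0_norm// (le_trans _ kz)//.
  by rewrite (le_trans _ uvk)// ler_piMl.
exists M, (Num.max Kp Km); split => //.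
- apply/andP; split; first by rewrite mulr_ge0// ltW.
  by rewrite (le_trans _ (fpM 0 _))// ler_piMl// ltW.
- apply/andP; split; first by rewrite mulr_ge0// ltW.
  by rewrite (le_trans _ (fmM 0 _))// ler_piMl// ltW.
(* One of the two limits vanishes when [p] is 0 or 1, but never both. *)
- have [->|pn0] := eqVneq p 0; first by rewrite mul0r add0r subr0 mul1r.
  have pp : 0 < p by rewrite lt_neqAle eq_sym pn0.
  by apply: ltr_pwDl; rewrite mulr_gt0// || rewrite mulr_ge0// ltW.
- by rewrite le_max Kp0.
- move=> y y0; rewrite mixture_density_ge//.
  apply: (scale_le p _ _ _ _ p0 p1 (fpK y _)); first by rewrite /= in_itv/= y0.
  by rewrite ger0_norm// ler_wpM2r// le_max lexx.
- move=> y y0; rewrite mixture_density_lt//.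
  apply: (scale_le (1 - p) _ _ _ _ q0 q1 (fmK y _)); first by rewrite /= in_itv/= ltW.
  by rewrite ltr0_norm// ler_wpM2r ?oppr_ge0 ?(ltW y0)// le_max lexx orbT.
Qed.

End mixture.

(** On [[- h, 0[] and [[0, h]] the density is within [K * h] of [C] and [A] respectively, so the
    mean over both halves tends to their average. *)
Lemma regular_density_C0 (R : realType) (M K A C : R) (f : R -> R) :
  regular_density M K A C f -> C0 f = (A + C) / 2.
Proof.
move=> rf; have df := rd_bounded rf; have K0 := rd_slope rf.
have fM x : `|f x| <= M by rewrite ger0_norm ?(bd_ge0 df)// (bd_le df).
apply: cvg_lim => //; apply/cvgrPdist_le => e e0.
near=> h; have h0 : 0 < h by near: h; exact: nbhs_right_gt.
have Kh : K * h <= e by near: h; exact: near_mul_le.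
have hh : - h <= h by rewrite ge0_cp// ltW.
have m1 : lebesgue_measure (`[0, h] : set R) = h%:E.
  by rewrite lebesgue_measure_cc ?subr0// ltW.
have m2 : lebesgue_measure (`[- h, 0[ : set R) = h%:E.
  by rewrite lebesgue_measure_itv/= lte_fin oppr_lt0 h0 -EFinB sub0r opprK.
have ih : lebesgue_measure.-integrable (`[- h, h] : set R) (EFin \o f).
  apply: (@itv_bounded_integrable _ _ _ M) => //.
    by rewrite lebesgue_measure_cc// ltry.
  exact: measurable_funTS (bd_measurable df).
have near_val (u v w : R) : `|u - v| <= w -> w <= K * h -> v - K * h <= u <= v + K * h.
  by rewrite ler_distl => /andP[? ?] ?; apply/andP; split; lra.
have right_val x : x \in `[0, h] -> A - K * h <= f x <= A + K * h.
  rewrite in_itv/= => /andP[x0 xh]; apply: near_val (rd_right_slope rf x0) _.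
  by rewrite ler_wpM2l.
have left_val x : x \in `[- h, 0[ -> C - K * h <= f x <= C + K * h.
  rewrite in_itv/= => /andP[xh x0]; apply: near_val (rd_left_slope rf x0) _.
  by rewrite ler_wpM2l// lerNl.
have := Rintegral_itv_bounds m1 (bd_measurable df) fM right_val.
have := Rintegral_itv_bounds m2 (bd_measurable df) fM left_val.
have -> : \int[lebesgue_measure]_(x in `[- h, h]) f x =
    \int[lebesgue_measure]_(x in `[- h, 0[) f x + \int[lebesgue_measure]_(x in `[0, h]) f x.
  rewrite -Rintegral_setU//.
  - congr Rintegral; apply/seteqP; split => x /=; rewrite !in_itv/=.
      by move=> /andP[-> ->]; rewrite andbT/=; case: (ltP x 0) => ?; [left|right].
    by move=> [/andP[-> x0]|/andP[x0 ->]]; rewrite ?andbT/=; lra.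
  - apply: integrableS ih => //; first exact: measurableU.
    by move=> x [/=|/=]; rewrite !in_itv/= => /andP[? ?]; apply/andP; split; lra.
  - apply/disj_setPS => x [/=]; rewrite !in_itv/= => /andP[_ ?] /andP[? _].
    by lra.
move: (Rintegral _ _ _) (Rintegral _ _ _) => u v /andP[u1 u2] /andP[v1 v2].
rewrite (_ : _ - _ = (2 * h)^-1 * ((A + C) * h - (u + v))); last first.
  by field; rewrite gt_eqF.
rewrite normrM ger0_norm ?invr_ge0 ?mulr_ge0 ?(ltW h0)// mulrC ler_pdivrMr ?mulr_gt0//.
have eh : K * h * h <= e * h by rewrite ler_wpM2r// ltW.
by rewrite ler_norml; apply/andP; split; lra.
Unshelve. all: by end_near. Qed.

(** Shifting the index and splitting each term turns the series at the two points into two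
    convergent series. *)
Lemma jump_intensity_series (R : realType) (c s La M : R) (f : R -> R) (x : R) :
  0 < s -> 0 <= La -> bounded_density M f ->
  \big[+%R/0]_(1 <= k <oo) (La ^+ k / k`!%:R *
    (convolution (normal_pdf c s) (convolution_power f k) x +
     convolution (normal_pdf c s) (convolution_power f k) (- x))) =
  jump_intensity_density (normal_pdf c s) f La x +
  jump_intensity_density (normal_pdf c s) f La (- x).
Proof.
move=> s0 La0 df.
have dfk k : bounded_density M (convolution_power f k.+1).
  rewrite -(convolution_sequence_cst f 0).
  exact: (convolution_sequence_bounded_density _ _ (fun=> df)).
have ge0 y k : 0 <= convolution (normal_pdf c s) (convolution_power f k.+1) y.
  have sn0 : s != 0 by rewrite gt_eqF.
  exact: (bd_ge0 (convolution_bounded_density (normal_pdf_bounded_density c sn0) (dfk k))).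
have leM y k : convolution (normal_pdf c s) (convolution_power f k.+1) y <= M.
  exact: normal_convolution_le (dfk k).
apply: cvg_lim => //; rewrite -cvg_shiftS.
rewrite (_ : [sequence _]_n = (fun n =>
  \sum_(0 <= k < n) La ^+ k.+1 / k.+1`!%:R *
    convolution (normal_pdf c s) (convolution_power f k.+1) x +
  \sum_(0 <= k < n) La ^+ k.+1 / k.+1`!%:R *
    convolution (normal_pdf c s) (convolution_power f k.+1) (- x))); last first.
  apply/funext => n /=; rewrite big_add1/= -big_split/=.
  by apply: eq_bigr => k _; rewrite mulrDr.
by apply: (@cvgD _ R^o); [exact: cvg_power_weighted_series (ge0 x) (leM x)|
  exact: cvg_power_weighted_series (ge0 (- x)) (leM (- x))].
Qed.

(** * Replacing averaged coefficients by their values at [t] *)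

Section lipschitz.
Context {R : realType}.
Implicit Types (g : R -> R).

Lemma is_derive_quotient g (x l : R) :
  (g y - g x) / (y - x) @[y --> x^'] --> l -> is_derive x 1 g l.
Proof.
move=> gl.
have gl' : h^-1 *: ((g \o shift x) (h *: 1) - g x) @[h --> 0^'] --> l.
  apply/cvgrPdist_lt => e e0.
  have := gl => /cvgrPdist_lt /(_ e e0) /nbhs_ballP[r /= r0 rg].
  apply/nbhs_ballP; exists r => // h /=; rewrite /ball/= sub0r normrN => hr h0.
  have := rg (h + x); rewrite /ball/= addrK opprD addrCA subrr addr0 normrN => /(_ hr).
  have -> : h + x != x by rewrite -subr_eq0 addrK.
  by move=> /(_ isT); rewrite /GRing.scale/= mulr1 mulrC.
apply: DeriveDef; first by apply/cvg_ex; exists l.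
exact: cvg_lim gl'.
Qed.

Lemma C1_on_lipschitz g (a b u v : R) : a < u -> v < b -> C1_on `]a, b[ g ->
  exists2 K, 0 <= K & forall x y, u <= x -> x <= y -> y <= v ->
    `|g y - g x| <= K * (y - x).
Proof.
move=> au vb [dg cdg gdg].
have [uv|vu] := leP u v; last first.
  by exists 0 => // x y ux xy yv; have := le_trans ux (le_trans xy yv); rewrite leNgt vu.
have sub x y : u <= x -> y <= v -> `[x, y]%classic `<=` `]a, b[%classic.
  move=> ux yv z /=; rewrite !in_itv/= => /andP[xz zy].
  by rewrite (lt_le_trans au (le_trans ux xz)) (le_lt_trans (le_trans zy yv) vb).
have cndg : {within `[u, v], continuous (fun x => `|dg x|)}.
  have := continuous_subspaceW (sub u v (lexx _) (lexx _)) cdg.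
  by move=> cdg' x; apply: cvg_norm; exact: cdg'.
have [c _ cmax] := EVT_max uv cndg.
have gder x : x \in `]a, b[ -> is_derive x 1 g (dg x).
  move=> xab; apply: is_derive_quotient.
  have := gdg x xab; apply: cvg_trans; apply: cvg_app => P nP.
  (* The interval is open, so the limit along it is the full limit at [x]. *)
  have : nbhs x (`]a, b[%classic : set R).
    by apply: open_nbhs_nbhs; split => //; exact: interval_open.
  move=> nab.
  have {}nP : nbhs x (fun y => y != x -> `]a, b[%classic y -> P y) := nP.
  suff : nbhs x (fun y => y != x -> P y) by [].
  by apply: filterS2 nab nP => y yab yP yx; exact: yP.
exists `|dg c| => // x y ux xy yv.
have := xy; rewrite le_eqVlt => /predU1P[->|xy']; first by rewrite !subrr normr0 mulr0.
have gxy z : z \in `]x, y[ -> is_derive z 1 g (dg z).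
  rewrite in_itv/= => /andP[xz zy]; apply: gder.
  by apply: (sub x y) => //=; rewrite in_itv/= !ltW.
have cg : {within `[x, y], continuous g}.
  apply: continuous_in_subspaceT => z; rewrite inE/= => zxy.
  have /gder dz : z \in `]a, b[ by exact: (sub x y).
  by apply: differentiable_continuous; apply/derivable1_diffP; exact: ex_derive.
have [z zxy ->] := MVT_segment xy gxy cg.
rewrite normrM [X in _ * X]ger0_norm ?subr_ge0// ler_wpM2r ?subr_ge0//.
apply: cmax; move: zxy; rewrite !in_itv/= => /andP[xz zy].
by rewrite (le_trans ux xz) (le_trans zy yv).
Unshelve. all: by end_near. Qed.

Lemma ln_lipschitz (m x y : R) : 0 < m -> m <= x -> m <= y ->
  `|ln x - ln y| <= `|x - y| / m.
Proof.
have oneside (u v : R) : 0 < m -> m <= u -> m <= v -> ln u - ln v <= `|u - v| / m.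
  move=> m0 mu_ mv; have u0 := lt_le_trans m0 mu_; have v0 := lt_le_trans m0 mv.
  rewrite -ln_div ?posrE//.
  have -> : u / v = 1 + (u - v) / v by field; rewrite gt_eqF.
  apply: le_trans (le_ln1Dx _) _.
    by rewrite mulrBl mulfV ?gt_eqF// ltrBrDl subrr divr_gt0.
  apply: (@le_trans _ _ (`|u - v| / v)).
    by rewrite ler_wpM2r ?invr_ge0 ?(ltW v0)// ler_norm.
  by rewrite ler_wpM2l// lef_pV2.
move=> m0 mx my; rewrite ler_norml; apply/andP; split; last exact: oneside.
by rewrite lerNl opprB distrC; exact: oneside.
Qed.

(** A crude bound on the logarithm suffices: multiplied by a perturbation of order [h], it leaves a
    factor [sqrt h]. *)
Lemma ln_inv_le (h : R) : 0 < h -> ln (1 / h) <= 2 * (Num.sqrt h)^-1.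
Proof.
move=> h0; have r0 : 0 < (Num.sqrt h)^-1 by rewrite invr_gt0 sqrtr_gt0.
have -> : 1 / h = (Num.sqrt h)^-1 * (Num.sqrt h)^-1.
  by rewrite -invfM -expr2 sqr_sqrtr ?div1r// ltW.
rewrite lnM ?posrE//.
have : ln (Num.sqrt h)^-1 <= (Num.sqrt h)^-1.
  rewrite -[X in ln X](subrK 1) addrC.
  by apply: le_trans (le_ln1Dx _) _; lra.
by lra.
Qed.

Variables (c s1 s2 l1 l2 k : R).
Hypotheses (c0 : 0 < c) (s10 : 0 < s1) (l10 : 0 < l1) (k0 : 0 <= k).
Local Notation lead h s l :=
  (Num.sqrt h * s * Num.sqrt (3 * ln (1 / h) - 2 * ln (c * s * l))).

(** Perturbing [s] and [l] by [O(h)] changes the leading term by [O(h)], which is of smaller order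
    than [h ^ (1 / 2 + al)] because [al < 1 / 2]. *)
Lemma near_leading_dist (al e : R) : 0 < al < 1 / 2 -> 0 < e ->
  \forall h \near 0^'+, forall s s' l l' : R,
    s1 <= s <= s2 -> s1 <= s' <= s2 -> l1 <= l <= l2 -> l1 <= l' <= l2 ->
    `|s - s'| <= k * h -> `|l - l'| <= k * h ->
    `|lead h s l - lead h s' l'| <= e * h `^ (1 / 2 + al).
Proof.
move=> /andP[al0 al1] e0.
pose D := ln (c * s1 * l1); pose E := ln (c * s2 * l2).
(* [C1] accounts for the change of the factor [s], multiplied by the root; [C2] for the change of
   the two logarithms under the root. *)
pose C1 := k * (6 + 2 * `|D|).
pose C2 := `|s2| * (2 * (k / s1 + k / l1)).
have C10 : 0 <= C1 by rewrite mulr_ge0// addr_ge0// mulr_ge0.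
have C20 : 0 <= C2 by rewrite mulr_ge0// mulr_ge0// addr_ge0// divr_ge0// ltW.
have exponent_ge1 (u v w : R) :
    u <= v -> v <= `|v| -> w <= - ((1 + 2 * `|v|) / 3) -> 1 <= 3 * - w - 2 * u.
  by move: `|v| => z; lra.
have exponent_le (u v w r : R) : v <= u -> - v <= `|v| -> w <= 2 * r -> 1 <= r ->
    3 * w - 2 * u <= (6 + 2 * `|v|) * r.
  move=> vu vv wr r1; have := ler_wpM2l (normr_ge0 v) r1.
  by move: `|v| vv => z; lra.
near=> h => s s' l l' /andP[s1s ss2] /andP[s1s' ss2'] /andP[l1l ll2] /andP[l1l' ll2'] sk lk.
have h0 : 0 < h by near: h; exact: nbhs_right_gt.
have h1 : h <= 1 by near: h; exact: nbhs_right_le.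
have rh0 : 0 < Num.sqrt h by rewrite sqrtr_gt0.
have rh1 : Num.sqrt h <= 1 by rewrite -sqrtr1 ler_wsqrtr.
have rhh : Num.sqrt h * Num.sqrt h = h by rewrite -expr2 sqr_sqrtr// ltW.
have ri1 : 1 <= (Num.sqrt h)^-1 by rewrite invf_ge1.
have hE : h <= expR (- ((1 + 2 * `|E|) / 3)).
  by near: h; apply: nbhs_right_le; exact: expR_gt0.
have lnhE : ln h <= - ((1 + 2 * `|E|) / 3).
  by rewrite -[leRHS]expRK ler_ln ?posrE ?expR_gt0.
have lnh : ln (1 / h) = - ln h by rewrite div1r lnV ?posrE.
have pos (u v : R) : s1 <= u -> l1 <= v -> 0 < c * u /\ 0 < v.
  move=> su lv; split; last exact: lt_le_trans lv.
  by rewrite mulr_gt0// (lt_le_trans _ su).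
have lnle (u v u' v' : R) : s1 <= u -> l1 <= v -> u <= u' -> v <= v' ->
    ln (c * u * v) <= ln (c * u' * v').
  move=> su lv uu' vv'; have [cu vp] := pos u v su lv.
  have [cu' vp'] := pos u' v' (le_trans su uu') (le_trans lv vv').
  rewrite ler_ln ?posrE ?(mulr_gt0 cu vp) ?(mulr_gt0 cu' vp')//.
  apply: ler_pM => //; [exact: ltW|exact: ltW|].
  by rewrite ler_pM2l.
have Q1 (u v : R) : s1 <= u -> u <= s2 -> l1 <= v -> v <= l2 ->
    1 <= 3 * ln (1 / h) - 2 * ln (c * u * v).
  move=> *; rewrite lnh; apply: (@exponent_ge1 _ E) => //; last exact: ler_norm.
  exact: lnle.
have Qle (u v : R) : s1 <= u -> l1 <= v ->
    3 * ln (1 / h) - 2 * ln (c * u * v) <= (6 + 2 * `|D|) * (Num.sqrt h)^-1.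
  move=> *; apply: exponent_le => //; first exact: lnle.
    by rewrite -normrN ler_norm.
  exact: ln_inv_le.
have := Q1 s l s1s ss2 l1l ll2; have := Q1 s' l' s1s' ss2' l1l' ll2'.
have := Qle s l s1s l1l.
have Qdist : `|(3 * ln (1 / h) - 2 * ln (c * s * l)) - (3 * ln (1 / h) - 2 * ln (c * s' * l'))| <=
    2 * (k / s1 + k / l1) * h.
  have [cs lp] := pos s l s1s l1l; have [cs' lp'] := pos s' l' s1s' l1l'.
  have sp := lt_le_trans s10 s1s; have sp' := lt_le_trans s10 s1s'.
  rewrite (lnM cs lp) (lnM cs' lp') (lnM c0 sp) (lnM c0 sp').
  rewrite (_ : _ - _ = 2 * ((ln s' - ln s) + (ln l' - ln l))); last by ring.
  rewrite normrM ger0_norm// -mulrA ler_wpM2l// (le_trans (ler_normD _ _))//.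
  rewrite mulrDl; apply: lerD.
    apply: le_trans (ln_lipschitz s10 s1s' s1s) _.
    by rewrite distrC mulrAC ler_wpM2r// invr_ge0 ltW.
  apply: le_trans (ln_lipschitz l10 l1l' l1l) _.
  by rewrite distrC mulrAC ler_wpM2r// invr_ge0 ltW.
move: Qdist.
move: (3 * _ - _) (3 * _ - _) => Q' Q Qd Qle' Q'1 Q1'.
(* Because [1 <= Q], the bound already known for [Q] also bounds its root. *)
have rQ : Num.sqrt Q <= Q.
  rewrite -[leRHS]ger0_norm ?(le_trans _ Q1')// -sqrtr_sqr ler_wsqrtr// expr2.
  by rewrite ler_peMl// (le_trans _ Q1').
have step : `|Num.sqrt h * s * Num.sqrt Q - Num.sqrt h * s' * Num.sqrt Q'| <=
    Num.sqrt h * (C1 * Num.sqrt h + C2 * h).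
  rewrite (_ : _ - _ = Num.sqrt h * ((s - s') * Num.sqrt Q + s' * (Num.sqrt Q - Num.sqrt Q'))); last by ring.
  rewrite normrM (gtr0_norm rh0) ler_wpM2l ?(ltW rh0)// (le_trans (ler_normD _ _))//.
  apply: lerD; rewrite normrM.
    apply: (@le_trans _ _ (k * h * ((6 + 2 * `|D|) * (Num.sqrt h)^-1))).
      apply: ler_pM => //; rewrite ger0_norm ?sqrtr_ge0//.
      exact: le_trans rQ Qle'.
    by rewrite /C1 -{1}rhh le_eqVlt; apply/orP; left; apply/eqP; field; rewrite gt_eqF.
  rewrite /C2 -mulrA; apply: ler_pM => //.
    have sp' := lt_le_trans s10 s1s'.
    by rewrite gtr0_norm// (le_trans ss2')// ler_norm.
  by apply: le_trans Qd; apply: sqrt_dist_le => //; exact: le_trans Q1'.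
apply: (le_trans step).
have rhE : Num.sqrt h = h `^ (1 / 2) by rewrite -powR12_sqrt ?(ltW h0)// mul1r.
rewrite powRD ?(gt_eqF h0) ?implybT// -rhE mulrCA ler_wpM2l ?(ltW rh0)//.
apply: (@le_trans _ _ ((C1 + C2) * Num.sqrt h)).
  by rewrite mulrDl lerD2l ler_wpM2l// -[leLHS]rhh ler_piMl// ltW.
have -> : Num.sqrt h = h `^ (1 / 2 - al) * h `^ al.
  by rewrite -powRD ?(gt_eqF h0) ?implybT// subrK.
rewrite mulrA ler_wpM2r ?powR_ge0//.
by near: h; apply: near_mul_powR_le; rewrite ?addr_ge0// subr_gt0.
Unshelve. all: by end_near. Qed.

End lipschitz.

Lemma average_dist (R : realType) (g : R -> R) (t h K : R) :
  0 <= t -> 0 < h -> 0 <= K -> measurable_fun (`[0, +oo[ : set R) g ->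
  (forall s, t <= s <= t + h -> `|g s - g t| <= K * (s - t)) ->
  `|average g t h - g t| <= K * h.
Proof.
move=> t0 h0 K0 mg gK; rewrite ler_distl; apply: average_bounded => // s ts.
have /andP[_ sh] := ts; rewrite -ler_distl (le_trans (gK s ts))//.
by rewrite ler_wpM2l// lerBlDl.
Qed.

(** * From the uniform estimates to the three claims *)

Theorem theorem2p2 (R : realType) (d : measure_display)
    (Omega : measurableType d) (P : probability Omega R)
    (gamma sigma lambda : R -> R)
    (p : R) (fp fm : R -> R) (a b : R)
    (W : R -> {RV P >-> R}) (I : R -> {RV P >-> R})
    (N : R -> {RV P >-> nat}) (zeta : nat -> {RV P >-> R})
    (f := mixture_density p fp fm)
    (X := jump_diffusion gamma (fun t => I t : Omega -> R)
            (fun t => N t : Omega -> nat) (fun j => zeta j : Omega -> R))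
    (L := loss P X (fun t => N t : Omega -> nat))
    (* coefficients *)
    (hgamma_meas : measurable_fun (`[0, +oo[ : set R) gamma)
    (hlambda_meas : measurable_fun (`[0, +oo[ : set R) lambda)
    (hgamma : locally_bounded_away gamma)
    (hsigma : locally_bounded_away sigma)
    (hlambda : locally_bounded_away lambda)
    (hsigma_cont : {within `[0, +oo[, continuous sigma})
    (* jump density *)
    (hp : 0 <= p <= 1)
    (hfp : one_sided_density `[0, +oo[ 0^'+ fp)
    (hfm : one_sided_density `]-oo, 0] 0^'- fm)
    (hb : 0 < b) (hfp_C1 : C1_on `[0, b[ fp)
    (ha : a < 0) (hfm_C1 : C1_on `]a, 0] fm)
    (* driving processes *)
    (hW : wiener_process W)
    (hI : forall t, 0 <= t ->
       is_wiener_integral P (fun s => W s : Omega -> R) sigma t (I t))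
    (hN : poisson_process lambda N)
    (hzeta : iid_with_density f zeta)
    (hindep : independent3 P
       (generated_sigma_algebra `[0, +oo[ (fun t => W t : Omega -> R))
       (generated_sigma_algebra `[0, +oo[ (fun t => N t : Omega -> nat))
       (generated_sigma_algebra setT (fun j => zeta j : Omega -> R)))
    (T : R) (hT : 0 < T) :
  (exists2 h0 : R, 0 < h0 &
     forall t h, 0 <= t <= T -> 0 < h < h0 ->
     forall B, unique_global_minimum (L t h) B ->
       B = threshold_rhs gamma sigma lambda f t h B)
  /\
  (forall alpha, 0 < alpha < 1 / 2 -> forall e, 0 < e ->
     \forall h \near 0^'+, forall t, 0 <= t <= T ->
     forall B, unique_global_minimum (L t h) B ->
       `|B - threshold_leading f h (sigma_bar sigma t h) (average lambda t h)|
         <= e * h `^ (1 / 2 + alpha))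
  /\
  (C1_on `]0, T[ (fun t => sigma t ^+ 2) -> C1_on `]0, T[ lambda ->
   {within `[0, T], continuous (fun t => sigma t ^+ 2)} ->
   {within `[0, T], continuous lambda} ->
   forall alpha, 0 < alpha < 1 / 2 ->
   forall t1 t2, 0 < t1 -> t2 < T -> forall e, 0 < e ->
     \forall h \near 0^'+, forall t, t1 <= t <= t2 ->
     forall B, unique_global_minimum (L t h) B ->
       `|B - threshold_leading f h (sigma t) (lambda t)|
         <= e * h `^ (1 / 2 + alpha)).
Proof.
have [M [K rf]] := mixture_regular_density hp hfp hfm hb hfp_C1 ha hfm_C1.
have df := rd_bounded rf.
(* Bounds on [[0, T + 1]] cover every window [[t, t + h]] with [t <= T] and [h <= 1]. *)
have T1 : 0 < T + 1 by rewrite addr_gt0.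
have [g1 [g2 [g10 g12 gb]]] := locally_bounded_awayP T1 hgamma.
have [s1 [s2 [s10 s12 sb]]] := locally_bounded_awayP T1 hsigma.
have [l1 [l2 [l10 l12 lb]]] := locally_bounded_awayP T1 hlambda.
have g20 : 0 <= g2 by rewrite (le_trans (ltW g10)).
have coefs t h : 0 <= t <= T -> 0 < h -> h <= 1 ->
    [/\ 0 <= average gamma t h <= g2, s1 <= sigma_bar sigma t h <= s2 &
        l1 <= average lambda t h <= l2].
  move=> /andP[t0 tT] h0 h1.
  have in_T1 s : t <= s <= t + h -> 0 <= s <= T + 1.
    by move=> /andP[ts sh]; rewrite (le_trans t0 ts) (le_trans sh)// lerD.
  split.
  - have /andP[gl gr] := average_bounded t0 h0 hgamma_meas (fun s ts => gb s (in_T1 s ts)).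
    by rewrite gr (le_trans (ltW g10) gl).
  - apply: sigma_bar_bounded => //; [exact: ltW|exact: le_trans (ltW s10) s12|].
    by move=> s /in_T1 /sb.
  - exact: average_bounded t0 h0 hlambda_meas (fun s ts => lb s (in_T1 s ts)).
have Lmin t h B : 0 <= t <= T -> 0 < h -> h <= 1 -> unique_global_minimum (L t h) B ->
    threshold_minimum f (average gamma t h) (sigma_bar sigma t h) (average lambda t h) h B.
  move=> tT h0 h1 [B0 Bmin]; split => // C C0.
  have [_ /andP[s1b _] /andP[l1b _]] := coefs t h tT h0 h1.
  have /andP[t0 _] := tT.
  have s0 : 0 < sigma_bar sigma t h * Num.sqrt h.
    by apply: mulr_gt0; [exact: lt_le_trans s1b|rewrite sqrtr_gt0].
  have La0 : 0 <= h * average lambda t h.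
    by rewrite mulr_ge0 ?(ltW h0)// (le_trans (ltW l10)).
  (* The strict inequality of the unique minimum concerns [C <> B] only; equality is trivial for the
     weak one. *)
  have [->//|/eqP CB] := eqVneq C B.
  have := Bmin C C0 CB; rewrite /L /X.
  rewrite !(loss_formula hgamma_meas hlambda_meas hgamma hlambda hsigma
    hsigma_cont df hW hI hN hzeta hindep t0 h0).
  rewrite (loss_real _ s0 La0 df B0) (loss_real _ s0 La0 df C0) lte_fin.
  by rewrite ltr_pM2l ?expR_gt0// ltrD2l => /ltW.
split; last split.
- have /nbhs_ballP[r /= r0 cB] := near_drift_lt_minimum rf g20 s10 s12 l10 l12.
  (* The radius of the neighbourhood serves as [h0], capped at 1 so that the coefficient bounds
     apply. *)
  exists (Num.min r 1) => [|t h tT /andP[h0]]; first by rewrite lt_min r0 ltr01.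
  rewrite lt_min => /andP[hr /ltW h1] B /(Lmin t h B tT h0 h1) Bmin.
  have [gt st lt] := coefs t h tT h0 h1.
  have hball : ball 0 r h by rewrite /ball/= sub0r normrN gtr0_norm.
  have cBt := cB h hball h0 _ _ _ _ gt st lt Bmin.
  have /andP[s1b _] := st; have /andP[l1b _] := lt.
  have sb0 : 0 < sigma_bar sigma t h by exact: lt_le_trans s1b.
  have s0 : 0 < sigma_bar sigma t h * Num.sqrt h.
    by apply: mulr_gt0; rewrite // sqrtr_gt0.
  have La0 : 0 <= h * average lambda t h.
    by rewrite mulr_ge0 ?(ltW h0)// (le_trans (ltW l10)).
  rewrite /threshold_rhs.
  have -> : phi_th gamma sigma t h =
      normal_pdf (h * average gamma t h) (sigma_bar sigma t h * Num.sqrt h).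
    by apply/funext => x; exact: phi_thE.
  rewrite (jump_intensity_series _ _ s0 La0 df).
  exact: (minimum_threshold rf s10 l10 gt st lt h0 Bmin cBt).
- move=> al al01 e e0; near=> h => t tT B.
  have h0 : 0 < h by near: h; exact: nbhs_right_gt.
  have h1 : h <= 1 by near: h; exact: nbhs_right_le.
  move=> /(Lmin t h B tT h0 h1); have [gt st lt] := coefs t h tT h0 h1.
  rewrite /threshold_leading (regular_density_C0 rf).
  move: (average gamma t h) (sigma_bar sigma t h) (average lambda t h) B gt st lt.
  by near: h; exact: (near_minimum_asymptotics rf).
- move=> sigma_C1 lambda_C1 _ _ al al01 t1 t2 t10 t2T e e0.
  (* For [h <= u - t2] the window stays in [[t1, u]], a compact part of []0, T[] where the
     coefficients are Lipschitz. *)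
  pose u := (t2 + T) / 2.
  have t2u : t2 < u by rewrite /u; lra.
  have uT : u < T by rewrite /u; lra.
  have [Ks Ks0 sK] := C1_on_lipschitz t10 uT sigma_C1.
  have [Kl Kl0 lK] := C1_on_lipschitz t10 uT lambda_C1.
  pose k := Ks / s1 + Kl.
  have k0 : 0 <= k by rewrite addr_ge0// divr_ge0// ltW.
  pose c := Num.sqrt (2 * pi) * C0 f.
  have c0 : 0 < c.
    rewrite mulr_gt0 ?sqrtr_gt0 ?mulr_gt0 ?pi_gt0// (regular_density_C0 rf).
    by rewrite divr_gt0// (rd_gt0 rf).
  have e20 : 0 < e / 2 by rewrite divr_gt0.
  near=> h => t /andP[tt1 tt2] B.
  have h0 : 0 < h by near: h; exact: nbhs_right_gt.
  have h1 : h <= 1 by near: h; exact: nbhs_right_le.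
  have hu : h <= u - t2 by near: h; apply: nbhs_right_le; rewrite subr_gt0.
  have t0 : 0 <= t by rewrite (le_trans (ltW t10)).
  have tT : 0 <= t <= T by rewrite t0 (le_trans tt2)// ltW.
  move=> /(Lmin t h B tT h0 h1) Bmin; have [gt st lt] := coefs t h tT h0 h1.
  have thu : t + h <= u by rewrite -(subrKC t2 u) lerD.
  have tT1 : 0 <= t <= T + 1 by have /andP[-> /le_trans->] := tT; rewrite ?lerDl.
  have /andP[s1t _] := sb t tT1; have /andP[s1b _] := st.
  have ld : `|average lambda t h - lambda t| <= k * h.
    apply: (@le_trans _ _ (Kl * h)).
      apply: average_dist => // s /andP[ts sh]; apply: lK => //.
      exact: le_trans thu.
    by rewrite ler_wpM2r ?(ltW h0)// lerDr divr_ge0// ltW.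
  have sd : `|sigma_bar sigma t h - sigma t| <= k * h.
    have sd2 : `|sigma_bar sigma t h ^+ 2 - sigma t ^+ 2| <= Ks * h.
      have -> : sigma_bar sigma t h ^+ 2 = average (fun s => sigma s ^+ 2) t h.
        by rewrite /average -(sigma_bar_sqr sigma t0 h0) mulrC mulfK ?gt_eqF.
      apply: average_dist => //; first exact: measurable_sigma2.
      by move=> s /andP[ts sh]; apply: sK => //; exact: le_trans thu.
    apply: (@le_trans _ _ (Ks / s1 * h)); last first.
      by rewrite ler_wpM2r ?(ltW h0)// lerDl.
    (* Passing from squares to [sigma] divides by the sum of the two values, which is at least
       [s1]. *)
    rewrite mulrAC ler_pdivlMr//; apply: le_trans sd2.
    rewrite subr_sqr normrM ler_wpM2l// ger0_norm; last first.
      by rewrite addr_ge0// (le_trans (ltW s10)).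
    by rewrite ler_wpDr// (le_trans (ltW s10)).
  (* One half pays for the asymptotics with averages, the other for replacing the averages by values
     at [t]. *)
  have -> : e = e / 2 + e / 2 by field.
  rewrite mulrDl -(subrKA (threshold_leading f h (sigma_bar sigma t h) (average lambda t h))).
  apply: le_trans (ler_normD _ _) _; apply: lerD.
    rewrite /threshold_leading (regular_density_C0 rf).
    move: (average gamma t h) (sigma_bar sigma t h) (average lambda t h) B gt st lt Bmin {s1b ld sd}.
    by near: h; exact: (near_minimum_asymptotics rf).
  rewrite /threshold_leading -/c.
  move: (sigma_bar sigma t h) (sigma t) (average lambda t h) (lambda t)
    st (sb t tT1) lt (lb t tT1) sd ld {gt Bmin s1t s1b}.
  by near: h; exact: near_leading_dist.
Unshelve. all: by end_near. Qed.
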